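(* Assume $\eta_p^{\mathrm{LS}}>0$ and $\eta_d^{\mathrm{LS}}>0$. The indicators $$\eta_K^2=\frac12\left(\frac{\eta_d^{\mathrm{LS}}}{\eta_p^{\mathrm{LS}}}(\eta_{p,K}^{\mathrm{LS}})^2+\frac{\eta_p^{\mathrm{LS}}}{\eta_d^{\mathrm{LS}}}(\eta_{d,K}^{\mathrm{LS}})^2\right),\qquad K\in\mathcal T_h,$$ satisfy $$\sum_{K\in\mathcal T_h}\eta_K^2=\eta_p^{\mathrm{LS}}\,\eta_d^{\mathrm{LS}},$$ and hence, for $i=0,1$, $$|\gamma-\gamma_{i,h}|\le C\sum_{K\in\mathcal T_h}\eta_K^2,$$ with a constant $C>0$ independent of the mesh $\mathcal T_h$.
   Context: Domain and coefficients: $\Omega\subset\mathbb R^d$, $d\ge2$, is a bounded Lipschitz domain with outward unit normal $n$ and $\partial\Omega=\overline{\Gamma_D}\cup\overline{\Gamma_N}$, where $\Gamma_D,\Gamma_N$ are disjoint relatively open subsets of $\partial\Omega$ and $|\Gamma_D|>0$. $A\in L^\infty(\Omega;\mathbb R^{d\times d})$ is symmetric with $a_0|\xi|^2\le\xi^TA(x)\xi\le a_1|\xi|^2$ for all $\xi\in\mathbb R^d$ and a.e. $x$, where $0<a_0\le a_1<\infty$; $b\in L^\infty(\Omega)^d$, $c\in L^\infty(\Omega)$. Data: $f_1,g_1\in L^2(\Omega)$, $f_2,g_2\in L^2(\Omega)^d$, $\psi_p,\psi_d\in L^2(\Gamma_N)$, $\phi_p,\phi_d\in H^{1/2}(\Gamma_D)$.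 Notation: $(\cdot,\cdot)$ and $\|\cdot\|_0$ are the $L^2(\Omega)$ inner product and norm, $\|\cdot\|_{0,K}$ the $L^2(K)$ norm, $\|\cdot\|_1$ the $H^1(\Omega)$ norm, $\langle\cdot,\cdot\rangle_{\Gamma_N}$ the $L^2(\Gamma_N)$ pairing of traces. $H_D^1(\Omega)=\{v\in H^1(\Omega):v=0\text{ on }\Gamma_D\}$, $X_p=\{w\in H^1(\Omega):w=\phi_p\text{ on }\Gamma_D\}$. For $\tau\in H(\mathrm{div};\Omega)$ and $\psi\in L^2(\Gamma_N)$, ''$\tau\cdot n=\psi$ on $\Gamma_N$'' means $(\tau,\nabla s_0)+(\nabla\cdot\tau,s_0)=\langle\psi,s_0\rangle_{\Gamma_N}$ for all $s_0\in H_D^1(\Omega)$. For $t,s,w\in H^1(\Omega)$, $a(t,s)=(A\nabla t,\nabla s)+(b\cdot\nabla t+ct,s)$, $\ell(s)=(f_1,s)-(f_2,\nabla s)-\langle\psi_p,s\rangle_{\Gamma_N}$, $m(w)=(g_1,w)-(g_2,\nabla w)-\langle\psi_d,w\rangle_{\Gamma_N}$. Standing assumption (inf-sup): there is $\beta>0$ with $\beta=\inf_{0\ne w_0\in H_D^1(\Omega)}\sup_{0\ne v_0\in H_D^1(\Omega)}\frac{a(w_0,v_0)}{\|w_0\|_1\|v_0\|_1}=\inf_{0\ne v_0\in H_D^1(\Omega)}\sup_{0\ne w_0\in H_D^1(\Omega)}\frac{a(w_0,v_0)}{\|w_0\|_1\|v_0\|_1}$. Quantity of interest: $u\in X_p$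 is the solution of $a(u,s_0)=\ell(s_0)$ for all $s_0\in H_D^1(\Omega)$, $\sigma=-A\nabla u-f_2\in H(\mathrm{div};\Omega)$, and $\gamma=\mathcal J_p(u)=(g_1,u)-(g_2,\nabla u)-\langle\psi_d,u\rangle_{\Gamma_N}+\langle\sigma\cdot n,\phi_d\rangle_{\Gamma_D}$, where $\langle\sigma\cdot n,\phi_d\rangle_{\Gamma_D}:=(\sigma,\nabla z_d)+(\nabla\cdot\sigma,z_d)-\langle\psi_p,z_d\rangle_{\Gamma_N}$ for any $z_d\in H^1(\Omega)$ with $z_d=\phi_d$ on $\Gamma_D$ (independent of the choice). Least-squares functionals: $\mathrm{LS}_p(\tau,w)=\|A^{-1/2}\tau+A^{1/2}\nabla w+A^{-1/2}f_2\|_0^2+\|\nabla\cdot\tau+b\cdot\nabla w+cw-f_1\|_0^2$ and $\mathrm{LS}_d(\rho,v)=\|A^{-1/2}\rho+A^{1/2}\nabla v+A^{-1/2}bv+A^{-1/2}g_2\|_0^2+\|\nabla\cdot\rho+cv-g_1\|_0^2$. Discretization: $\mathcal T_h$ is a shape-regular conforming simplicial triangulation of $\Omega$ obtained by conforming refinement of an initial mesh $\mathcal T_0$. $\Sigma_h=\{\tau_h\in H(\mathrm{div};\Omega):\tau_h|_K\in\mathbb P_0(K)^d+x\,\mathbb P_0(K)\ \forall K\in\mathcal T_h\}$ (lowest-order Raviart–Thomas), $X_h=\{v_h\in C^0(\overline\Omega):v_h|_K\in\mathbb P_1(K)\ \forall K\in\mathcal T_h\}$; $\Sigma_0,X_0$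 are these spaces on $\mathcal T_0$. It is assumed that $\phi_p,\phi_d\in X_0|_{\Gamma_D}$ and $\psi_p,\psi_d\in(\Sigma_0\cdot n)|_{\Gamma_N}$. $X_p^h=\{w_h\in X_h:w_h=\phi_p\text{ on }\Gamma_D\}$, $X_d^h=\{v_h\in X_h:v_h=\phi_d\text{ on }\Gamma_D\}$, $\Sigma_p^h=\{\tau_h\in\Sigma_h:\tau_h\cdot n=\psi_p\text{ on }\Gamma_N\}$, $\Sigma_d^h=\{\rho_h\in\Sigma_h:\rho_h\cdot n=\psi_d\text{ on }\Gamma_N\}$. $(\sigma_h,u_h)$ is the minimizer of $\mathrm{LS}_p$ over $\Sigma_p^h\times X_p^h$ and $(r_h,z_h)$ the minimizer of $\mathrm{LS}_d$ over $\Sigma_d^h\times X_d^h$. Estimators: $\eta_p^{\mathrm{LS}}=\mathrm{LS}_p(\sigma_h,u_h)^{1/2}$, $\eta_d^{\mathrm{LS}}=\mathrm{LS}_d(r_h,z_h)^{1/2}$, and for $K\in\mathcal T_h$, $(\eta_{p,K}^{\mathrm{LS}})^2=\|A^{-1/2}\sigma_h+A^{1/2}\nabla u_h+A^{-1/2}f_2\|_{0,K}^2+\|\nabla\cdot\sigma_h+b\cdot\nabla u_h+cu_h-f_1\|_{0,K}^2$, $(\eta_{d,K}^{\mathrm{LS}})^2=\|A^{-1/2}r_h+A^{1/2}\nabla z_h+A^{-1/2}bz_h+A^{-1/2}g_2\|_{0,K}^2+\|\nabla\cdot r_h+cz_h-g_1\|_{0,K}^2$. Corrected outputs: $\gamma_{0,h}=\gamma_0(u_h,z_h)$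 and $\gamma_{1,h}=\gamma_1(u_h,\sigma_h,z_h,r_h)$, where $\gamma_0(w,v)=m(w)+\ell(v)-a(w,v)$ and $\gamma_1(w,\tau,v,\rho)=\widetilde m(\tau,w)+\widetilde\ell(\rho,v)-\widetilde a((\tau,w),(\rho,v))+(\tau+A\nabla w+f_2,A^{-1}\rho)+(A^{-1}\tau,\rho+g_2+A\nabla v+bv)$ with $\widetilde\ell(\rho,v)=(f_1,v)+(f_2,A^{-1}(\rho+bv+g_2))-\langle\psi_p,v\rangle_{\Gamma_N}$, $\widetilde m(\tau,w)=(g_1,w)+(A^{-1}(\tau+f_2),g_2)-\langle\psi_d,w\rangle_{\Gamma_N}$, $\widetilde a((\tau,w),(\rho,v))=(A^{-1}(\tau+f_2),\rho+g_2)+(cw,v)$. *)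

(* Defs.v *)
From HB Require Import structures.
From mathcomp Require Import all_boot all_order all_algebra.
From mathcomp Require Import all_classical all_reals all_analysis.

Set Implicit Arguments.
Unset Strict Implicit.
Unset Printing Implicit Defensive.
Import Order.TTheory GRing.Theory Num.Theory.
Import numFieldNormedType.Exports.

Local Open Scope classical_set_scope.
Local Open Scope ring_scope.

(* Points and vectors of R^d are columns 'cV[R]_d, with the product
   sigma-algebra (same convention as the library's n-tuples). *)
Section measurable_columns.
Context {R : realType} (n : nat).

Definition coord (i : 'I_n) (x : 'cV[R]_n) : R := x i 0.

Let col_set0 : g_sigma_preimage coord set0.
Proof. exact: sigma_algebra0. Qed.

Let col_setC A : g_sigma_preimage coord A -> g_sigma_preimage coord (~` A).
Proof. exact: sigma_algebraC. Qed.

Let col_bigcup (F : _^nat) : (forall i, g_sigma_preimage coord (F i)) ->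
  g_sigma_preimage coord (\bigcup_i (F i)).
Proof. exact: sigma_algebra_bigcup. Qed.

HB.instance Definition _ := @isMeasurable.Build default_measure_display
  'cV[R]_n (g_sigma_preimage coord) col_set0 col_setC col_bigcup.

Lemma measurable_coord i : measurable_fun setT (coord i).
Proof.
move=> _ B mB; rewrite setTI; apply: sub_sigma_algebra.
by rewrite (bigD1 i)//=; left; exists B => //; rewrite setTI.
Qed.

Lemma measurable_fun_coordP d (T : measurableType d) (f : T -> 'cV[R]_n) :
  (forall i, measurable_fun setT (coord i \o f)) -> measurable_fun setT f.
Proof.
move=> mf; apply: (@measurability _ _ _ _ _ _
  (\big[setU/set0]_(i < n) preimage_set_system setT (coord i) measurable)) => //.
move=> _ [C + <-]; rewrite setTI; move: C.
apply: (big_ind (fun S : set (set 'cV[R]_n) =>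
  forall C, S C -> measurable (f @^-1` C))) => //.
- by move=> S S' hS hS' C [/hS|/hS'].
- move=> i _ _ [B mB <-]; rewrite setTI -comp_preimage -[X in measurable X]setTI.
  exact: mf.
Qed.

End measurable_columns.

Section lebesgue.
Context {R : realType}.

Section step.
Variable n : nat.

Definition col_cons (p : R * 'cV[R]_n) : 'cV[R]_n.+1 :=
  \col_i (if unlift ord0 i is Some j then p.2 j 0 else p.1).

Definition col_uncons (x : 'cV[R]_n.+1) : R * 'cV[R]_n :=
  (x ord0 0, \col_j x (lift ord0 j) 0).

Lemma col_consK : cancel col_cons col_uncons.
Proof.
move=> [a x]; congr pair; first by rewrite mxE unlift_none.
by apply/colP => j; rewrite !mxE liftK.
Qed.

Lemma measurable_col_cons : measurable_fun setT col_cons.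
Proof.
apply: measurable_fun_coordP => i.
case: (unliftP ord0 i) => [j ->|->].
  rewrite (_ : _ \o _ = coord j \o snd); last first.
    by apply/funext => p; rewrite /coord /= mxE liftK.
  by apply: measurableT_comp => //; exact: measurable_coord.
rewrite (_ : _ \o _ = fst) //.
by apply/funext => p; rewrite /coord /= mxE unlift_none.
Qed.

Lemma measurable_col_uncons : measurable_fun setT col_uncons.
Proof.
apply: measurable_fun_pair; first exact: measurable_coord.
apply: measurable_fun_coordP => j.
rewrite (_ : _ \o _ = coord (lift ord0 j)); first exact: measurable_coord.
by apply/funext => x; rewrite /coord /= mxE.
Qed.

Variable m : {sigma_finite_measure set 'cV[R]_n -> \bar R}.

Definition lebesgue_step : set 'cV[R]_n.+1 -> \bar R :=
  pushforward (lebesgue_measure \x m)%E col_cons.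

Let measurable_pre A : measurable A -> measurable (col_cons @^-1` A).
Proof. by move=> mA; rewrite -[X in measurable X]setTI; exact: measurable_col_cons. Qed.

Let step0 : lebesgue_step set0 = 0%E.
Proof. by rewrite /lebesgue_step /pushforward preimage_set0 measure0. Qed.

Let step_ge0 A : (0 <= lebesgue_step A)%E.
Proof. exact: (measure_ge0 (lebesgue_measure \x m)%E). Qed.

Let step_sigma_additive : semi_sigma_additive lebesgue_step.
Proof.
move=> F mF tF mUF; rewrite /lebesgue_step /pushforward preimage_bigcup.
apply: measure_semi_sigma_additive.
- by move=> k; exact: measurable_pre.
- apply/trivIsetP => /= i j _ _ ij; rewrite -preimage_setI.
  by move/trivIsetP : tF => /(_ _ _ _ _ ij) ->//; rewrite preimage_set0.
- by rewrite -preimage_bigcup; exact: measurable_pre.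
Qed.

HB.instance Definition _ := isMeasure.Build _ _ _ lebesgue_step
  step0 step_ge0 step_sigma_additive.

Let step_sigma_finite : sigma_finite setT lebesgue_step.
Proof.
have /sigma_finiteP[F [FT ndF Foo]] := sigma_finiteT (@lebesgue_measure R).
have /sigma_finiteP[G [GT ndG Goo]] := sigma_finiteT m.
exists (fun k => col_uncons @^-1` (F k `*` G k)).
  apply/esym; rewrite -subTset => x _.
  have [k _ Fk] : (\bigcup_k F k) (col_uncons x).1 by rewrite -FT.
  have [l _ Gl] : (\bigcup_l G l) (col_uncons x).2 by rewrite -GT.
  exists (maxn k l) => //; split.
    exact: (subsetPset _ _ (ndF _ _ (leq_maxl k l))).
  exact: (subsetPset _ _ (ndG _ _ (leq_maxr k l))).
move=> k; have [mFk Fkoo] := Foo k; have [mGk Gkoo] := Goo k; split.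
  rewrite -[X in measurable X]setTI; apply: measurable_col_uncons => //.
  exact: measurableX.
rewrite /lebesgue_step /pushforward -comp_preimage.
rewrite (_ : col_uncons \o col_cons = id); last first.
  by apply/funext => p /=; rewrite col_consK.
by rewrite preimage_id product_measure1E// lte_mul_pinfty// ge0_fin_numE.
Qed.

HB.instance Definition _ := Measure_isSigmaFinite.Build _ _ _ lebesgue_step
  step_sigma_finite.

End step.

Fixpoint lebesgue n : {sigma_finite_measure set 'cV[R]_n -> \bar R} :=
  if n is k.+1 then lebesgue_step (lebesgue k) else dirac (0 : 'cV[R]_0).

End lebesgue.

Section euclidean.
Context {R : realType} {d : nat}.
Implicit Types u v x : 'cV[R]_d.

Definition dot u v : R := \sum_i u i 0 * v i 0.
Definition enorm u : R := Num.sqrt (dot u u).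

Definition ediam (C : set 'cV[R]_d) : \bar R :=
  ereal_sup (0%E |` [set (enorm (p.1 - p.2))%:E | p in C `*` C]).

Definition bdry (A : set 'cV[R]_d) : set 'cV[R]_d := closure A `\` interior A.

End euclidean.

(* Hausdorff measure.  The constant is the Lebesgue measure of the ball of
   diameter 1 in R^s, so that the s-dimensional Hausdorff measure is the usual
   surface measure on s-dimensional surfaces.  Covers by measurable sets
   suffice, since a set and its closure have the same diameter. *)
Section hausdorff.
Context {R : realType} (d s : nat).
Local Open Scope ereal_scope.

Definition hausdorff_const : R :=
  (fine (lebesgue s [set x : 'cV[R]_s | (enorm x <= 1)%R]) / 2 ^+ s)%R.

Definition hausdorff_gauge (e : R) (C : set 'cV[R]_d) : \bar R :=
  if C == set0 then 0
  else if ediam C <= e%:E then hausdorff_const%:E * ediam C ^+ s else +oo.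

Definition hausdorff (A : set 'cV[R]_d) : \bar R :=
  ereal_sup [set mu_ext (hausdorff_gauge e) A | e in [set e | (0 < e)%R]].

Lemma ediam_ge0 (C : set 'cV[R]_d) : 0 <= ediam C.
Proof. by apply: ereal_sup_ubound; left. Qed.

Let gauge0 e : hausdorff_gauge e set0 = 0.
Proof. by rewrite /hausdorff_gauge eqxx. Qed.

Let gauge_ge0 e C : 0 <= hausdorff_gauge e C.
Proof.
rewrite /hausdorff_gauge; case: ifP => // _; case: ifP => // _.
rewrite mule_ge0 ?expe_ge0 ?ediam_ge0 // lee_fin divr_ge0 ?exprn_ge0 //.
exact/fine_ge0/measure_ge0.
Qed.

Let hausdorff_ge0 A : 0 <= hausdorff A.
Proof.
apply: (@le_trans _ _ (mu_ext (hausdorff_gauge 1%R) A)); first exact: mu_ext_ge0.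
by apply: ereal_sup_ubound; exists 1%R => //=; exact: ltr01.
Qed.

Let hausdorff0 : hausdorff set0 = 0.
Proof.
apply/eqP; rewrite eq_le hausdorff_ge0 andbT.
by apply: ge_ereal_sup => _ [e _ <-]; rewrite mu_ext0.
Qed.

Let le_hausdorff : {homo hausdorff : A B / A `<=` B >-> A <= B}.
Proof.
move=> A B AB; apply: ge_ereal_sup => _ [e e0 <-].
apply: (@le_trans _ _ (mu_ext (hausdorff_gauge e) B)); first exact: le_mu_ext.
by apply: ereal_sup_ubound; exists e.
Qed.

Let hausdorff_sigma_subadditive : sigma_subadditive hausdorff.
Proof.
move=> F; apply: ge_ereal_sup => _ [e e0 <-].
apply: (@le_trans _ _ (\sum_(k <oo) mu_ext (hausdorff_gauge e) (F k))).
  exact: mu_ext_sigma_subadditive.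
apply: lee_nneseries => [k _ _|k _]; first exact: mu_ext_ge0.
by apply: ereal_sup_ubound; exists e.
Qed.

HB.instance Definition _ := isOuterMeasure.Build R 'cV[R]_d hausdorff
  hausdorff0 hausdorff_ge0 le_hausdorff hausdorff_sigma_subadditive.

End hausdorff.

Section sobolev.
Context {R : realType} {d : nat}.
Local Notation E := 'cV[R]_d.

Definition surf_outer : {outer_measure set E -> \bar R} := @hausdorff R d d.-1.
Definition surf : {measure set (caratheodory_type surf_outer) -> \bar R} :=
  surf_outer.
Definition leb : {sigma_finite_measure set E -> \bar R} := lebesgue d.

Definition L2 disp (T : measurableType disp) (mu : {measure set T -> \bar R})
    (D : set T) (f : T -> R) : Prop :=
  measurable_fun D f /\ mu.-integrable D (fun x => (f x ^+ 2)%:E).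

Definition L2v (D : set E) (f : E -> E) : Prop :=
  forall i, L2 leb D (fun x => f x i 0).

Definition Linf (D : set E) (f : E -> R) : Prop :=
  measurable_fun D f /\
  exists M : R, {ae leb, forall x, D x -> `|f x| <= M}.

Definition ip (D : set E) (f g : E -> R) : R := \int[leb]_(x in D) (f x * g x).
Definition ipv (D : set E) (f g : E -> E) : R :=
  \int[leb]_(x in D) dot (f x) (g x).

Definition unit_col (i : 'I_d) : E := delta_mx i 0.
Definition partial (i : 'I_d) (f : E -> R) : E -> R :=
  fun x => 'D_(unit_col i) f x.
Definition grad (f : E -> R) : E -> E := fun x => \col_i partial i f x.

Fixpoint Ck (k : nat) (f : E -> R) : Prop :=
  continuous f /\
  if k is j.+1 then
    forall i, (forall x, derivable f x (unit_col i)) /\ Ck j (partial i f)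
  else True.
Definition smooth (f : E -> R) : Prop := forall k, Ck k f.

Definition test_fun (Om : set E) (phi : E -> R) : Prop :=
  smooth phi /\ exists K : set E,
    [/\ compact K, K `<=` Om & forall x, ~ K x -> phi x = 0].

Definition weak_grad (Om : set E) (v : E -> R) (G : E -> E) : Prop :=
  forall phi, test_fun Om phi -> forall i,
    ip Om v (partial i phi) = - ip Om (fun x => G x i 0) phi.

Definition weak_div (Om : set E) (tau : E -> E) (q : E -> R) : Prop :=
  forall phi, test_fun Om phi -> ipv Om tau (grad phi) = - ip Om q phi.

(* g is the boundary trace of the H^1 function v with gradient G: the trace
   operator is the continuous extension of the restriction to the boundary,
   defined on functions smooth up to the boundary. *)
Definition is_trace (Om : set E) (v : E -> R) (G : E -> E) (g : E -> R) : Prop :=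
  exists phi : nat -> E -> R,
    [/\ forall k, smooth (phi k),
        (\int[leb]_(x in Om) ((phi k x - v x) ^+ 2)%:E @[k --> \oo] --> 0)%E,
        (\int[leb]_(x in Om)
           (dot (grad (phi k) x - G x) (grad (phi k) x - G x))%:E
           @[k --> \oo] --> 0)%E &
        (\int[surf]_(x in bdry Om) ((phi k x - g x) ^+ 2)%:E
           @[k --> \oo] --> 0)%E].

(* An element of H^1(Om) is carried together with its weak gradient and its
   trace; on a bounded Lipschitz domain both exist and are unique a.e. *)
Record H1 (Om : set E) := MkH1 {
  val1 : E -> R;
  grad1 : E -> E;
  trace1 : E -> R;
  _ : L2 leb Om val1;
  _ : L2v Om grad1;
  _ : weak_grad Om val1 grad1;
  _ : L2 surf (bdry Om) trace1;
  _ : is_trace Om val1 grad1 trace1 }.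

Record Hdiv (Om : set E) := MkHdiv {
  valdiv : E -> E;
  div1 : E -> R;
  _ : L2v Om valdiv;
  _ : L2 leb Om div1;
  _ : weak_div Om valdiv div1 }.

Definition H1norm (Om : set E) (v : H1 Om) : R :=
  Num.sqrt (ip Om (val1 v) (val1 v) + ipv Om (grad1 v) (grad1 v)).

Definition eq_on (Om G : set E) (v : H1 Om) (phi : E -> R) : Prop :=
  {ae surf, forall x, G x -> trace1 v x = phi x}.

Definition Hhalf (Om G : set E) (phi : E -> R) : Prop :=
  exists v : H1 Om, eq_on G v phi.

Definition HD (Om GD : set E) : set (H1 Om) := [set v | eq_on GD v (cst 0)].

Definition bpair (Om G : set E) (psi : E -> R) (v : H1 Om) : R :=
  \int[surf]_(x in G) (psi x * trace1 v x).

(* tau . n = psi on GN *)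
Definition normal_trace (Om GD GN : set E) (tau : Hdiv Om) (psi : E -> R) : Prop :=
  forall s : H1 Om, HD GD s ->
    ipv Om (valdiv tau) (grad1 s) + ip Om (div1 tau) (val1 s) = bpair GN psi s.

(* Near each boundary point, and in suitable orthonormal coordinates, Om is the
   subgraph (in direction nu) of a Lipschitz function g of the coordinates
   orthogonal to nu. *)
Definition lipschitz_domain (Om : set E) : Prop :=
  [/\ open Om, connected Om, bounded_set Om &
    forall x, bdry Om x ->
      exists (nu : E) (g : E -> R) (L r : R),
        [/\ 0 < r, enorm nu = 1,
            forall y z, `|g y - g z| <= L * enorm (y - z) &
            forall y, enorm (y - x) < r ->
              (Om y <-> dot nu y < g (y - dot nu y *: nu))]].

Definition boundary_split (Om GD GN : set E) : Prop :=
  [/\ exists2 U, open U & GD = bdry Om `&` U,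
      exists2 U, open U & GN = bdry Om `&` U,
      GD `&` GN = set0,
      bdry Om = closure GD `|` closure GN &
      (0 < surf GD)%E].

End sobolev.

Section simplicial_meshes.
Context {R : realType} {d : nat}.
Local Notation E := 'cV[R]_d.

(* A simplex is given by the matrix whose d+1 columns are its vertices. *)
Definition barycentric (l : 'cV[R]_d.+1) : Prop :=
  (forall i, 0 <= l i 0) /\ \sum_i l i 0 = 1.

Definition simplex (K : 'M[R]_(d, d.+1)) : set E :=
  [set x | exists2 l, barycentric l & x = K *m l].

Definition common_face (K K' : 'M[R]_(d, d.+1)) : set E :=
  [set x | exists2 l, barycentric l & x = K *m l /\
    forall i, l i 0 != 0 -> exists j, col i K = col j K'].

Definition affinely_independent (K : 'M[R]_(d, d.+1)) : Prop :=
  forall l : 'cV[R]_d.+1, \sum_i l i 0 = 0 -> K *m l = 0 -> l = 0.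

Definition triangulation (Om : set E) (T : seq 'M[R]_(d, d.+1)) : Prop :=
  [/\ uniq T,
      {in T, forall K, affinely_independent K},
      {in T &, injective simplex},
      closure Om = [set x | exists2 K, K \in T & simplex K x] &
      {in T &, forall K K', simplex K `&` simplex K' = common_face K K'}].

(* diameter of K <= kappa * (diameter of a ball contained in K) *)
Definition shape_regular (kappa : R) (T : seq 'M[R]_(d, d.+1)) : Prop :=
  {in T, forall K, exists (x : E) (r : R),
    [/\ 0 < r, (forall y, enorm (y - x) <= r -> simplex K y) &
        (ediam (simplex K) <= (kappa * (2 * r))%:E)%E]}.

Definition refines (T T0 : seq 'M[R]_(d, d.+1)) : Prop :=
  {in T, forall K, exists2 K0, K0 \in T0 & simplex K `<=` simplex K0}.

(* lowest-order Raviart-Thomas space; membership on K is a.e., as the fields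
   may jump across faces *)
Definition RT (Om : set E) (T : seq 'M[R]_(d, d.+1)) : set (Hdiv Om) :=
  [set tau | {in T, forall K, exists (a : E) (t : R),
    {ae leb, forall x, simplex K x -> valdiv tau x = a + t *: x}}].

Definition P1 (Om : set E) (T : seq 'M[R]_(d, d.+1)) : set (H1 Om) :=
  [set v | {within closure Om, continuous (val1 v)} /\
    {in T, forall K, exists (t : R) (a : E),
      forall x, simplex K x -> val1 v x = t + dot a x}].

End simplicial_meshes.

(* Unique symmetric positive definite square root, with default value 0. *)
Definition msqrt {R : realType} {d : nat} (M : 'M[R]_d) : 'M[R]_d :=
  xget 0 [set S | [/\ S^T = S, forall xi, xi != 0 -> 0 < dot xi (S *m xi) &
                      S *m S = M]].

Record problem (R : realType) (d : nat) := Problem {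
  dom : set 'cV[R]_d;
  bdryD : set 'cV[R]_d;
  bdryN : set 'cV[R]_d;
  coefA : 'cV[R]_d -> 'M[R]_d;
  coefb : 'cV[R]_d -> 'cV[R]_d;
  coefc : 'cV[R]_d -> R;
  srcf1 : 'cV[R]_d -> R;
  srcf2 : 'cV[R]_d -> 'cV[R]_d;
  srcg1 : 'cV[R]_d -> R;
  srcg2 : 'cV[R]_d -> 'cV[R]_d;
  fluxp : 'cV[R]_d -> R;
  fluxd : 'cV[R]_d -> R;
  dirp : 'cV[R]_d -> R;
  dird : 'cV[R]_d -> R }.

Unset Implicit Arguments.
Section forms.
Context {R : realType} {d : nat} (P : problem R d).
Local Notation E := 'cV[R]_d.
Local Notation Om := (dom P).
Local Notation A := (coefA P).
Local Notation b := (coefb P).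
Local Notation c := (coefc P).
Local Notation f1 := (srcf1 P).
Local Notation f2 := (srcf2 P).
Local Notation g1 := (srcg1 P).
Local Notation g2 := (srcg2 P).
Local Notation "( f , g )_0" := (ip Om f g) (format "( f ,  g )_0").
Local Notation "( f , g )_v" := (ipv Om f g) (format "( f ,  g )_v").
Implicit Types (t s u w v z : H1 Om) (tau rho sigma : Hdiv Om).

Definition Amul (f : E -> E) : E -> E := fun x => A x *m f x.
Definition Ainv (f : E -> E) : E -> E := fun x => invmx (A x) *m f x.
Definition Ahalf (f : E -> E) : E -> E := fun x => msqrt (A x) *m f x.
Definition Aihalf (f : E -> E) : E -> E := fun x => invmx (msqrt (A x)) *m f x.
Definition bval v : E -> E := fun x => val1 v x *: b x.
Definition bgrad v : E -> R := fun x => dot (b x) (grad1 v x).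
Definition cval v : E -> R := fun x => c x * val1 v x.

Definition coefficients (a0 a1 : R) : Prop :=
  [/\ 0 < a0 <= a1,
      forall i j, Linf Om (fun x => A x i j),
      forall i, Linf Om (fun x => b x i 0),
      Linf Om c &
      {ae leb, forall x, Om x -> (A x)^T = A x /\
        forall xi, a0 * enorm xi ^+ 2 <= dot xi (A x *m xi) <=
                   a1 * enorm xi ^+ 2}].

Definition data : Prop :=
  [/\ L2 leb Om f1 /\ L2 leb Om g1,
      L2v Om f2 /\ L2v Om g2,
      L2 surf (bdryN P) (fluxp P) /\ L2 surf (bdryN P) (fluxd P) &
      Hhalf Om (bdryD P) (dirp P) /\ Hhalf Om (bdryD P) (dird P)].

Definition a_form t s : R :=
  (Amul (grad1 t), grad1 s)_v + (bgrad t \+ cval t, val1 s)_0.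
Definition ell s : R :=
  (f1, val1 s)_0 - (f2, grad1 s)_v - bpair (bdryN P) (fluxp P) s.
Definition m_form w : R :=
  (g1, val1 w)_0 - (g2, grad1 w)_v - bpair (bdryN P) (fluxd P) w.

Definition HD0 : set (H1 Om) := [set v | HD (bdryD P) v /\ H1norm v != 0].
Definition infsup (beta : R) : Prop :=
  [/\ 0 < beta,
      beta%:E = ereal_inf [set ereal_sup
        [set (a_form w v / (H1norm w * H1norm v))%:E | v in HD0] | w in HD0] &
      beta%:E = ereal_inf [set ereal_sup
        [set (a_form w v / (H1norm w * H1norm v))%:E | w in HD0] | v in HD0]].

Definition primal_solution u : Prop :=
  eq_on (bdryD P) u (dirp P) /\ forall s, HD (bdryD P) s -> a_form u s = ell s.

Definition primal_flux u sigma : Prop :=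
  {ae leb, forall x, Om x ->
    valdiv sigma x = - (A x *m grad1 u x) - f2 x}.

(* <sigma . n, phi_d> on Gamma_D, computed with a lifting z of phi_d *)
Definition flux_pair sigma z : R :=
  (valdiv sigma, grad1 z)_v + (div1 sigma, val1 z)_0 - bpair (bdryN P) (fluxp P) z.
Definition Jp u sigma z : R := m_form u + flux_pair sigma z.

Definition residual_p1 tau w : E -> E :=
  Aihalf (valdiv tau) \+ Ahalf (grad1 w) \+ Aihalf f2.
Definition residual_p2 tau w : E -> R :=
  div1 tau \+ bgrad w \+ cval w \- f1.
Definition residual_d1 rho v : E -> E :=
  Aihalf (valdiv rho) \+ Ahalf (grad1 v) \+ Aihalf (bval v) \+ Aihalf g2.
Definition residual_d2 rho v : E -> R :=
  div1 rho \+ cval v \- g1.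

(* LS_p and LS_d are obtained for K := Om; the squared local indicators
   (eta_{p,K})^2 and (eta_{d,K})^2 for K a simplex. *)
Definition LSp (K : set E) tau w : R :=
  ipv K (residual_p1 tau w) (residual_p1 tau w) +
  ip K (residual_p2 tau w) (residual_p2 tau w).
Definition LSd (K : set E) rho v : R :=
  ipv K (residual_d1 rho v) (residual_d1 rho v) +
  ip K (residual_d2 rho v) (residual_d2 rho v).

Definition gamma0 w v : R := m_form w + ell v - a_form w v.

Definition ell_tilde rho v : R :=
  (f1, val1 v)_0 + (f2, Ainv (valdiv rho \+ bval v \+ g2))_v
  - bpair (bdryN P) (fluxp P) v.
Definition m_tilde tau w : R :=
  (g1, val1 w)_0 + (Ainv (valdiv tau \+ f2), g2)_v - bpair (bdryN P) (fluxd P) w.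
Definition a_tilde tau w rho v : R :=
  (Ainv (valdiv tau \+ f2), valdiv rho \+ g2)_v + (cval w, val1 v)_0.
Definition gamma1 w tau v rho : R :=
  m_tilde tau w + ell_tilde rho v - a_tilde tau w rho v
  + (valdiv tau \+ Amul (grad1 w) \+ f2, Ainv (valdiv rho))_v
  + (Ainv (valdiv tau), valdiv rho \+ g2 \+ Amul (grad1 v) \+ bval v)_v.

Section discrete.
Variable T : seq 'M[R]_(d, d.+1).

Definition Xp : set (H1 Om) := [set w | P1 T w /\ eq_on (bdryD P) w (dirp P)].
Definition Xd : set (H1 Om) := [set v | P1 T v /\ eq_on (bdryD P) v (dird P)].
Definition Sp : set (Hdiv Om) :=
  [set tau | RT T tau /\ normal_trace (bdryD P) (bdryN P) tau (fluxp P)].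
Definition Sd : set (Hdiv Om) :=
  [set rho | RT T rho /\ normal_trace (bdryD P) (bdryN P) rho (fluxd P)].

(* With T the initial mesh: phi_p, phi_d are in X_0 restricted to Gamma_D, and
   psi_p, psi_d in (Sigma_0 . n) restricted to Gamma_N. *)
Definition discrete_boundary_data : Prop :=
  [/\ Xp !=set0, Xd !=set0, Sp !=set0 & Sd !=set0].

Definition minimizer_p sigma u : Prop :=
  [/\ Sp sigma, Xp u &
      forall tau w, Sp tau -> Xp w -> LSp Om sigma u <= LSp Om tau w].
Definition minimizer_d rho z : Prop :=
  [/\ Sd rho, Xd z &
      forall tau w, Sd tau -> Xd w -> LSd Om rho z <= LSd Om tau w].

End discrete.

Definition etap sigma u : R := Num.sqrt (LSp Om sigma u).
Definition etad rho z : R := Num.sqrt (LSd Om rho z).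

(* eta_K^2 *)
Definition eta2 sigma u rho z (K : 'M[R]_(d, d.+1)) : R :=
  2^-1 * (etad rho z / etap sigma u * LSp (simplex K) sigma u +
          etap sigma u / etad rho z * LSd (simplex K) rho z).

End forms.

(* Main.v *)
(* The squares of eta_p and eta_d are sums of local contributions, because the
   faces of the simplices are null sets and the open simplices fill the Lipschitz
   domain up to them; so the weights eta_d / eta_p and eta_p / eta_d make the
   indicators add up to eta_p eta_d.

   Write e = u - u_h, R_p = sigma_h + A grad u_h + f_2, and let r_p be the second
   residual of LS_p; likewise R_d and r_d for LS_d.  The Neumann condition on
   sigma_h gives a(e,s) = -(R_p, grad s) - (r_p, s) for s in H_D^1, so the inf-sup
   condition bounds beta |e|_1 by sqrt(max(a_1,1)) eta_p.  Testing the equations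
   for u with z_d - z_h, which vanishes on Gamma_D, turns gamma - gamma_0 into
   -(R_d, grad e) - (r_d, e), which is at most sqrt(max(a_1,1)) eta_d |e|_1.
   Finally gamma_1 - gamma_0 = (R_p, A^{-1} R_d), at most eta_p eta_d by the
   Cauchy-Schwarz inequality.  Hence C = max(a_1,1) / beta + 1.

   The boundary pairing of sigma obeys the equation of u tested with any z in H^1:
   a residual that annihilates test functions vanishes, as test functions are dense
   in L2 and elements of H^1 are L2-limits of smooth functions. *)
Require Import Defs.
From mathcomp Require Import all_boot all_order all_algebra.
From mathcomp Require Import all_classical all_reals all_analysis.
From mathcomp Require Import measurable_realfun.
From mathcomp Require complex.
From mathcomp Require Import zify ring lra.
Import Order.TTheory GRing.Theory Num.Theory.
Import numFieldNormedType.Exports.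
Local Open Scope classical_set_scope.
Local Open Scope ring_scope.
Set Implicit Arguments.
Unset Strict Implicit.
Unset Printing Implicit Defensive.

(** Three obstacles shape the development. Boundary integrals are taken on the Carathéodory
    sigma-algebra of a Hausdorff outer measure, so Borel sets must be shown to belong to it before
    traces can be subtracted or restricted to the Neumann part; since an [H1] element carries its
    trace, even u - u_h and z_d - z_h are objects to be constructed. A triangulation describes only
    the closure of the domain. The Lipschitz condition is what places the open simplices inside the
    domain itself, by pushing points across the boundary along the graph direction. The divergence
    of the exact flux is known only through functions compactly supported in the domain, whereas z_d
    may have a nonzero trace. The passage from the former to the latter uses cutoffs that tend
    pointwise to 1, built from bumps on rational cubes, together with the smooth approximants that
    the definition of the trace provides. *)

Local Notation coord := Defs.coord.
Local Notation val1 := Defs.val1.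

(** * Borel sets and the surface measure *)

Section borel_columns.
Context {R : realType} {d : nat}.
Local Notation E := 'cV[R]_d.
Implicit Types (x y z : E) (U : set E).

Lemma col_ballP x (U : set E) : nbhs x U <->
  exists2 e : R, 0 < e & forall y, (forall i, `|x i 0 - y i 0| < e) -> U y.
Proof.
split=> [/nbhs_ballP[e e0 eU]|[e e0 eU]].
  by exists e => // y xy; apply: eU; split=> // i j; rewrite ord1; exact: xy.
by apply/nbhs_ballP; exists e => // y [_ xy]; apply: eU => i; exact: xy.
Qed.

Lemma measurable_coord_preimage i (B : set R) :
  measurable B -> measurable (coord i @^-1` B : set E).
Proof. by move=> mB; rewrite -[X in measurable X]setTI; exact: measurable_coord. Qed.

Definition open_cube (q : E) (r : R) : set E :=
  [set y | forall i, `|q i 0 - y i 0| < r].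

Lemma measurable_open_cube q r : measurable (open_cube q r).
Proof.
rewrite (_ : open_cube q r = \bigcap_(i in [set: 'I_d]) coord i @^-1` (ball (q i 0) r)).
  apply: fin_bigcap_measurable => // i _.
  by apply: measurable_coord_preimage; exact: measurable_ball.
by apply/seteqP; split=> y /= h i; [move=> _|]; apply: h.
Qed.

(** A radius below [e / 2] leaves room for moving the centre to a rational point. The closed cube is
    kept inside as well, because bump functions are supported on closed cubes, while measurability
    of open sets uses the open ones. *)
Lemma rational_cube x (e : R) : 0 < e ->
  exists (q : 'cV[rat]_d) (k : nat), open_cube (map_mx ratr q) k.+1%:R^-1 x /\
    forall y, (forall i, `|(map_mx ratr q : E) i 0 - y i 0| <= k.+1%:R^-1) -> open_cube x e y.
Proof.
move=> e0; have e20 : 0 < e / 2 by rewrite divr_gt0.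
have [k] := ltr_add_invr e20; rewrite add0r => ke.
have k0 : 0 < k.+1%:R^-1 :> R by rewrite invr_gt0.
move: k0 ke; set t := k.+1%:R^-1 => t0 te.
have /choice[q qP] : forall i, exists q : rat, `|ratr q - x i 0| < t.
  move=> i; have /rat_in_itvoo[q /itvP qP] :
    x i 0 - t < x i 0 + t by lra.
  by exists q; rewrite ltr_distl !qP.
exists (\col_i q i), k; split=> [i|y qy i]; first by rewrite !mxE; exact: qP.
have := qy i; have := qP i; rewrite !mxE => h1 h2.
rewrite (_ : x i 0 - y i 0 = (ratr (q i) - y i 0) - (ratr (q i) - x i 0)); last by ring.
by rewrite -/t in h2; rewrite (le_lt_trans (ler_normB _ _))//; lra.
Qed.

(** The sigma-algebra on columns is generated by the coordinates, not by the topology. The two meet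
    because an open set is the union of the rational cubes it contains, and these are countably
    many. *)
Lemma open_measurable_col U : open U -> measurable U.
Proof.
move=> oU; pose F (p : 'cV[rat]_d * nat) :=
  let C := open_cube (map_mx ratr p.1) p.2.+1%:R^-1 in
  if `[< C `<=` U >] then C else set0.
rewrite (_ : U = \bigcup_p F p).
  apply: countable_bigcupT_measurable => [|p]; first exact: countableP.
  by rewrite /F; case: ifP => // _; exact: measurable_open_cube.
apply/seteqP; split=> [x Ux|x [p _]]; last first.
  by rewrite /F; case: asboolP => // CU /CU.
have /col_ballP[e e0 eU] : nbhs x U by exact: open_nbhs_nbhs.
have [q [k [qx qe]]] := rational_cube x e0.
exists (q, k) => //; rewrite /F /=; case: asboolP => // -[].
by move=> y yq; apply: eU; apply: qe => i; exact/ltW/yq.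
Qed.

Lemma closed_measurable_col U : closed U -> measurable U.
Proof.
move=> cU; rewrite -[U]setCK; apply: measurableC; apply: open_measurable_col.
exact: closed_openC.
Qed.

Lemma continuous_measurable_col (f : E -> R) :
  continuous f -> measurable_fun setT f.
Proof.
move=> /continuousP cf; apply: (measurability _ (RGenOpens.measurableE R)).
move=> _ [_ [a [b ->] <-]]; rewrite setTI; apply: open_measurable_col.
exact/cf/interval_open.
Qed.

End borel_columns.

(** * Carathéodory's criterion for sets separated by a real function *)

Section caratheodory_criterion.
Context {R : realType} {T : Type} (mu : {outer_measure set T -> \bar R}).
Variable f : T -> R.
Hypothesis mu_sep : forall (A B : set T) (e : R), 0 < e ->
  (forall x y, A x -> B y -> e <= `|f x - f y|) ->
  (mu A + mu B <= mu (A `|` B))%E.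
Local Open Scope ereal_scope.

Let inv (n : nat) : R := n.+1%:R^-1.

Let le_inv m n : (m <= n)%N -> (inv n <= inv m)%R.
Proof. by move=> mn; rewrite lef_pV2 ?posrE// ler_nat. Qed.

Let lt_inv m n : (m < n)%N -> (inv n < inv m)%R.
Proof. by move=> mn; rewrite ltf_pV2 ?posrE// ltr_nat. Qed.

(* Shells of equal parity are at positive distance from one another, hence the
   outer measures of all shells sum to at most twice that of [X]. *)
Let shell (X : set T) a n :=
  X `&` [set x | a + inv n.+1 <= f x < a + inv n]%R.

Let shell_sum X a p N : \sum_(0 <= k < N) mu (shell X a (p + k.*2)) <= mu X.
Proof.
suff : \sum_(0 <= k < N) mu (shell X a (p + k.*2)) <=
    mu (\big[setU/set0]_(0 <= k < N) shell X a (p + k.*2)).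
  move/le_trans; apply; apply: le_outer_measure.
  by apply: (big_ind (fun Y => Y `<=` X)) => // [A B AX BX x [/AX|/BX]|k _ x []].
elim: N => [|N IH]; first by rewrite !big_geq ?outer_measure0.
rewrite !big_nat_recr//=; apply: le_trans (leeD IH (lexx _)) _.
(* The shells already summed lie above the level of index p + 2N - 1, the new one below the level of
   index p + 2N, which gives a positive gap. At index 0 the predecessor degenerates, but then no
   shell has been summed yet. *)
have e0 : (0 < inv (p + N.*2).-1 - inv (p + N.*2))%R \/ (p + N.*2)%N = 0%N.
  by case: (p + N.*2)%N => [|n]; [right|left; rewrite subr_gt0 lt_inv].
case: e0 => [e0|pN0]; last first.
  by have -> : N = 0%N; [lia|rewrite big_geq// outer_measure0 add0e set0U].
apply: mu_sep e0 _ => x y + [_ /= /andP[_ yN]].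
have : \big[setU/set0]_(0 <= k < N) shell X a (p + k.*2) `<=`
    [set z | a + inv (p + N.*2).-1 <= f z]%R.
  rewrite big_nat_cond.
  apply: (big_ind (fun Y => Y `<=` [set z | a + inv (p + N.*2).-1 <= f z]%R)) => [//||k].
    by move=> A B hA hB z [/hA|/hB].
  rewrite andbT => /andP[_ kN] z [_ /= /andP[+ _]]; apply: le_trans.
  by rewrite lerD2l le_inv//; lia.
move=> /[apply] /= xN; rewrite (le_trans _ (ler_norm _))//; lra.
Qed.

Let shell_sum_le X a N :
  \sum_(0 <= k < N) mu (shell X a k) <= mu X + mu X.
Proof.
have dbl M : \sum_(0 <= k < M.*2) mu (shell X a k) =
    \sum_(0 <= k < M) mu (shell X a (0 + k.*2)) +
    \sum_(0 <= k < M) mu (shell X a (1 + k.*2)).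
  elim: M => [|M IH]; first by rewrite !big_geq// adde0.
  rewrite doubleS !big_nat_recr//= IH !add0n -!addeA; congr (_ + _).
  by rewrite !addeA; congr (_ + _); rewrite addeC.
apply: (@le_trans _ _ (\sum_(0 <= k < N.*2) mu (shell X a k))).
  apply: lee_sum_nneg_natr => [*|]; first exact: outer_measure_ge0.
  by rewrite -addnn leq_addr.
by rewrite dbl leeD// shell_sum.
Qed.

(** The part of [X] above level [a + inv n] is separated from the part where [f x <= a], so there
    the outer measure is additive. What remains lies in the shells of index at least [n], whose
    total is a tail of a convergent series. *)
Lemma caratheodory_separated a : mu.-caratheodory [set x | (a < f x)%R].
Proof.
apply: le_caratheodory_measurable => X.
have [->|Xoo] := eqVneq (mu X) +oo; first by rewrite leey.
have muX : mu X \is a fin_num by rewrite ge0_fin_numE ?outer_measure_ge0// ltey.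
pose tail n := \sum_(n <= k <oo) mu (shell X a k).
have tail0 : tail n @[n --> \oo] --> 0.
  apply: nneseries_tail_cvg => [|k _]; last exact: outer_measure_ge0.
  apply: (@le_lt_trans _ _ (mu X + mu X)).
    apply: lime_le; last by apply: nearW => N; exact: shell_sum_le.
    by apply: is_cvg_ereal_nneg_natsum => k _; exact: outer_measure_ge0.
  by rewrite lte_add_pinfty// ltey.
have lim : (fun n => mu X + tail n) @ \oo --> mu X + 0.
  by apply: cvgeD => //; [rewrite fin_num_adde_defl|exact: cvg_cst].
rewrite -[leRHS]adde0; apply: cvge_ge lim.
apply: nearW => n; rewrite addeC.
have XU : X `&` [set x | (a < f x)%R] `<=`
    (X `&` [set x | (a + inv n <= f x)%R]) `|` \bigcup_(k in ~` `I_n) shell X a k.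
  move=> x [Xx /= ax]; have [|fn] := leP (a + inv n)%R (f x); first by left.
  have exk : exists k, (a + inv k <= f x)%R.
    by have [k /ltW ?] := ltr_add_invr ax; exists k.
  (* Minimality of [k] puts [f x] below the level of index [k.-1], so [x] lies in the shell of index
     [k.-1], which is at least [n]. *)
  have [k kx kmin] := ex_minnP exk; right.
  have nk : (n < k)%N.
    rewrite ltnNge; apply: contraTN fn => kn.
    by rewrite -leNgt (le_trans _ kx)// lerD2l le_inv.
  exists k.-1 => /=; first by move/negP; apply; lia.
  split => //=; rewrite prednK ?(leq_ltn_trans _ nk)// kx/= ltNge.
  by apply/negP => /kmin; rewrite leqNgt ltn_predL (leq_ltn_trans _ nk).
apply: (@le_trans _ _ (mu (X `&` ~` [set x | (a < f x)%R]) +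
    (mu (X `&` [set x | (a + inv n <= f x)%R]) + tail n))).
  rewrite leeD2l//; apply: le_trans (le_outer_measure mu _ _ XU) _.
  apply: le_trans (outer_measureU2 _ _ _) _; rewrite leeD2l//.
  exact: outer_measure_sigma_subadditive_tail.
rewrite addeA leeD2r//.
apply: le_trans (@mu_sep _ _ (inv n) _ _) _ => //; first by rewrite invr_gt0.
  move=> x y [_ /= /negP]; rewrite -leNgt => xa [_ /= ya].
  by rewrite distrC (le_trans _ (ler_norm _))//; lra.
by apply: le_outer_measure => x [[]|[]].
Qed.

End caratheodory_criterion.

(** * Borel sets are measurable for the Hausdorff measure *)

Section hausdorff_borel.
Context {R : realType} {d : nat}.
Local Notation E := 'cV[R]_d.

Lemma dot_ge0 (x : E) : 0 <= dot x x.
Proof. by apply: sumr_ge0 => i _; rewrite -expr2 sqr_ge0. Qed.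

Lemma coord_le_enorm (x : E) i : `|x i 0| <= enorm x.
Proof.
rewrite -sqrtr_sqr; apply: ler_wsqrtr; rewrite /dot (bigD1 i)//= -expr2 lerDl.
by apply: sumr_ge0 => j _; rewrite -expr2 sqr_ge0.
Qed.

Local Open Scope ereal_scope.

Lemma coord_le_ediam (C : set E) (x y : E) i : C x -> C y ->
  (`|coord i x - coord i y|%R)%:E <= ediam C.
Proof.
move=> Cx Cy; apply: (@le_trans _ _ (enorm (x - y)%R)%:E).
  by rewrite lee_fin; have := coord_le_enorm (x - y)%R i; rewrite !mxE.
by apply: ereal_sup_ubound; right; exists (x, y).
Qed.

Variable s : nat.
Local Notation gauge := (@hausdorff_gauge R d s).

Lemma gauge_ge0 e C : 0 <= gauge e C.
Proof.
rewrite /hausdorff_gauge; case: ifP => // _; case: ifP => // _.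
rewrite mule_ge0 ?expe_ge0 ?ediam_ge0 // lee_fin divr_ge0 ?exprn_ge0 //.
exact/fine_ge0/measure_ge0.
Qed.

Lemma gauge_set0 e : gauge e set0 = 0.
Proof. by rewrite /hausdorff_gauge eqxx. Qed.

Lemma gauge_antitone (e e' : R) C : (e' <= e)%R -> gauge e C <= gauge e' C.
Proof.
move=> ee'; rewrite /hausdorff_gauge; case: ifP => // _.
case: ifPn => [_|/negP h].
  case: ifP => // _; exact: leey.
case: ifPn => // h'; exfalso; apply: h.
by rewrite (le_trans h')// lee_fin.
Qed.

(* Sets of diameter larger than [e] have infinite gauge, so a set of the cover
   that meets both [A] and [B] makes the right-hand side infinite. *)
Lemma mu_ext_gauge_sep i (A B : set E) (e r : R) : (e < r)%R ->
  (forall x y, A x -> B y -> r <= `|coord i x - coord i y|)%R ->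
  mu_ext (gauge e) A + mu_ext (gauge e) B <= mu_ext (gauge e) (A `|` B).
Proof.
move=> er AB; apply: le_ereal_inf_tmp => _ [F [mF ABF] <-].
pose sub (C : set E) k := if `[< F k `&` C !=set0 >] then F k else set0.
have subP C : C `<=` A `|` B -> measurable_cover C (sub C).
  move=> CAB; split=> [k|x Cx]; first by rewrite /sub; case: ifP.
  have [k _ Fkx] := ABF _ (CAB _ Cx).
  by exists k => //; rewrite /sub ifT//; apply/asboolP; exists x.
apply: (@le_trans _ _ (\sum_(k <oo) gauge e (sub A k) + \sum_(k <oo) gauge e (sub B k))).
  apply: leeD; apply: ereal_inf_lbound.
    by exists (sub A) => //; apply: subP => x; left.
  by exists (sub B) => //; apply: subP => x; right.
rewrite -nneseriesD; [|by move=> *; exact: gauge_ge0..].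
apply: lee_nneseries => k _; first by rewrite adde_ge0// gauge_ge0.
rewrite /sub; case: asboolP => [[x [Fx Ax]]|_]; last first.
  by rewrite gauge_set0 add0e; case: ifP => // _; rewrite gauge_set0 gauge_ge0.
case: asboolP => [[y [Fy By]]|_]; last by rewrite gauge_set0 adde0.
suff -> : gauge e (F k) = +oo by rewrite leey.
rewrite /hausdorff_gauge ifF; last by apply/negP => /eqP F0; move: Fx; rewrite F0.
rewrite ifF//; apply/negbTE; rewrite -ltNge.
apply: lt_le_trans (coord_le_ediam i Fx Fy); rewrite lte_fin.
exact: lt_le_trans (AB _ _ Ax By).
Qed.

(** The two suprema over mesh sizes [e] and [e'] are first treated at fixed values: a common size
    below both and below [r] reduces to a single gauge, whose covers split. The suprema are then
    taken one after the other, which moves terms across the inequality and hence calls for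
    finiteness. *)
Lemma hausdorff_sep i (A B : set E) (r : R) : (0 < r)%R ->
  (forall x y, A x -> B y -> r <= `|coord i x - coord i y|)%R ->
  hausdorff s A + hausdorff s B <= hausdorff s (A `|` B).
Proof.
move=> r0 AB.
have key (e e' : R) : (0 < e)%R -> (0 < e')%R ->
    mu_ext (gauge e) A + mu_ext (gauge e') B <= hausdorff s (A `|` B).
  move=> e0 e'0; pose m := Num.min (r / 2)%R (Num.min e e').
  have m0 : (0 < m)%R by rewrite !lt_min e0 e'0 divr_gt0.
  have mr : (m < r)%R by rewrite gt_min; apply/orP; left; lra.
  have mono (C : set E) (t : R) : (m <= t)%R -> mu_ext (gauge t) C <= mu_ext (gauge m) C.
    move=> mt; apply: le_ereal_inf_tmp => _ [F FC <-].
    apply: (@le_trans _ _ (\sum_(k <oo) gauge t (F k))).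
      by apply: ereal_inf_lbound; exists F.
    apply: lee_nneseries => [*|k _]; [exact: gauge_ge0|exact: gauge_antitone].
  apply: (@le_trans _ _ (mu_ext (gauge m) A + mu_ext (gauge m) B)).
    by apply: leeD; apply: mono; rewrite !ge_min lexx ?orbT.
  apply: le_trans (mu_ext_gauge_sep mr AB) _.
  by apply: ereal_sup_ubound; exists m.
have [->|Zoo] := eqVneq (hausdorff s (A `|` B)) +oo; first by rewrite leey.
have ext0 t C : 0 <= mu_ext (gauge t) C by apply: mu_ext_ge0 => X; exact: gauge_ge0.
have Zfin : hausdorff s (A `|` B) \is a fin_num.
  rewrite ge0_fin_numE ?ltey//.
  exact: (le_trans (adde_ge0 (ext0 _ _) (ext0 _ _)) (key _ _ ltr01 ltr01)).
have finB e' : (0 < e')%R -> mu_ext (gauge e') B \is a fin_num.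
  move=> e'0; rewrite ge0_fin_numE//; apply: (@le_lt_trans _ _ (hausdorff s (A `|` B))).
    by apply: le_trans (key _ _ ltr01 e'0); rewrite leeDr.
  by rewrite ltey.
have hA e' : (0 < e')%R -> hausdorff s A + mu_ext (gauge e') B <= hausdorff s (A `|` B).
  move=> e'0; rewrite -leeBrDr ?finB//; apply: ge_ereal_sup => _ [e e0 <-].
  by rewrite leeBrDr ?finB//; exact: key.
have finA : hausdorff s A \is a fin_num.
  rewrite ge0_fin_numE ?outer_measure_ge0//; apply: (@le_lt_trans _ _ (hausdorff s (A `|` B))).
    by apply: le_trans (hA _ ltr01); rewrite leeDl.
  by rewrite ltey.
rewrite addeC -leeBrDr//; apply: ge_ereal_sup => _ [e e0 <-].
by rewrite leeBrDr// addeC; exact: hA.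
Qed.

(** The identity, seen as a map from the Carathéodory sigma-algebra to the columns, is measurable as
    soon as its coordinates are; on the generating half-lines this is the separation criterion
    applied to a coordinate. *)
Lemma measurable_hausdorff (A : set E) :
  measurable A -> (hausdorff s : {outer_measure set E -> \bar R}).-caratheodory A.
Proof.
move=> mA; pose H := caratheodory_type (hausdorff s : {outer_measure set E -> \bar R}).
suff mid : measurable_fun [set: H] (id : H -> E).
  by have := mid measurableT _ mA; rewrite setTI.
apply: measurable_fun_coordP => i.
apply: (measurability _ (RGenOInfty.measurableE R)) => _ [_ [a ->] <-].
rewrite setTI (_ : _ @^-1` _ = [set x : E | (a < coord i x)%R]).
  by apply: caratheodory_separated => B C e e0 h; exact: (hausdorff_sep e0 h).
by apply/seteqP; split=> x /=; rewrite in_itv/= andbT.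
Qed.

End hausdorff_borel.

(** * Square roots of symmetric positive definite matrices *)

Section spd_square_root.
Import complex.

Lemma interpolation (F : fieldType) (s : seq F) (g : F -> F) :
  exists p : {poly F}, {in s, forall x, p.[x] = g x}.
Proof.
elim: s => [|a s [p ps]]; first by exists 0.
have [as_|as_] := boolP (a \in s).
  by exists p => x; rewrite inE => /orP[/eqP->|]; exact: ps.
pose w := \prod_(b <- s) ('X - b%:P).
have wa : w.[a] != 0 by have := as_; rewrite -root_prod_XsubC.
exists (p + ((g a - p.[a]) / w.[a]) *: w) => x; rewrite inE hornerD hornerZ.
move=> /orP[/eqP->|xs]; first by rewrite divfK// addrC subrK.
have : root w x by rewrite root_prod_XsubC.
by rewrite rootE => /eqP->; rewrite mulr0 addr0 ps.
Qed.

Lemma trmx_horner (F : fieldType) n (A : 'M[F]_n.+1) (p : {poly F}) :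
  A^T = A -> (horner_mx A p)^T = horner_mx A p.
Proof.
move=> AT; elim/poly_ind: p => [|p c IH]; first by rewrite rmorph0 trmx0.
rewrite rmorphD rmorphM/= horner_mx_X horner_mx_C linearD/= tr_scalar_mx.
by rewrite trmx_mul AT IH; congr (_ + _); apply: comm_mx_horner.
Qed.

(** The Hermitian spectral theorem applies over the complex numbers and yields real eigenvalues.
    Diagonalizability returns to the reals in polynomial form: a polynomial vanishing on the
    spectrum annihilates [A]. *)
Lemma symmetric_spectrum (R : rcfType) n (A : 'M[R]_n.+1) : A^T = A ->
  exists s : seq R,
    {in s, forall l, exists2 x : 'rV[R]_n.+1, x != 0 & x *m A = l *: x} /\
    forall q : {poly R}, {in s, forall l, q.[l] = 0} -> horner_mx A q = 0.
Proof.
move=> AT; pose M := map_mx (real_complex R) A.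
have Mherm : M \is hermsymmx.
  apply/is_hermitianmxP; rewrite expr0 scale1r; apply/matrixP => i j.
  by rewrite !mxE -[in LHS]AT mxE conj_Creal// complex_real.
have Dreal := hermitian_spectral_diag_real Mherm.
have /hermitian_normalmx/orthomx_spectralP ME := Mherm.
set P := spectralmx M in ME; set D := spectral_diag M in ME Dreal.
have Pu : P \in unitmx by exact: spectral_unit.
have DE i : D 0 i = real_complex R (complex.Re (D 0 i)).
  by rewrite RRe_real//; have /mxOverP := Dreal; apply.
exists [seq complex.Re (D 0 i) | i <- enum 'I_n.+1]; split=> [l /mapP[i _ ->]|q qD].
  have PM : row i P *m M = D 0 i *: row i P.
    by rewrite -row_mul {1}ME !mulmxA mulmxV// mul1mx row_mul row_diag_mx -scalemxAl -rowE.
  have PN0 : row i P != 0.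
    apply/eqP => Pi0; have /row_freeP[B PB] : row_free P by rewrite row_free_unit.
    have /(congr1 (row i)) := PB; rewrite row_mul Pi0 mul0mx row1 => /rowP/(_ i).
    by rewrite !mxE !eqxx => /esym/eqP; rewrite oner_eq0.
  (* One argument for the real and the imaginary part: both are real-linear, so each maps the
     complex eigenvector to a solution of the real eigenvalue equation. At least one of the two
     images is nonzero. *)
  have ReM (f : R[i] -> R) : (forall x y, f (x + y) = f x + f y) -> f 0 = 0 ->
      (forall (x : R[i]) (a : R), f (x * real_complex R a) = f x * a) ->
      map_mx f (row i P) *m A = complex.Re (D 0 i) *: map_mx f (row i P).
    move=> fD f0 fM; apply/rowP => j.
    have /rowP/(_ j) := PM; rewrite !mxE => /(congr1 f).
    rewrite (big_morph f fD f0) mulrC {1}DE fM mulrC => <-.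
    by apply: eq_bigr => k _; rewrite !mxE fM.
  have [Re0|ReN0] := eqVneq (map_mx (@complex.Re R) (row i P)) 0; last first.
    exists (map_mx (@complex.Re R) (row i P)) => //; apply: ReM => //.
    - by move=> [a b] [c e].
    - by move=> [a b] c /=; rewrite mulr0 subr0.
  exists (map_mx (@complex.Im R) (row i P)); last first.
    apply: ReM => //.
    - by move=> [a b] [c e].
    - by move=> [a b] c /=; rewrite mulr0 add0r.
  apply: contra PN0 => /eqP Im0; apply/eqP/rowP => j.
  have /rowP/(_ j) := Re0; have /rowP/(_ j) := Im0; rewrite !mxE.
  by case: (P i j) => a b /= -> ->.
apply: (map_mx_inj (f := real_complex R)); rewrite map_mx0 map_horner_mx -/M ME.
have q0 : map_mx (horner (map_poly (real_complex R) q)) D = 0.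
  apply/rowP => i; rewrite !mxE DE horner_map/= qD ?rmorph0//.
  by apply/mapP; exists i => //; rewrite mem_enum.
have dq0 : horner_mx (diag_mx D) (map_poly (real_complex R) q) = 0.
  rewrite horner_mx_diag q0.
  exact: raddf0.
rewrite (horner_mx_uconjC _ _ Pu) dq0.
by rewrite mulmx0 mul0mx.
Qed.

End spd_square_root.

Section msqrt_spec.
Context {R : realType}.

Lemma dotE d (u v : 'cV[R]_d) : dot u v = (u^T *m v) 0 0.
Proof. by rewrite mxE; apply: eq_bigr => i _; rewrite mxE. Qed.

Lemma dotC d (u v : 'cV[R]_d) : dot u v = dot v u.
Proof. by apply: eq_bigr => i _; rewrite mulrC. Qed.

Lemma dotDr d (u v w : 'cV[R]_d) : dot u (v + w) = dot u v + dot u w.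
Proof. by rewrite !dotE mulmxDr mxE. Qed.

Lemma dotDl d (u v w : 'cV[R]_d) : dot (u + v) w = dot u w + dot v w.
Proof. by rewrite dotC dotDr !(dotC w). Qed.

Lemma dotZr d (a : R) (u v : 'cV[R]_d) : dot u (a *: v) = a * dot u v.
Proof. by rewrite !dotE -scalemxAr mxE. Qed.

Lemma dotZl d (a : R) (u v : 'cV[R]_d) : dot (a *: u) v = a * dot u v.
Proof. by rewrite dotC dotZr dotC. Qed.

Lemma dotNr d (u v : 'cV[R]_d) : dot u (- v) = - dot u v.
Proof. by rewrite -scaleN1r dotZr mulN1r. Qed.

Lemma dotNl d (u v : 'cV[R]_d) : dot (- u) v = - dot u v.
Proof. by rewrite dotC dotNr dotC. Qed.

Lemma dot_eq0 d (x : 'cV[R]_d) : dot x x = 0 -> x = 0.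
Proof.
rewrite /dot => xx; apply/colP => i; apply/eqP; rewrite [X in _ == X]mxE -sqrf_eq0 expr2.
apply/eqP; apply: (psumr_eq0P _ xx) => // j _; rewrite -expr2; exact: sqr_ge0.
Qed.

Lemma exists_msqrt d (A : 'M[R]_d) : A^T = A ->
  (forall xi, xi != 0 -> 0 < dot xi (A *m xi)) ->
  exists S : 'M[R]_d, [/\ S^T = S, forall xi, xi != 0 -> 0 < dot xi (S *m xi) &
    S *m S = A].
Proof.
case: d A => [|d] A AT Apos.
  exists 0; split=> [|xi|]; [by apply/matrixP => -[]| |by apply/matrixP => -[]].
  by rewrite [xi]flatmx0 eqxx.
have [s [seig sann]] := symmetric_spectrum AT.
have spos : {in s, forall l, 0 < l}.
  move=> l /seig[x x0 xA]; have := Apos x^T.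
  rewrite -(inj_eq (@trmx_inj _ _ _)) trmxK trmx0 => /(_ x0).
  rewrite dotE trmxK mulmxA xA -scalemxAl mxE => h.
  have : 0 <= dot x^T x^T by exact: dot_ge0.
  rewrite dotE trmxK le_eqVlt => /orP[/eqP h0|h0]; first by move: h; rewrite -h0 mulr0 ltxx.
  by rewrite -(pmulr_lgt0 _ h0).
(* Fourth roots are interpolated rather than square roots: with [Q = p(A)] symmetric, the candidate
   [Q *m Q] is positive semidefinite by its form, and definite because [Q xi = 0] would force
   [A xi = 0]. *)
have [p ps] := interpolation s (fun l => Num.sqrt (Num.sqrt l)).
pose Q := horner_mx A p.
have QT : Q^T = Q by exact: trmx_horner.
have Q4 : (Q *m Q) *m (Q *m Q) = A.
  have /eqP : horner_mx A (p * p * (p * p) - 'X) = 0.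
    apply: sann => l ls; rewrite hornerD hornerN hornerX !hornerM !(ps _ ls) -!expr2.
    by rewrite !sqr_sqrtr ?subrr ?sqrtr_ge0// ltW// spos.
  by rewrite rmorphB/= !rmorphM/= horner_mx_X subr_eq0 => /eqP.
exists (Q *m Q); split=> // [|xi xi0]; first by rewrite trmx_mul QT.
rewrite dotE -mulmxA mulmxA -{1}QT -trmx_mul -dotE lt_neqAle dot_ge0 andbT eq_sym.
apply/eqP => Qxi0.
have Qxi : Q *m xi = 0.
  exact: dot_eq0.
by have := Apos xi xi0; rewrite -Q4 -!mulmxA Qxi !mulmx0 dotE mulmx0 mxE ltxx.
Qed.

(** [msqrt] returns 0 when no root exists; the existence of a root excludes this default, and
    positivity makes the chosen root invertible. *)
Lemma msqrtP d (A : 'M[R]_d) : A^T = A ->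
  (forall xi, xi != 0 -> 0 < dot xi (A *m xi)) ->
  [/\ (msqrt A)^T = msqrt A, msqrt A \in unitmx & msqrt A *m msqrt A = A].
Proof.
move=> AT Apos; rewrite /msqrt; case: xgetP => [S _ [ST Spos SS]|noS]; last first.
  by have [S hS] := exists_msqrt AT Apos; have := noS S.
split=> //; rewrite -unitmx_tr -row_free_unit -kermx_eq0; apply/rowV0P => v /sub_kermxP vS.
apply/eqP/negPn/negP => v0; have := Spos v^T.
rewrite -(inj_eq (@trmx_inj _ _ _)) trmxK trmx0 => /(_ v0).
by rewrite dotE trmxK mulmxA -{1}ST vS mul0mx mxE ltxx.
Qed.

End msqrt_spec.

(** * Null sets and triangulations of Lipschitz domains *)

Section continuous_real.
Context {R : realType} {T : topologicalType}.
Implicit Types f g : T -> R.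

Lemma continuous_add f g : continuous f -> continuous g ->
  continuous (fun x => f x + g x).
Proof. by move=> cf cg x; apply: (@cvgD _ _ _ _ _ f g); [exact: cf|exact: cg]. Qed.

Lemma continuous_sub f g : continuous f -> continuous g ->
  continuous (fun x => f x - g x).
Proof. by move=> cf cg x; apply: (@cvgB _ _ _ _ _ f g); [exact: cf|exact: cg]. Qed.

Lemma continuous_mul f g : continuous f -> continuous g ->
  continuous (fun x => f x * g x).
Proof. by move=> cf cg x; apply: (@cvgM _ _ _ _ f g); [exact: cf|exact: cg]. Qed.

End continuous_real.

Section null_sets.
Import HBNNSimple.
Local Open Scope ereal_scope.

(* The integral of a nonnegative function is a supremum over simple functions
   below it, so null sets can be discarded even when the integrand is not
   measurable. *)
Lemma ge0_integral_setD_null disp (T : measurableType disp) (R : realType)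
    (mu : {measure set T -> \bar R}) (D N : set T) (f : T -> \bar R) :
  measurable N -> mu N = 0 -> (forall x, D x -> 0 <= f x) ->
  \int[mu]_(x in D) f x = \int[mu]_(x in D `\` N) f x.
Proof.
move=> mN N0 f0.
have f0' x : (D `\` N) x -> 0 <= f x by move=> [Dx _]; exact: f0.
have p0 (C : set T) : (forall x, C x -> 0 <= f x) -> forall x, 0 <= (f \_ C) x.
  by move=> C0 x; rewrite patchE; case: ifPn => //; rewrite inE; exact: C0.
rewrite integral_mkcond [RHS]integral_mkcond !ge0_integralTE//; [|exact: p0..].
apply/eqP; rewrite eq_le; apply/andP; split; apply: ge_ereal_sup => _ [h hf <-].
  have mNC := measurableC mN.
  (* Truncating the simple function to the complement of [N] keeps its integral and puts it below
     [f] on [D] minus [N]. *)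
  apply: ereal_sup_ubound; exists (proj_nnsfun h mNC) => /=.
    move=> x; rewrite mindicE patchE in_setD in_setC.
    have := hf x; rewrite patchE; case: (x \in N) => /=; rewrite ?mulr1 ?mulr0 ?andbT ?andbF//.
  rewrite -!integralT_nnsfun (@ge0_negligible_integral _ _ _ _ _ N)//; last 2 first.
  - by apply/measurable_EFinP; exact: measurable_funPT.
  - by move=> x _; rewrite lee_fin fun_ge0.
  rewrite [RHS](@ge0_negligible_integral _ _ _ _ _ N)//; last 2 first.
  - by apply/measurable_EFinP; exact: measurable_funPT.
  - by move=> x _; rewrite lee_fin fun_ge0.
  apply: eq_integral => x; rewrite inE => -[_ Nx] /=.
  by rewrite mindicE in_setC memNset// mulr1.
apply: ereal_sup_ubound; exists h => // x; apply: le_trans (hf x) _.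
rewrite !patchE in_setD; case: ifPn => [/andP[->]//|_].
by case: ifPn => //; rewrite inE => /f0.
Qed.

Lemma negligible_measure0 disp (T : measurableType disp) (R : realType)
    (mu : {measure set T -> \bar R}) (P : T -> Prop) :
  {ae mu, forall x, P x} -> exists N, [/\ measurable N, mu N = 0 & forall x, ~ N x -> P x].
Proof.
move=> [N [mN N0 PN]]; exists N; split=> // x Nx; apply: contrapT => Px.
exact/Nx/PN.
Qed.

Lemma measure0_bigsetU disp (T : measurableType disp) (R : realType)
    (mu : {measure set T -> \bar R}) (I : eqType) (s : seq I) (F : I -> set T) :
  {in s, forall i, measurable (F i) /\ mu (F i) = 0} ->
  measurable (\big[setU/set0]_(i <- s) F i) /\ mu (\big[setU/set0]_(i <- s) F i) = 0.
Proof.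
move=> F0; rewrite big_seq.
apply: (big_ind (fun A => measurable A /\ mu A = 0)) => //.
by move=> A B [mA A0] [mB B0]; split; [exact: measurableU|exact: null_set_setU].
Qed.

Section hyperplane.
Context {R : realType}.

Lemma lebesgueS n (A : set 'cV[R]_n.+1) :
  lebesgue n.+1 A = (lebesgue_measure \x lebesgue n) (@col_cons R n @^-1` A).
Proof. by []. Qed.

Lemma dot_col_cons n (a : 'cV[R]_n.+1) p :
  (dot a (col_cons p) = a ord0 ord0 * p.1 + dot (\col_j a (lift ord0 j) ord0) p.2)%R.
Proof.
rewrite /dot big_ord_recl; congr (_ * _ + _)%R; first by rewrite mxE unlift_none.
by apply: eq_bigr => j _; rewrite !mxE liftK.
Qed.

Lemma dot_continuous n (a : 'cV[R]_n) : continuous (dot a).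
Proof.
apply: continuous_big => [|i _ x]; first exact: add_continuous.
by apply: continuousM; [exact: cst_continuous|exact: coord_continuous].
Qed.

Lemma measurable_hyperplane n (a : 'cV[R]_n) (c : R) :
  measurable [set x : 'cV[R]_n | dot a x = c].
Proof.
rewrite (_ : [set x | _] = dot a @^-1` [set c]) //.
rewrite -[X in measurable X]setTI; apply: continuous_measurable_col => //.
exact: dot_continuous.
Qed.

(** Induction through the product structure of the measure. If the leading coefficient vanishes,
    every slice at a fixed first coordinate is a hyperplane of lower dimension; otherwise every
    slice at fixed remaining coordinates is a single point. *)
Lemma lebesgue_hyperplane n (a : 'cV[R]_n) (c : R) : a != 0%R ->
  lebesgue n [set x | dot a x = c] = 0.
Proof.
elim: n a c => [a c|n IH a c a0]; first by rewrite [a]flatmx0 eqxx.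
rewrite lebesgueS; set A := _ @^-1` _.
have mA : measurable A.
  by rewrite -[A]setTI; apply: measurable_col_cons => //; exact: measurable_hyperplane.
have [a00|a00] := eqVneq (a ord0 ord0) 0%R.
  apply: integral0_eq => t _ /=.
  rewrite (_ : xsection A t = [set x | dot (\col_j a (lift ord0 j) ord0) x = c]).
    apply: IH; apply: contra a0 => /eqP/colP a'0; apply/eqP/colP => i; rewrite mxE.
    by case: (unliftP ord0 i) => [j ->|->//]; have := a'0 j; rewrite !mxE.
  apply/seteqP; split=> x; rewrite /xsection /= inE /A /= dot_col_cons /= a00 mul0r add0r//.
(* The product measure is defined by slicing at the first coordinate; uniqueness permits slicing at
   the others. *)
rewrite (@product_measure_unique _ _ _ _ _ _ _ (lebesgue_measure \x^ lebesgue n))//; last first.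
  by move=> X Y mX mY; exact: product_measure2E.
apply: integral0_eq => x _ /=.
set b := dot (\col_j a (lift ord0 j) ord0) x.
rewrite (_ : ysection A x = [set ((c - b) / a ord0 ord0)%R]) ?lebesgue_measure_set1//.
apply/seteqP; split=> t; rewrite /ysection /= inE /A /= dot_col_cons /= -/b.
  by move=> <-; field.
by move=> ->; field.
Qed.

End hyperplane.
End null_sets.

(** * Barycentric coordinates, simplices and tilings of a Lipschitz domain *)

Section simplices.
Context {R : realType} {d : nat}.
Local Notation E := 'cV[R]_d.
Implicit Types (K : 'M[R]_(d, d.+1)) (x y : E).

(** Affine independence says that [K] with a row of ones on top is invertible, and the rows of the
    inverse are the affine coordinate functions. Signs are left free, so the equivalence serves
    faces and open simplices alike. *)
Lemma barycentric_coordinates K : affinely_independent K ->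
  exists (n : 'I_d.+1 -> E) (c : 'I_d.+1 -> R),
    forall x (l : 'cV[R]_d.+1),
      (\sum_i l i 0 = 1 /\ x = K *m l) <-> (forall i, l i 0 = dot (n i) x + c i).
Proof.
move=> indK; pose B : 'M[R]_(1 + d, 1 + d) := col_mx (const_mx 1) K.
have onesE (l : 'cV[R]_d.+1) : (const_mx 1 : 'rV[R]_(1 + d)) *m l = (\sum_i l i 0)%:M.
  apply/matrixP => i j; rewrite !ord1 !mxE eqxx mulr1n.
  by apply: eq_bigr => k _; rewrite mxE mul1r.
have Bu : B \in unitmx.
  rewrite -unitmx_tr -row_free_unit -kermx_eq0; apply/rowV0P => v /sub_kermxP vB.
  have : B *m v^T = 0 by rewrite -[LHS]trmxK trmx_mul trmxK vB trmx0.
  rewrite mul_col_mx -col_mx0 => /eq_col_mx[]; rewrite onesE => /matrixP/(_ 0 0).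
  rewrite !mxE eqxx mulr1n => s0 K0.
  by apply: (@trmx_inj _ _ _); rewrite trmx0; exact: indK.
pose L := invmx B.
exists (fun i => (row i (rsubmx L))^T), (fun i => lsubmx L i 0) => x l.
have -> : (\sum_i l i 0 = 1 /\ x = K *m l) <-> B *m l = col_mx 1%:M x.
  rewrite mul_col_mx onesE; split=> [[-> ->]//|/eq_col_mx[/matrixP/(_ 0 0)]].
  by rewrite !mxE eqxx !mulr1n.
have -> : (B *m l = col_mx 1%:M x) <-> (l = L *m col_mx 1%:M x).
  by split=> [<-|->]; [rewrite mulKmx|rewrite mulKVmx].
have LE i : (L *m col_mx 1%:M x) i 0 = dot (row i (rsubmx L))^T x + lsubmx L i 0.
  rewrite -[in LHS](hsubmxK L) mul_row_col mulmx1 mxE addrC; congr (_ + _).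
  by rewrite dotE trmxK -row_mul [RHS]mxE.
by split=> [-> i|lE]; [exact: LE|apply/colP => i; rewrite LE].
Qed.

(** The coordinates may have any sign: this is the union of the whole hyperplanes that carry the
    faces, a larger set than the boundary of the simplex but still a null set. *)
Definition face_union K : set E :=
  [set x | exists i, exists l : 'cV[R]_d.+1, [/\ \sum_j l j 0 = 1, x = K *m l & l i 0 = 0]].

Definition open_simplex K : set E :=
  [set x | exists l : 'cV[R]_d.+1,
    [/\ \sum_j l j 0 = 1, x = K *m l & forall i, 0 < l i 0]].

Lemma simplexE K : affinely_independent K ->
  simplex K `\` face_union K = open_simplex K.
Proof.
move=> /barycentric_coordinates[n [c nc]]; apply/seteqP; split=> x.
  move=> [[l [l0 l1] xl] nf]; exists l; split=> // i.
  by rewrite lt_neqAle l0 andbT eq_sym; apply/eqP => li; apply: nf; exists i, l.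
move=> [l [l1 xl l0]]; split; first by exists l => //; split=> // i; exact: ltW.
move=> [i [m [m1 xm mi]]]; have /nc/(_ i) := conj l1 xl; have /nc/(_ i) := conj m1 xm.
by rewrite mi => <- li; have := l0 i; rewrite li ltxx.
Qed.

Lemma face_unionE K : affinely_independent K -> (0 < d)%N ->
  exists (n : 'I_d.+1 -> E) (c : 'I_d.+1 -> R), (forall i, n i != 0) /\
   face_union K = \bigcup_(i in [set: 'I_d.+1]) [set x | dot (n i) x = c i].
Proof.
move=> /barycentric_coordinates[n [c nc]] d0; exists n, (fun i => - c i); split.
  (* A zero normal would make the i-th barycentric coordinate constant, yet it is 1 at vertex [i]
     and 0 at any other vertex; another vertex exists since [0 < d]. *)
  move=> i; apply/eqP => n0.
  have vertex j : (j == i)%:R = c i.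
    have /nc/(_ i) : \sum_k (delta_mx j 0 : 'cV[R]_d.+1) k 0 = 1 /\
        col j K = K *m delta_mx j 0.
      split; last by rewrite colE.
      rewrite (bigD1 j)//= !mxE !eqxx big1 ?addr0// => k kj.
      by rewrite !mxE (negbTE kj).
    rewrite n0 mxE andbT eq_sym => ->; rewrite /dot big1 ?add0r// => k _.
    by rewrite mxE mul0r.
  pose j := if i == ord0 then @ord_max d else ord0.
  have ji : j != i.
    rewrite /j; have [->|] := eqVneq i ord0; last by rewrite eq_sym.
    by apply/eqP => /(congr1 val) /= d00; rewrite d00 in d0.
  have := vertex j; rewrite -(vertex i) eqxx (negbTE ji) => /esym/eqP.
  by rewrite oner_eq0.
apply/seteqP; split=> x.
  move=> [i [l [l1 xl li]]]; exists i => //=.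
  by have /nc/(_ i) := conj l1 xl; rewrite li; lra.
move=> [i _ /= xi]; exists i, (\col_j (dot (n j) x + c j)).
have /nc[s1 s2] : forall j, (\col_j (dot (n j) x + c j)) j 0 = dot (n j) x + c j.
  by move=> j; rewrite mxE.
by split=> //; rewrite mxE xi; lra.
Qed.

Lemma face_union_null K : affinely_independent K -> (0 < d)%N ->
  measurable (face_union K) /\ lebesgue d (face_union K) = 0%E.
Proof.
move=> indK d0; have [n [c [n0 ->]]] := face_unionE indK d0.
rewrite (_ : [set: 'I_d.+1] = [set` enum 'I_d.+1]); last first.
  by apply/seteqP; split=> i //= _; rewrite mem_enum.
rewrite bigcup_seq; apply: measure0_bigsetU => i _; split.
  exact: measurable_hyperplane.
exact: lebesgue_hyperplane.
Qed.

Lemma open_simplex_open K : affinely_independent K -> open (open_simplex K).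
Proof.
move=> /barycentric_coordinates[n [c nc]].
rewrite (_ : open_simplex K = \bigcap_(i in [set: 'I_d.+1]) [set x | - c i < dot (n i) x]).
  rewrite openE => x xi; rewrite /interior.
  suff : \forall y \near x, forall i, - c i < dot (n i) y.
    by apply: filterS => y yi i _; exact: yi.
  apply: (@filter_forall _ _ _ _ (nbhs_filter x)) => i.
  apply: open_nbhs_nbhs; split; last exact: xi.
  apply: (@open_comp _ _ (dot (n i)) [set y | - c i < y]) => [y _|]; last exact: open_gt.
  exact: dot_continuous.
apply/seteqP; split=> x.
  move=> [l [l1 xl l0]] i _ /=; have /nc/(_ i) := conj l1 xl; have := l0 i; lra.
move=> xi; exists (\col_j (dot (n j) x + c j)).
have /nc[s1 s2] : forall j, (\col_j (dot (n j) x + c j)) j 0 = dot (n j) x + c j.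
  by move=> j; rewrite mxE.
by split=> // i; rewrite mxE; have := xi i I => /=; lra.
Qed.

(** A shared interior point lies in the common face with all coordinates positive, so every vertex
    of [K] is a vertex of [K']. Counting makes this a bijection of vertices; the simplices then
    coincide as sets, which injectivity of [simplex] on [T] excludes. *)
Lemma open_simplex_disjoint (T : seq 'M[R]_(d, d.+1)) (Om : set E) :
  triangulation Om T -> {in T &, forall K K', K != K' ->
    open_simplex K `&` open_simplex K' = set0}.
Proof.
move=> [_ indT injT _ faceT] K K' KT K'T KK'; apply/seteqP; split=> // x [xK xK'].
have [indK indK'] := (indT _ KT, indT _ K'T).
have : common_face K K' x.
  rewrite -faceT//; move: xK xK'; rewrite -!simplexE//.
  by move=> [? _] [? _].
move=> [l lb [xl lK]].
have [m [m1 xm m0]] := xK.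
have lm : l = m.
  apply/subr0_eq/indK; last by rewrite mulmxBr -xl -xm subrr.
  under eq_bigr do rewrite !mxE.
  by rewrite sumrB m1 lb.2 subrr.
have /choice[f fE] : forall i, exists j, col i K = col j K'.
  by move=> i; apply: lK; rewrite lm gt_eqF.
have finj : injective f.
  move=> i j fij; have colij : col i K = col j K by rewrite !fE fij.
  apply/eqP/negPn/negP => ij.
  have := indK (delta_mx i 0 - delta_mx j 0).
  rewrite mulmxBr -!colE colij subrr => /(_ _ erefl).
  have -> : \sum_k (delta_mx i 0 - delta_mx j 0 : 'cV[R]_d.+1) k 0 = 0.
    under eq_bigr do rewrite !mxE !andbT.
    rewrite sumrB (bigD1 i)//= eqxx big1 => [|k /negbTE->//].
    by rewrite (bigD1 j)//= eqxx big1 ?subrr// => k /negbTE->.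
  move=> /(_ erefl)/colP/(_ i); rewrite !mxE !eqxx !andbT (negbTE ij) subr0.
  by move/eqP; rewrite oner_eq0.
have sub (K1 K2 : 'M[R]_(d, d.+1)) (g h : 'I_d.+1 -> 'I_d.+1) :
    cancel g h -> cancel h g -> (forall i, col i K1 = col (g i) K2) ->
    simplex K1 `<=` simplex K2.
  move=> gh hg gE y [k [k0 k1] yk]; exists (\col_i k (h i) 0).
    split=> [i|]; first by rewrite mxE.
    rewrite -[RHS]k1 [RHS](reindex h) /=; last by exists g => i _.
    by apply: eq_bigr => i _; rewrite mxE.
  rewrite yk; apply/colP => a; rewrite !mxE (reindex h) /=; last by exists g => i _.
  apply: eq_bigr => i _; rewrite mxE; congr (_ * _).
  by have /colP/(_ a) := gE (h i); rewrite !mxE hg.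
move/eqP: KK'; apply; apply: injT => //.
have [g fg gf] := injF_bij finj.
apply/seteqP; split; first exact: (sub K K' f g fg gf fE).
apply: (sub K' K g f gf fg) => i.
by rewrite fE gf.
Qed.

Lemma enorm_continuous (f : E -> E) : (forall i, continuous (fun x => f x i 0)) ->
  continuous (fun x => enorm (f x)).
Proof.
move=> cf x.
apply: (@continuous_comp _ _ _ (fun x => dot (f x) (f x)) Num.sqrt); last exact: sqrt_continuous.
move: x; apply: continuous_big => [|i _ y]; first exact: add_continuous.
by apply: continuousM; exact: cf.
Qed.

Lemma projection_continuous (u v w : E) i :
  continuous (fun z : E => (z - dot u z *: v - w) i 0).
Proof.
rewrite (_ : (fun z : E => _) = fun z : E => z i 0 - dot u z * v i 0 - w i 0); last first.
  by apply/funext => z; rewrite !mxE.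
apply: continuous_sub; last exact: cst_continuous.
apply: continuous_sub; first exact: coord_continuous.
by apply: continuous_mul; [exact: dot_continuous|exact: cst_continuous].
Qed.

(* Moving a boundary point slightly along [nu] leaves the closure of a
   Lipschitz domain, so the domain contains every open subset of its closure. *)
Lemma lipschitz_open_sub (Om U : set E) :
  lipschitz_domain Om -> open U -> U `<=` closure Om -> U `<=` Om.
Proof.
move=> [oOm _ _ lip] oU UOm x Ux; apply: contrapT => nOmx.
have bx : bdry Om x.
  by split; [exact: UOm|move=> Ox; apply: nOmx; exact: (interior_subset Ox)].
have [nu [g [L [r [r0 nu1 glip gOm]]]]] := lip x bx.
have nunu : dot nu nu = 1.
  by rewrite -[RHS](expr1n _ 2) -nu1 sqr_sqrtr// dot_ge0.
have enorm0 : enorm (0 : E) = 0.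
  by rewrite /enorm /dot big1 ?sqrtr0// => i _; rewrite mxE mul0r.
pose p (z : E) := z - dot nu z *: nu.
have [t [t0 [Ut tr]]] : exists t, 0 < t /\ U (x + t *: nu) /\ enorm (t *: nu) < r.
  have /col_ballP[e e0 eU] : nbhs x U by exact: open_nbhs_nbhs.
  have m0 : 0 < Num.min e r by rewrite lt_min e0 r0.
  have : Num.min e r / 2 < Num.min e r by lra.
  rewrite lt_min => /andP[te tr].
  have t0 : 0 < Num.min e r / 2 by lra.
  exists (Num.min e r / 2); split=> //; split; last first.
    by rewrite /enorm dotZr dotC dotZr nunu mulr1 -expr2 sqrtr_sqr gtr0_norm.
  apply: eU => i; rewrite !mxE opprD addrA subrr sub0r normrN normrM gtr0_norm//.
  apply: le_lt_trans te; rewrite ler_piMr// ?(ltW t0)//.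
  by rewrite -nu1 coord_le_enorm.
pose y := x + t *: nu.
have py : p y = p x.
  by rewrite /p /y dotDr dotZr nunu mulr1 scalerDl opprD addrACA subrr addr0.
have xg : g (p x) <= dot nu x.
  rewrite leNgt; apply/negP => h; apply: nOmx; apply/gOm => //.
  by rewrite subrr enorm0.
(* The Lipschitz majorant [g (p y) + L * enorm (p z - p y)] of [g (p z)] is continuous in [z], so
   this strict inequality at [y] persists nearby and keeps a whole neighbourhood of [y] outside the
   domain. *)
have yg : g (p y) + L * enorm (p y - p y) < dot nu y.
  rewrite subrr enorm0 mulr0 addr0 py.
  by rewrite /y dotDr dotZr nunu mulr1; lra.
have cdiff : continuous (fun z => dot nu z - (g (p y) + L * enorm (p z - p y)) : R).
  apply: continuous_sub; first exact: dot_continuous.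
  apply: continuous_add; first exact: cst_continuous.
  apply: continuous_mul; first exact: cst_continuous.
  apply: (@enorm_continuous (fun z => p z - p y)) => i.
  exact: projection_continuous.
have cr : continuous (fun z : E => enorm (z - x)).
  apply: enorm_continuous => i.
  rewrite (_ : (fun _ => _) = fun z : E => z i 0 - x i 0); last by apply/funext => w; rewrite !mxE.
  by apply: continuous_sub; [exact: coord_continuous|exact: cst_continuous].
have nearz : \forall z \near y, ~ Om z.
  have h1 : \forall z \near y, 0 < dot nu z - (g (p y) + L * enorm (p z - p y)).
    apply: (@cvgr_gt _ _ _ (nbhs_filter y) _ _ (cdiff y)).
    by rewrite subr_gt0.
  have h2 : \forall z \near y, enorm (z - x) < r.
    apply: (@cvgr_lt _ _ _ (nbhs_filter y) _ _ (cr y)).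
    by rewrite /y addrC addKr.
  near=> z => Omz.
  have zr : enorm (z - x) < r by near: z.
  have := (gOm z zr).1 Omz; rewrite -/(p z) => zg.
  have zy : 0 < dot nu z - (g (p y) + L * enorm (p z - p y)) by near: z.
  by have := glip (p z) (p y); rewrite ler_norml => /andP[_]; lra.
have [z [Oz]] : (Om `&` [set z | ~ Om z]) !=set0 by apply: (UOm _ Ut); exact: nearz.
exact.
Unshelve. all: by end_near. Qed.

(** Off [N] and the face hyperplanes, the open simplices are disjoint, lie in [Om] and cover it.
    Measurability is asked only off [N], to admit integrands that are controlled only where the
    coefficient matrix is symmetric and elliptic. *)
Lemma sum_integral_simplex (Om N : set E) (T : seq 'M[R]_(d, d.+1)) (f : E -> \bar R) :
  (0 < d)%N -> lipschitz_domain Om -> triangulation Om T ->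
  measurable N -> lebesgue d N = 0%E -> (forall x, (0 <= f x)%E) ->
  measurable_fun (Om `\` N) f ->
  (\sum_(K <- T) \int[leb]_(x in simplex K) f x = \int[leb]_(x in Om) f x)%E.
Proof.
move=> d0 lipOm triT mN N0 f0 mf; have [uT indT _ clT _] := triT.
pose F := \big[setU/set0]_(K <- T) face_union K.
have [mF F0] : measurable F /\ lebesgue d F = 0%E.
  by apply: measure0_bigsetU => K KT; apply: face_union_null => //; exact: indT.
pose M := N `|` F.
have mM : measurable M by exact: measurableU.
have M0 : leb M = 0%E by rewrite /leb null_set_setU.
(* The value [set0] outside [T] makes [G K] measurable for every matrix [K], degenerate ones
   included. *)
pose G K := if K \in T then open_simplex K `\` M else set0.
have FK K x : K \in T -> face_union K x -> M x.
  by move=> KT Kx; right; rewrite /F -bigcup_seq; exists K.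
have simG K : K \in T -> simplex K `\` M = G K.
  move=> KT; rewrite /G KT -simplexE; last exact: indT.
  apply/seteqP; split=> x [] Kx Mx; last by split=> //; case: Kx.
  by split=> //; split=> // /(FK _ _ KT).
have subOm K : K \in T -> open_simplex K `<=` Om.
  move=> KT; apply: (lipschitz_open_sub lipOm); first exact: open_simplex_open (indT _ KT).
  rewrite clT => x; rewrite -simplexE; last exact: indT.
  by move=> [Kx _]; exists K.
have UG : \big[setU/set0]_(K <- T) G K = Om `\` M.
  rewrite -bigcup_seq; apply/seteqP; split=> x.
    by move=> [K /= KT]; rewrite /G KT => -[Kx Mx]; split=> //; exact: subOm KT _ Kx.
  move=> [Ox Mx]; have : closure Om x by exact: subset_closure.
  by rewrite clT => -[K KT Kx]; exists K => //; rewrite -simG.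
rewrite (@ge0_integral_setD_null _ _ _ leb Om M)// -UG.
rewrite ge0_integral_bigsetU//.
- rewrite big_seq [RHS]big_seq; apply: eq_bigr => K KT.
  by rewrite -simG//; exact: ge0_integral_setD_null.
- move=> K; rewrite /G; case: ifPn => // KT; apply: measurableD => //.
  apply: open_measurable_col; exact: open_simplex_open (indT _ KT).
- apply/trivIsetP => K K' /= KT K'T KK'; rewrite /G KT K'T.
  have KK0 := open_simplex_disjoint triT KT K'T KK'.
  by apply/seteqP; split=> // x [[Kx _] [K'x _]]; rewrite -KK0; split.
- rewrite UG; apply: measurable_funS mf.
    apply: measurableD => //; apply: open_measurable_col; by case: lipOm.
  by move=> x [Ox Mx]; split=> // Nx; apply: Mx; left.
Qed.

End simplices.

(** * Integrals of partial derivatives *)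

Definition cube {R : realType} (n : nat) (M : R) : set 'cV[R]_n :=
  [set x | forall i, `|x i 0| <= M].
Arguments cube {R} n M _ /.
Arguments cube : simpl never.

Section boxes.
Context {R : realType}.
Implicit Types M : R.

Lemma measurable_cube n M : measurable (cube n M).
Proof.
rewrite (_ : cube n M = \bigcap_(i in [set: 'I_n]) coord i @^-1` `[- M, M]).
  by apply: fin_bigcap_measurable => // i _; exact: measurable_coord_preimage.
apply/seteqP; split=> x h i; first by move=> _; rewrite /= in_itv/= -ler_norml; exact: h.
by have := h i I; rewrite /= in_itv/= -ler_norml.
Qed.

Lemma cube_col_cons n M : @col_cons R n @^-1` cube n.+1 M = `[- M, M] `*` cube n M.
Proof.
apply/seteqP; split=> -[t x] /=.
  move=> h; split=> /=.
    by have := h ord0; rewrite mxE unlift_none in_itv/= -ler_norml.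
  by move=> j; have := h (lift ord0 j); rewrite mxE liftK.
rewrite in_itv/= -ler_norml => -[tM xM] i.
by case: (unliftP ord0 i) => [j ->|->]; rewrite mxE ?liftK ?unlift_none//; exact: xM.
Qed.

Lemma lebesgue_cube n M : (lebesgue n (cube n M) < +oo)%E.
Proof.
elim: n => [|n IH] /=.
  by rewrite diracE; case: (_ \in _); rewrite ltry.
rewrite lebesgueS cube_col_cons product_measure1E//; last exact: measurable_cube.
have h : lebesgue_measure (`[(- M)%R, M]%classic : set R) \is a fin_num.
  by rewrite lebesgue_measure_itv; case: ifP => _; rewrite -?EFinB.
by apply: lte_mul_pinfty.
Qed.

Lemma integrable_cube n (M C : R) (f : 'cV[R]_n -> R) : measurable_fun setT f ->
  (forall x, `|f x| <= C) -> (forall x, ~ cube n M x -> f x = 0) ->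
  (lebesgue n).-integrable setT (EFin \o f).
Proof.
move=> mf fC f0.
rewrite (_ : EFin \o f = (EFin \o f) \_ (cube n M)); last first.
  by apply/funext => x; rewrite patchE; case: ifPn => // /negP; rewrite inE => /f0 /= ->.
apply/(integrable_mkcond _ (@measurable_cube n M)).
apply: measurable_bounded_integrable.
- exact: measurable_cube.
- exact: lebesgue_cube.
- exact: measurable_funS mf.
- by exists C; split; [exact: num_real|move=> x Cx y _ /=; rewrite (le_trans (fC y))// ltW].
Qed.

End boxes.

Section integral_partial.
Context {R : realType}.

(** Shifts along a later coordinate commute with splitting off the first one, so the difference
    quotients of a function are those of its slices. *)
Lemma col_cons_shift n (t : R) (x : 'cV[R]_n) (h : R) j :
  h *: unit_col (lift ord0 j) + col_cons (t, x) = col_cons (t, h *: unit_col j + x).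
Proof.
apply/colP => i; rewrite !mxE !andbT; case: (unliftP ord0 i) => [k ->|->] /=.
  by rewrite !mxE !andbT (inj_eq (@lift_inj _ _)).
by rewrite mulr0 add0r.
Qed.

Lemma col_cons_shift0 n (t : R) (x : 'cV[R]_n) (h : R) :
  h *: unit_col ord0 + col_cons (t, x) = col_cons (h *: 1 + t, x).
Proof.
apply/colP => i; rewrite !mxE !andbT; case: (unliftP ord0 i) => [k ->|->] /=.
  by rewrite mulr0 add0r.
by [].
Qed.

Lemma continuous_col_cons n (t : R) : continuous (fun x : 'cV[R]_n => col_cons (t, x)).
Proof.
move=> x U /col_ballP[e e0 eU]; apply/col_ballP; exists e => // y xy; apply: eU => i.
rewrite !mxE; case: (unliftP ord0 i) => [j _|_]; first exact: xy.
by rewrite subrr normr0.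
Qed.

Lemma continuous_col_cons1 n (x : 'cV[R]_n) : continuous (fun t : R => col_cons (t, x)).
Proof.
move=> t U /col_ballP[e e0 eU]; apply/nbhs_ballP; exists e => // s ts; apply: eU => i.
rewrite !mxE; case: (unliftP ord0 i) => [j _|_]; last exact: ts.
by rewrite subrr normr0.
Qed.

Lemma ge0_integral_lebesgueS n (f : 'cV[R]_n.+1 -> \bar R) :
  measurable_fun setT f -> (forall x, (0 <= f x)%E) ->
  (\int[lebesgue n.+1]_x f x =
   \int[(lebesgue_measure \x lebesgue n)%E]_p (f \o @col_cons R n) p)%E.
Proof.
move=> mf f0; have := @ge0_integral_pushforward _ _ (measurableTypeR R * 'cV[R]_n)%type _ _ _
  (@measurable_col_cons R n) (lebesgue_measure \x lebesgue n)%E setT f.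
by rewrite preimage_setT => ->.
Qed.

Lemma integral_derivative_compact (M : R) (F : R -> R) :
  (forall t, derivable F t 1) -> continuous (derive1 F) ->
  (forall t, M < `|t| -> F t = 0 /\ derive1 F t = 0) ->
  (\int[lebesgue_measure]_t (derive1 F t)%:E = 0)%E.
Proof.
move=> dF cF' FM; pose b : R := `|M| + 1.
have b0 : 0 < b by rewrite /b ltr_pwDr// normr_ge0.
have Mb : M < b by rewrite (le_lt_trans (ler_norm M))// ltrDl.
have cF : continuous F by move=> t; apply/differentiable_continuous/derivable1_diffP.
have -> : (\int[lebesgue_measure]_t (derive1 F t)%:E =
    \int[lebesgue_measure]_(t in `[(- b)%R, b]) (derive1 F t)%:E)%E.
  rewrite [RHS]integral_mkcond; apply: eq_integral => t _; rewrite patchE.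
  case: ifPn => // /negP; rewrite inE/= in_itv/= -ler_norml => /negP; rewrite -ltNge => bt.
  by rewrite (FM t _).2// (lt_trans Mb).
have bb : - b < b by rewrite ltrNl (lt_trans _ b0)// oppr_lt0.
have FTC : derivable_oo_LRcontinuous F (- b) b.
  split=> [t _| |]; first exact: dF.
  - by apply: cvg_at_right_filter; exact: cF.
  - by apply: cvg_at_left_filter; exact: cF.
rewrite (continuous_FTC2 bb (continuous_subspaceT cF') FTC); last by [].
by rewrite !(FM _ _).1 ?subee// ?normrN gtr0_norm.
Qed.

(** Fubini and induction on the dimension. For the first direction, that variable is integrated
    first, by the fundamental theorem of calculus; for the others, the slices at a fixed first
    coordinate satisfy the same hypotheses with the same [M] and [C]. *)
Lemma integral_partial n (i : 'I_n) (f : 'cV[R]_n -> R) (M C : R) :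
  (forall x, derivable f x (unit_col i)) -> continuous (partial i f) ->
  (forall x, `|partial i f x| <= C) ->
  (forall x, ~ cube n M x -> f x = 0 /\ partial i f x = 0) ->
  (\int[lebesgue n]_x (partial i f x)%:E = 0)%E.
Proof.
elim: n i f => [[]//|n IH] i f df cg gC fM.
have mg := continuous_measurable_col cg.
have ig := integrable_cube mg gC (fun x xM => (fM x xM).2).
have iG : (lebesgue_measure \x lebesgue n)%E.-integrable setT
    (EFin \o partial i f \o (@col_cons R n)).
  apply/integrableP; split.
    by apply: measurableT_comp (@measurable_col_cons R n); exact/measurable_EFinP.
  have /integrableP[_] := ig.
  rewrite (@ge0_integral_lebesgueS _ (fun x => `|(EFin \o partial i f) x|%E))//.
  by apply: measurableT_comp => //; exact/measurable_EFinP.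
transitivity (\int[(lebesgue_measure \x lebesgue n)%E]_p (partial i f (col_cons p))%:E)%E.
  have := @integral_pushforward _ _ (measurableTypeR R * 'cV[R]_n)%type _ _ _
    (@measurable_col_cons R n) (lebesgue_measure \x lebesgue n)%E setT (EFin \o partial i f).
  by rewrite preimage_setT => ->//; exact/measurable_EFinP.
case: (unliftP ord0 i) => [j ij|i0].
  have fE t x : derivable (fun x => f (col_cons (t, x))) x (unit_col j) /\
      partial j (fun x => f (col_cons (t, x))) x = partial i f (col_cons (t, x)).
    have := df (col_cons (t, x)).
    rewrite /partial /derive /derivable ij.
    rewrite (_ : (fun h => h^-1 *: ((f \o _) _ - _)) = (fun h : R => h^-1 *:
      (((fun x => f (col_cons (t, x))) \o shift x) (h *: unit_col j) - f (col_cons (t, x)))))//.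
    by apply/funext => h /=; rewrite col_cons_shift.
  rewrite -(integral12_prod_meas1 iG); apply: integral0_eq => t _.
  rewrite /fubini_F -[RHS](IH j (fun x => f (col_cons (t, x)))).
  - by apply: eq_integral => x _; rewrite (fE t x).2.
  - by move=> x; exact: (fE t x).1.
  - rewrite (_ : partial _ _ = partial i f \o (fun x => col_cons (t, x))); last first.
      by apply/funext => x; exact: (fE t x).2.
    by move=> x; apply: continuous_comp; [exact: continuous_col_cons|exact: cg].
  - by move=> x; rewrite (fE t x).2.
  - move=> x xM; rewrite (fE t x).2; apply: fM => h; apply: xM.
    have : (@col_cons R n @^-1` cube n.+1 M) (t, x) by [].
    by rewrite cube_col_cons => -[].
have fE x t : derivable (fun t => f (col_cons (t, x))) t 1 /\
    derive1 (fun t => f (col_cons (t, x))) t = partial i f (col_cons (t, x)).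
  have := df (col_cons (t, x)).
  rewrite derive1E /partial /derive /derivable i0.
  rewrite (_ : (fun h => h^-1 *: ((f \o _) _ - _)) = (fun h : R => h^-1 *:
    (((fun t => f (col_cons (t, x))) \o shift t) (h *: 1) - f (col_cons (t, x)))))//.
  by apply/funext => h /=; rewrite col_cons_shift0.
rewrite -(integral21_prod_meas1 iG); apply: integral0_eq => x _.
rewrite /fubini_G -[RHS](@integral_derivative_compact M (fun t => f (col_cons (t, x)))).
- by apply: eq_integral => t _; rewrite (fE x t).2.
- by move=> t; exact: (fE x t).1.
- rewrite (_ : derive1 _ = partial i f \o (fun t => col_cons (t, x))); last first.
    by apply/funext => t; exact: (fE x t).2.
  by move=> t; apply: continuous_comp; [exact: continuous_col_cons1|exact: cg].
- move=> t tM; rewrite (fE x t).2; apply: fM => h.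
  have : (@col_cons R n @^-1` cube n.+1 M) (t, x) by [].
  by rewrite cube_col_cons => -[/= + _]; rewrite in_itv/= -ler_norml leNgt tM.
Qed.

End integral_partial.

(** * Smooth cutoff functions *)

Section Ck_closure.
Context {R : realType} {d : nat}.
Local Notation E := 'cV[R]_d.
Implicit Types f g : E -> R.

Lemma Ck_continuous k f : Ck k f -> continuous f.
Proof. by case: k => [|k] []. Qed.

Lemma CkS k f : Ck k.+1 f -> Ck k f.
Proof.
elim: k f => [|k IH] f [cf df]; split=> // i; have [dfi pf] := df i; split=> //.
exact: IH.
Qed.

Lemma Ck_cst k (c : R) : Ck k (cst c : E -> R).
Proof.
elim: k c => [|k IH] c; first by split=> //; exact: cst_continuous.
split=> [|i]; first exact: cst_continuous.
split=> [x|]; first exact: derivable_cst.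
rewrite (_ : partial i _ = cst 0); first exact: IH.
by apply/funext => x; rewrite /partial derive_cst.
Qed.

Lemma CkD k f g : Ck k f -> Ck k g -> Ck k (fun x => f x + g x).
Proof.
elim: k f g => [|k IH] f g [cf df] [cg dg]; split=> //; try exact: continuous_add.
move=> i; have [dfi pf] := df i; have [dgi pg] := dg i.
split=> [x|]; first exact: derivableD.
rewrite (_ : partial i _ = fun x => partial i f x + partial i g x); first exact: IH.
by apply/funext => x; rewrite /partial -deriveD.
Qed.

Lemma CkM k f g : Ck k f -> Ck k g -> Ck k (fun x => f x * g x).
Proof.
elim: k f g => [|k IH] f g Cf Cg; have [cf df] := Cf; have [cg dg] := Cg;
  split=> //; try exact: continuous_mul.
move=> i; have [dfi pf] := df i; have [dgi pg] := dg i.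
split=> [x|]; first exact: derivableM.
rewrite (_ : partial i _ = fun x => f x * partial i g x + g x * partial i f x).
  by apply: CkD; apply: IH => //; exact: CkS.
by apply/funext => x; rewrite /partial [LHS]deriveM.
Qed.

Lemma smooth_cst (c : R) : smooth (cst c : E -> R).
Proof. by move=> k; exact: Ck_cst. Qed.

Lemma smoothD f g : smooth f -> smooth g -> smooth (fun x => f x + g x).
Proof. by move=> sf sg k; exact: CkD. Qed.

Lemma smoothM f g : smooth f -> smooth g -> smooth (fun x => f x * g x).
Proof. by move=> sf sg k; exact: CkM. Qed.

Lemma smoothB f g : smooth f -> smooth g -> smooth (fun x => f x - g x).
Proof.
move=> sf sg; rewrite (_ : (fun x => _) = fun x => f x + cst (-1) x * g x).
  by apply: smoothD => //; apply: smoothM => //; exact: smooth_cst.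
by apply/funext => x /=; rewrite mulN1r.
Qed.

Lemma smooth_prod (I : Type) (s : seq I) (F : I -> E -> R) :
  (forall i, smooth (F i)) -> smooth (fun x => \prod_(i <- s) F i x).
Proof.
move=> sF; elim: s => [|i s IH].
  by rewrite (_ : (fun x => _) = cst 1); [exact: smooth_cst|apply/funext => x; rewrite big_nil].
rewrite (_ : (fun x => _) = fun x => F i x * \prod_(j <- s) F j x); first exact: smoothM.
by apply/funext => x; rewrite big_cons.
Qed.

Lemma smoothX f n : smooth f -> smooth (fun x => f x ^+ n).
Proof.
move=> sf; rewrite (_ : (fun x => _) = fun x => \prod_(i <- nseq n tt) f x).
  exact: smooth_prod.
by apply/funext => x; rewrite big_const_seq count_predT size_nseq -Monoid.iteropE.
Qed.

Lemma smooth_derivable f i x : smooth f -> derivable f x (unit_col i).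
Proof. by move=> /(_ 1%N)[_ /(_ i)[]]. Qed.

Lemma smooth_partial f i : smooth f -> smooth (partial i f).
Proof. by move=> sf k; have [_ /(_ i)[]] := sf k.+1. Qed.

Lemma smooth_continuous f : smooth f -> continuous f.
Proof. by move=> sf; exact: Ck_continuous (sf 0%N). Qed.

Lemma partialM f g i x : smooth f -> smooth g ->
  partial i (fun x => f x * g x) x = f x * partial i g x + g x * partial i f x.
Proof. by move=> sf sg; rewrite /partial [LHS]deriveM//; exact: smooth_derivable. Qed.

Lemma partialB f g i x : smooth f -> smooth g ->
  partial i (fun x => f x - g x) x = partial i f x - partial i g x.
Proof. by move=> sf sg; rewrite /partial [LHS]deriveB//; exact: smooth_derivable. Qed.

End Ck_closure.

(** * A smooth function on the line that vanishes to infinite order at 0 *)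

Section flat_function.
Context {R : realType}.

(* The functions t^-k exp(-1/t), extended by 0 to t <= 0; they are stable under
   derivation up to linear combinations. *)
Definition flat (k : nat) (t : R) : R :=
  if 0 < t then t^-1 ^+ k * expR (- t^-1) else 0.

Lemma flat_ge0 k t : 0 <= flat k t.
Proof.
rewrite /flat; case: ifP => // t0; rewrite mulr_ge0 ?expR_ge0// exprn_ge0//.
by rewrite invr_ge0 ltW.
Qed.

Lemma flat0_gt0 t : (0 < flat 0 t) = (0 < t).
Proof. by rewrite /flat; case: ifP => [t0|]; rewrite ?ltxx// mul1r expR_gt0. Qed.

Lemma flat0_le1 t : flat 0 t <= 1.
Proof.
rewrite /flat; case: ifP => [t0|_]; last exact: ler01.
by rewrite mul1r -expR0 ler_expR oppr_le0 invr_ge0 ltW.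
Qed.

(** With s = 1/t, one term of the exponential series gives s^(k+1) <= (k+1)! exp(s). One power more
    than the k present leaves a factor t, hence the limit 0 at the origin. *)
Lemma flat_bound k t : `|flat k t| <= k.+1`!%:R * `|t|.
Proof.
rewrite ger0_norm ?flat_ge0// /flat; case: ifP => [t0|_]; last by rewrite mulr_ge0.
set s := t^-1; have s0 : 0 < s by rewrite invr_gt0.
have := expR_ge1Dxn k (ltW s0) => h.
have {}h : s ^+ k.+1 <= k.+1`!%:R * expR s.
  rewrite -ler_pdivrMl ?ltr0n ?fact_gt0// mulrC (le_trans _ h)// lerDr.
  exact: ler01.
rewrite gtr0_norm// -[t]invrK -/s expRN ler_pdivlMr// mulrAC -exprSr.
by rewrite ler_pdivrMr ?expR_gt0.
Qed.

Lemma flat_cvg0 k : flat k t @[t --> 0] --> 0.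
Proof.
apply/cvgr0Pnorm_lt => e e0.
have c0 : 0 < k.+1`!%:R :> R by rewrite ltr0n fact_gt0.
near=> t; apply: le_lt_trans (flat_bound k t) _.
rewrite mulrC -ltr_pdivlMr//; near: t.
by exists (e / k.+1`!%:R) => /= [|z /=]; [rewrite divr_gt0|rewrite sub0r normrN].
Unshelve. all: by end_near. Qed.

Lemma is_derive_flat k (t : R) :
  is_derive t (1 : R) (flat k) (flat k.+2 t - k%:R * flat k.+1 t).
Proof.
have [t0|t0|->] := ltgtP t 0.
- have nt : \forall u \near t, cst 0 u = flat k u.
    near=> u; rewrite /flat /= ifF//; apply/negbTE; rewrite -leNgt ltW//.
    by near: u; apply: lt_nbhsl.
  rewrite /flat !ifF ?mulr0 ?subr0; try by apply/negbTE; rewrite -leNgt ltW.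
  split; first exact: (near_eq_derivable nt (derivable_cst _ _ _)).
  by rewrite -(near_eq_derive (1 : R) nt) derive_cst.
- have tN0 : t != 0 by rewrite gt_eqF.
  have nt : \forall u \near t, (u^-1 ^+ k * expR (- u^-1)) = flat k u.
    near=> u; rewrite /flat ifT//.
    by near: u; apply: lt_nbhsr.
  pose G (s : R) := s ^+ k * expR (- s).
  have dX s : is_derive s (1 : R) (fun s : R => s ^+ k) (k%:R * s ^+ k.-1).
    have h := is_deriveX k (is_derive_id s (1 : R)).
    rewrite (_ : (fun s : R => s ^+ k) = (id : R -> R) ^+ k); last first.
      by apply/funext => x; rewrite exprfctE.
    by apply: (is_derive_eq h); rewrite /GRing.scale /= mulr1.
  have dG s : is_derive s (1 : R) G (k%:R * s ^+ k.-1 * expR (- s) - s ^+ k * expR (- s)).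
    have h := is_deriveM (dX s) (is_derive1_comp (is_derive_expR (- s))
      (is_deriveN (is_derive_id s (1 : R)))).
    by apply: (is_derive_eq h); rewrite /GRing.scale /=; ring.
  have dV : is_derive t (1 : R) (fun u => u^-1) (- t ^- 2).
    have h := is_deriveV tN0 (is_derive_id t (1 : R)).
    by apply: (is_derive_eq h); rewrite /GRing.scale /= mulr1.
  have dGV := is_derive1_comp (dG t^-1) dV.
  rewrite /flat t0; split.
    by apply: (near_eq_derivable nt); have [] := dGV.
  rewrite -(near_eq_derive (1 : R) nt); have [_ /= ->] := dGV.
  case: k {nt G dX dG dGV} => [|k].
    by rewrite /= !expr0 !mul0r !mul1r sub0r mulrNN mulrC exprVn subr0.
  rewrite /= -!exprVn; set s := t^-1; rewrite ![in RHS]exprS !(exprS s k) expr2; ring.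
(* The difference quotient of [flat k] at 0 is [flat k.+1], which has just been shown to tend to
   0. *)
- have q0 : h^-1 *: (flat k (h *: 1 + 0) - flat k 0) @[h --> (0 : R)^'] --> (0 : R).
    have h1 : flat k.+1 h @[h --> (0 : R)^'] --> (0 : R).
      by apply: cvg_within_filter; exact: flat_cvg0.
    apply: cvg_trans h1; apply: near_eq_cvg; near=> h.
    rewrite addr0 /flat ltxx subr0 /GRing.scale /= mulr1.
    by case: ifP => _; rewrite ?mulr0// exprS mulrA.
  rewrite /flat ltxx mulr0 subr0; split.
    by apply/cvg_ex; exists 0; exact: q0.
  exact: (cvg_lim (@Rhausdorff R) q0).
Unshelve. all: by end_near. Qed.

Lemma flat_continuous k : continuous (flat k).
Proof.
move=> t; apply/differentiable_continuous/derivable1_diffP.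
by have [] := is_derive_flat k t.
Qed.

End flat_function.

(** * Bumps on cubes and cutoff functions of an open set *)

Section smooth_bumps.
Context {R : realType} {d : nat}.
Local Notation E := 'cV[R]_d.

Lemma derive_coord (h : R -> R) (h' : R -> R) i j (x : E) :
  (forall t, is_derive t (1 : R) h (h' t)) ->
  derivable (fun y : E => h (y i 0)) x (unit_col j) /\
  partial j (fun y : E => h (y i 0)) x = (i == j)%:R * h' (x i 0).
Proof.
move=> dh; rewrite /partial /derive /derivable.
have [->|ij] := eqVneq i j.
  rewrite (_ : (fun _ => _) =
      (fun e : R => e^-1 *: ((h \o shift (x j 0)) (e *: 1) - h (x j 0)))); last first.
    by apply/funext => e /=; rewrite !mxE !eqxx.
  by have [d1 d2] := dh (x j 0); split; [exact: d1|rewrite mul1r; exact: d2].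
rewrite (_ : (fun _ => _) = cst 0); last first.
  apply/funext => e /=; rewrite !mxE (negbTE ij) mulr0 add0r subrr.
  by rewrite scaler0.
by rewrite mul0r; split; [exact: is_cvg_cst|rewrite lim_cst].
Qed.

Lemma flat_coord_smooth k (a b : R) i : smooth (fun x : E => flat k (a * x i 0 + b)).
Proof.
have dh l t : is_derive t (1 : R) (fun t => flat l (a * t + b))
    ((flat l.+2 (a * t + b) - l%:R * flat l.+1 (a * t + b)) * a).
  apply: (@is_derive1_comp _ (flat l) (fun t => a * t + b)).
    exact: is_derive_flat.
  have h := is_deriveD (is_deriveZ a (is_derive_id t (1 : R))) (is_derive_cst b t (1 : R)).
  by apply: (is_derive_eq h); rewrite addr0 /GRing.scale /= mulr1.
have cx l : continuous (fun x : E => flat l (a * x i 0 + b)).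
  move=> x; apply: (@cvg_comp _ _ _ (fun x : E => a * x i 0 + b) (flat l) _ _ _ _
    (@flat_continuous R l (a * x i 0 + b))).
  apply: (@continuous_add R E (fun x => a * x i 0) (cst b)); last exact: cst_continuous.
  apply: continuous_mul; [exact: cst_continuous|exact: coord_continuous].
move=> m; elim: m k => [|m IH] k; split=> // j.
have D x := derive_coord i j x (dh k).
split=> [x|]; first exact: (D x).1.
rewrite (_ : partial j _ = fun x : E => cst ((i == j)%:R * a) x *
    (flat k.+2 (a * x i 0 + b) + cst (- k%:R) x * flat k.+1 (a * x i 0 + b))).
  apply: CkM; first exact: Ck_cst.
  by apply: CkD; [exact: IH|apply: CkM; [exact: Ck_cst|exact: IH]].
by apply/funext => x; rewrite (D x).2 /=; ring.
Qed.

Definition closed_cube (q : E) (r : R) : set E :=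
  [set y | forall i, `|q i 0 - y i 0| <= r].

Lemma closed_cube_compact q r : compact (closed_cube q r).
Proof.
(* Compactness of boxes is known for row vectors and is carried to columns by transposition. *)
have cT : continuous (fun v : 'rV[R]_d => v^T).
  move=> v U /col_ballP[e e0 eU]; apply/nbhs_ballP; exists e => // w [_ vw].
  by apply: eU => i; rewrite !mxE; exact: vw.
have := continuous_compact (continuous_subspaceT cT)
  (@rV_compact R d (fun i => `[q i 0 - r, q i 0 + r]%classic)
     (fun i => @segment_compact R _ _)).
congr compact; apply/seteqP; split=> [y [v vq <-] i|y yq].
  by have := vq i; rewrite mxE /= in_itv /= distrC ler_distl.
exists y^T; last by rewrite trmxK.
by move=> i; have := yq i; rewrite mxE /= in_itv /= distrC ler_distl.
Qed.

Definition bump (q : E) (r : R) (x : E) : R :=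
  \prod_(i <- enum 'I_d)
    (flat 0 (1 * x i 0 + (r - q i 0)) * flat 0 (-1 * x i 0 + (q i 0 + r))).

Lemma bump_smooth q r : smooth (bump q r).
Proof.
apply: smooth_prod => i; apply: smoothM; exact: flat_coord_smooth.
Qed.

Lemma bump_itv q r x : 0 <= bump q r x <= 1.
Proof.
apply: (big_ind (fun t => 0 <= t <= 1)) => [|s t /andP[s0 s1] /andP[t0 t1]|i _].
- by rewrite lexx ler01.
- by rewrite mulr_ge0//= mulr_ile1.
- by rewrite mulr_ge0 ?flat_ge0//= mulr_ile1 ?flat_ge0 ?flat0_le1.
Qed.

Lemma bump_gt0 q r x : open_cube q r x -> 0 < bump q r x.
Proof.
move=> xq; rewrite /bump big_seq; apply: prodr_gt0 => i _.
have := xq i; rewrite ltr_distl => /andP[h1 h2].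
by rewrite mulr_gt0// flat0_gt0; lra.
Qed.

Lemma bump_eq0 q r x : ~ closed_cube q r x -> bump q r x = 0.
Proof.
move=> /existsNP[i /negP]; rewrite -ltNge => h.
rewrite /bump (big_rem i) ?mem_enum//= /flat.
have [h1|h1] := boolP (0 < 1 * x i 0 + (r - q i 0)); last by rewrite !mul0r.
have [h2|h2] := boolP (0 < -1 * x i 0 + (q i 0 + r)); last by rewrite mulr0 mul0r.
by exfalso; move: h; rewrite ltNge ler_distl => /negP; apply; apply/andP; split; lra.
Qed.

(** The rational cubes whose closures lie in [Om] cover it; let f_j enumerate their bumps. The
    function 1 minus the product of (1 - f_j)^n over j < n is supported in finitely many of these
    compact cubes and tends to 1 wherever some f_j is positive. *)
Lemma cutoff_functions (Om : set E) : open Om ->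
  exists chi : nat -> E -> R,
    [/\ forall n, test_fun Om (chi n), forall n x, 0 <= chi n x <= 1 &
        forall x, Om x -> chi n x @[n --> \oo] --> (1 : R)].
Proof.
move=> oOm.
pose F (p : 'cV[rat]_d * nat) : E -> R :=
  let q := map_mx ratr p.1 in let r := p.2.+1%:R^-1 in
  if `[< closed_cube q r `<=` Om >] then bump q r else cst 0.
have sF p : smooth (F p) by rewrite /F /=; case: ifP => _; [exact: bump_smooth|exact: smooth_cst].
have F01 p x : 0 <= F p x <= 1.
  by rewrite /F /=; case: ifP => _; [exact: bump_itv|rewrite /= lexx ler01].
pose f (n : nat) : E -> R := if unpickle n is Some p then F p else cst 0.
have sf n : smooth (f n) by rewrite /f; case: unpickle => [p|]; [exact: sF|exact: smooth_cst].
have f01 n x : 0 <= f n x <= 1.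
  by rewrite /f; case: unpickle => [p|]; [exact: F01|rewrite /= lexx ler01].
have supp n : exists K : set E, [/\ compact K, K `<=` Om & forall x, ~ K x -> f n x = 0].
  have triv : exists K : set E, [/\ compact K, K `<=` Om & forall x, ~ K x -> (0 : R) = 0].
    by exists set0; split=> //; exact: compact0.
  rewrite /f; case: unpickle => [p|]; last exact: triv.
  rewrite /F /=; case: asboolP => [pOm|_]; last exact: triv.
  exists (closed_cube (map_mx ratr p.1) p.2.+1%:R^-1); split=> //.
    exact: closed_cube_compact.
  by move=> x; exact: bump_eq0.
have /choice[K KP] := supp.
(* The n-th power makes one positive factor enough for convergence to 0. *)
pose P n x := \prod_(j <- iota 0 n) (1 - f j x) ^+ n.
have P01 n x : 0 <= P n x <= 1.
  rewrite /P; apply: (big_ind (fun t => 0 <= t <= 1)) => [|s t /andP[s0 s1] /andP[t0 t1]|i _].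
  - by rewrite lexx ler01.
  - by rewrite mulr_ge0//= mulr_ile1.
  - have /andP[h0 h1] := f01 i x.
    by rewrite exprn_ge0 ?exprn_ile1//=; lra.
exists (fun n x => 1 - P n x); split.
- move=> n; split.
    apply: smoothB; first exact: smooth_cst.
    apply: smooth_prod => i; apply: smoothX; apply: smoothB => //; exact: smooth_cst.
  exists (\big[setU/set0]_(j <- iota 0 n) K j); split.
  + by apply: bigsetU_compact => j _; have [] := KP j.
  + rewrite -bigcup_seq => x [j _]; have [_ + _] := KP j; exact.
  + rewrite -bigcup_seq => x xK; rewrite /P big_seq big1 ?subrr// => j jn.
    have [_ _ -> //] := KP j; first by rewrite subr0 expr1n.
    by move=> Kx; apply: xK; exists j.
- by move=> n x; have := P01 n x; lra.
- move=> x Ox.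
  have /col_ballP[e e0 eOm] : nbhs x Om by exact: open_nbhs_nbhs.
  have [q [k [qx qe]]] := rational_cube x e0.
  have qOm : closed_cube (map_mx ratr q) k.+1%:R^-1 `<=` Om.
    by move=> y qy; apply: eOm; exact: qe.
  pose n0 := pickle (q, k).
  have fx0 : 0 < f n0 x.
    by rewrite /f pickleK /F /=; case: asboolP => // _; exact: bump_gt0.
  have fx1 : f n0 x <= 1 by have /andP[] := f01 n0 x.
  have Px : P n x @[n --> \oo] --> (0 : R).
    apply: (@squeeze_cvgr _ _ _ _ (fun=> 0) (fun n => (1 - f n0 x) ^+ n)).
    - near=> n; have /andP[-> _] := P01 n x; rewrite /= /P.
      rewrite (bigD1_seq n0) ?iota_uniq//=; last first.
        by rewrite mem_iota add0n leq0n; near: n; exact: nbhs_infty_gt.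
      rewrite ler_piMr//; first by rewrite exprn_ge0//; lra.
      suff [] : \prod_(i <- iota 0 n | i != n0) (1 - f i x) ^+ n <= 1 /\
        0 <= \prod_(i <- iota 0 n | i != n0) (1 - f i x) ^+ n by [].
      apply: (big_ind (fun t => t <= 1 /\ 0 <= t)) => [|s t [s1 s0] [t1 t0]|i _].
      + by split; [exact: lexx|exact: ler01].
      + by split; [exact: mulr_ile1|exact: mulr_ge0].
      + by have /andP[h0 h1] := f01 i x; split; [rewrite exprn_ile1//|rewrite exprn_ge0]; lra.
    - exact: cvg_cst.
    - by apply: cvg_expr; rewrite ger0_norm; lra.
  rewrite -[X in _ --> X](subr0 1); apply: cvgB; [exact: cvg_cst|exact: Px].
Unshelve. all: by end_near. Qed.

End smooth_bumps.

(** * Integrable and square integrable functions *)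

Section integrable_real.
Context disp (T : measurableType disp) (R : realType).
Variables (mu : {measure set T -> \bar R}) (D : set T).
Hypothesis mD : measurable D.
Implicit Types f g h : T -> R.

Local Notation Int f := (mu.-integrable D (EFin \o f)).

Lemma integrable_add f g : Int f -> Int g -> Int (fun x => f x + g x).
Proof. by move=> intf intg; have := integrableD mD intf intg. Qed.

Lemma integrable_scale (c : R) f : Int f -> Int (fun x => c * f x).
Proof. by move=> intf; have := integrableZl mD c intf. Qed.

Lemma integrable_finsum (I : Type) (s : seq I) (h : I -> T -> R) :
  (forall i, Int (h i)) -> Int (fun x => \sum_(i <- s) h i x).
Proof.
move=> ih; elim: s => [|i s IH].
  rewrite (_ : _ \o _ = cst 0%E); first exact: integrable0.
  by apply/funext => x; rewrite /= big_nil.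
rewrite (_ : EFin \o _ = EFin \o (fun x => h i x + \sum_(j <- s) h j x)).
  exact: integrable_add.
by apply/funext => x; rewrite /= big_cons.
Qed.

Lemma ae_eq_Rintegral f g : measurable_fun D f -> measurable_fun D g ->
  {ae mu, forall x, D x -> f x = g x} ->
  \int[mu]_(x in D) f x = \int[mu]_(x in D) g x.
Proof.
move=> mf mg fg; congr fine; apply: ae_eq_integral => //; try exact/measurable_EFinP.
by apply: filterS fg => x /[apply] /= ->.
Qed.

Lemma integrable_measurable f : Int f -> measurable_fun D f.
Proof. by move=> /integrableP[/measurable_EFinP]. Qed.

Lemma Rintegral_lincomb (s : seq (R * (T -> R))) :
  foldr (fun p Q => Int p.2 /\ Q) True s ->
  {ae mu, forall x, D x -> \sum_(p <- s) p.1 * p.2 x = 0} ->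
  \sum_(p <- s) p.1 * \int[mu]_(x in D) p.2 x = 0.
Proof.
move=> ints ae0.
have [int_sum ->] : Int (fun x => \sum_(p <- s) p.1 * p.2 x) /\
    \sum_(p <- s) p.1 * \int[mu]_(x in D) p.2 x =
    \int[mu]_(x in D) (\sum_(p <- s) p.1 * p.2 x).
  elim: s ints {ae0} => [|p s IH] /= => [_|[ip /IH[is_ IHs]]].
    split; first by under eq_fun do rewrite big_nil; exact: integrable0.
    by rewrite big_nil; under eq_Rintegral do rewrite big_nil; rewrite Rintegral_cst// mul0r.
  have isp := integrable_scale p.1 ip.
  rewrite big_cons IHs -RintegralZl// -RintegralD//.
  split; last by apply: eq_Rintegral => x _; rewrite big_cons.
  rewrite (_ : EFin \o _ = EFin \o (fun x => p.1 * p.2 x + \sum_(q <- s) q.1 * q.2 x)).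
    exact: integrable_add.
  by apply/funext => x; rewrite /= big_cons.
rewrite (@ae_eq_Rintegral _ (cst 0)) //; last exact: integrable_measurable.
by rewrite Rintegral_cst// mul0r.
Qed.

Lemma integrable_le f g : measurable_fun D f -> Int g ->
  (forall x, D x -> `|f x| <= g x) -> Int f.
Proof.
move=> mf ig fg; apply: (le_integrable mD _ _ ig); first exact/measurable_EFinP.
by move=> x Dx; rewrite /= lee_fin (le_trans (fg x Dx))// ler_norm.
Qed.

Lemma integrable_ae_le f g : measurable_fun D f -> Int g ->
  {ae mu, forall x, D x -> `|f x| <= g x} -> Int f.
Proof.
move=> mf ig fg; apply/integrableP; split; first exact/measurable_EFinP.
have mg := integrable_measurable ig.
have /integrableP[_] := ig; apply: le_lt_trans.
apply: ae_ge0_le_integral => //.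
- by apply: measurableT_comp => //; exact/measurable_EFinP.
- by apply: measurableT_comp => //; exact/measurable_EFinP.
- apply: filterS fg => x + Dx => /(_ Dx) fgx.
  by rewrite /= lee_fin (le_trans fgx)// ler_norm.
Qed.

Lemma L2_prod f g : L2 mu D f -> L2 mu D g -> Int (fun x => f x * g x).
Proof.
move=> [mf if2] [mg ig2].
apply: (@integrable_le _ (fun x => f x ^+ 2 + g x ^+ 2)).
- exact: measurable_funM.
- exact: integrable_add.
- move=> x _; rewrite ler_norml; apply/andP; split; nra.
Qed.

Lemma L2_add f g : L2 mu D f -> L2 mu D g -> L2 mu D (fun x => f x + g x).
Proof.
move=> Lf Lg; have ifg := L2_prod Lf Lg; have [mf if2] := Lf; have [mg ig2] := Lg.
split; first exact: measurable_funD.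
apply: (@integrable_le _ (fun x => 2 * (f x ^+ 2 + g x ^+ 2))).
- by apply: measurable_funX; exact: measurable_funD.
- by apply: integrable_scale; exact: integrable_add.
- move=> x _; rewrite ger0_norm ?sqr_ge0// -subr_ge0.
  by rewrite (_ : _ - _ = (f x - g x) ^+ 2) ?sqr_ge0//; ring.
Qed.

Lemma L2_scale (c : R) f : L2 mu D f -> L2 mu D (fun x => c * f x).
Proof.
move=> [mf if2]; split; first exact: measurable_funM.
under eq_fun do rewrite exprMn.
exact: integrable_scale.
Qed.

Lemma L2_sub f g : L2 mu D f -> L2 mu D g -> L2 mu D (fun x => f x - g x).
Proof.
move=> Lf Lg; rewrite (_ : (fun x => _) = fun x => f x + (-1) * g x).
  by apply: L2_add => //; exact: L2_scale.
by apply/funext => x; rewrite mulN1r.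
Qed.

Lemma L2_sum (I : Type) (s : seq I) (h : I -> T -> R) :
  (forall i, L2 mu D (h i)) -> L2 mu D (fun x => \sum_(i <- s) h i x).
Proof.
move=> Lh; elim: s => [|i s IH].
  under eq_fun do rewrite big_nil.
  split => //; rewrite (_ : (fun=> _) = cst 0%E); first exact: integrable0.
  by apply/funext => x; rewrite expr0n.
under eq_fun do rewrite big_cons.
exact: L2_add.
Qed.

Lemma L2_ae_bounded_mul (c f : T -> R) (M : R) : measurable_fun D c ->
  {ae mu, forall x, D x -> `|c x| <= M} -> L2 mu D f -> L2 mu D (fun x => c x * f x).
Proof.
move=> mc cM [mf if2]; split; first exact: measurable_funM.
apply: (@integrable_ae_le _ (fun x => M ^+ 2 * f x ^+ 2)).
- by apply: measurable_funX; exact: measurable_funM.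
- exact: integrable_scale.
- apply: filterS cM => x /[apply] cMx.
  rewrite ger0_norm ?sqr_ge0// exprMn ler_wpM2r ?sqr_ge0//.
  rewrite -[leLHS]real_normK ?num_real// ler_sqr ?nnegrE//.
  exact: le_trans cMx.
Qed.

(** The choice [t = |X| / F] makes the first term equal to [|X|] and leaves the claim. If [F = 0]
    and [X] is nonzero, [t = (G + 1) / |X|] makes the right side smaller than [|X|], a
    contradiction. *)
Lemma sqr_le_of_ampm (X F G : R) : 0 <= F -> 0 <= G ->
  (forall t, 0 < t -> 2 * `|X| <= t * F + t^-1 * G) -> X ^+ 2 <= F * G.
Proof.
move=> F0 G0 h; have [->|X0] := eqVneq X 0; first by rewrite expr0n mulr_ge0.
have aX : 0 < `|X| by rewrite normr_gt0.
have F1 : 0 < F.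
  rewrite lt_neqAle F0 andbT eq_sym; apply/eqP => Fz.
  have t0 : 0 < (G + 1) / `|X| by rewrite divr_gt0//; lra.
  have := h _ t0; rewrite Fz mulr0 add0r invf_div mulrAC.
  rewrite ler_pdivlMr; last lra.
  nra.
have t0 : 0 < `|X| / F by rewrite divr_gt0.
have := h _ t0; rewrite divfK ?gt_eqF// invf_div => {}h.
have : `|X| <= F / `|X| * G by lra.
by rewrite mulrAC ler_pdivlMr// -expr2 real_normK ?num_real.
Qed.

Lemma le_half_sum_of_sqr_le (h a b : R) : 0 <= a -> 0 <= b -> h ^+ 2 <= a * b ->
  2 * `|h| <= a + b.
Proof.
move=> a0 b0 hab; rewrite -ler_sqr ?nnegrE ?mulr_ge0 ?addr_ge0// exprMn real_normK ?num_real//.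
apply: (@le_trans _ _ (2 ^+ 2 * (a * b))); first by rewrite ler_pM2l// exprn_gt0.
by rewrite -subr_ge0 (_ : _ - _ = (a - b) ^+ 2) ?sqr_ge0//; ring.
Qed.

Lemma ae_le_Rintegral f g : Int f -> Int g -> {ae mu, forall x, D x -> f x <= g x} ->
  \int[mu]_(x in D) f x <= \int[mu]_(x in D) g x.
Proof.
move=> intf intg fg; rewrite -subr_ge0 -RintegralB//.
have mf := integrable_measurable intf; have mg := integrable_measurable intg.
rewrite (@ae_eq_Rintegral _ (fun x => `|g x - f x|)).
- exact: Rintegral_ge0.
- exact: measurable_funB.
- by apply: measurableT_comp => //; exact: measurable_funB.
- by apply: filterS fg => x /[apply] h; rewrite ger0_norm// subr_ge0.
Qed.

Lemma ae_Rintegral_ge0 f : Int f -> {ae mu, forall x, D x -> 0 <= f x} ->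
  0 <= \int[mu]_(x in D) f x.
Proof.
move=> intf f0; apply: (@le_trans _ _ (\int[mu]_(x in D) cst 0 x)).
  by rewrite Rintegral_cst// mul0r.
by apply: ae_le_Rintegral => //; exact: integrable0.
Qed.

(** The hypothesis is a pointwise inequality [h^2 <= f g] rather than a factorization of [h], so
    that pairings weighted by the inverse of A are covered together with plain products. *)
Lemma Rintegral_CauchySchwarz h f g : Int h -> Int f -> Int g ->
  {ae mu, forall x, D x -> [/\ 0 <= f x, 0 <= g x & h x ^+ 2 <= f x * g x]} ->
  (\int[mu]_(x in D) h x) ^+ 2 <=
  (\int[mu]_(x in D) f x) * (\int[mu]_(x in D) g x).
Proof.
move=> inth intf intg hfg.
apply: sqr_le_of_ampm => [||t t0].
- by apply: ae_Rintegral_ge0 => //; apply: filterS hfg => x /[apply] -[].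
- by apply: ae_Rintegral_ge0 => //; apply: filterS hfg => x /[apply] -[].
have intn : Int (fun x => `|h x|).
  by apply: (@integrable_le _ (fun x => `|h x|)) => [||x _];
    [apply: measurableT_comp => //; exact: integrable_measurable|
     exact: integrable_norm inth|rewrite normr_id].
apply: (@le_trans _ _ (2 * \int[mu]_(x in D) `|h x|)).
  by rewrite ler_pM2l//; exact: le_normr_Rintegral.
rewrite -!RintegralZl// -RintegralD//; try exact: integrable_scale.
apply: ae_le_Rintegral; first exact: integrable_scale.
  by apply: integrable_add; exact: integrable_scale.
apply: filterS hfg => x + Dx => /(_ Dx)[f0 g0 hx].
apply: le_half_sum_of_sqr_le; rewrite ?mulr_ge0 ?invr_ge0 ?(ltW t0)//.
by rewrite mulrACA divff ?gt_eqF// mul1r.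
Qed.

Lemma ge0_integral_le_add (f g h : T -> R) : measurable_fun D f -> measurable_fun D g ->
  measurable_fun D h -> (forall x, 0 <= f x) -> (forall x, 0 <= g x) ->
  (forall x, 0 <= h x <= 2 * (f x + g x)) ->
  (\int[mu]_(x in D) (h x)%:E <=
   2%:E * (\int[mu]_(x in D) (f x)%:E + \int[mu]_(x in D) (g x)%:E))%E.
Proof.
move=> mf mg mh f0 g0 h01.
rewrite -ge0_integralD//; try (by apply/measurable_EFinP); try (by move=> x _; rewrite lee_fin).
rewrite -ge0_integralZl//.
- apply: ge0_le_integral => //.
  + by move=> x _; rewrite lee_fin; have /andP[] := h01 x.
  + exact/measurable_EFinP.
  + by apply/measurable_EFinP; apply: measurable_funM => //; exact: measurable_funD.
  + by move=> x _; rewrite -EFinD -EFinM lee_fin; have /andP[] := h01 x.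
- by apply/measurable_EFinP; exact: measurable_funD.
- by move=> x _; rewrite -EFinD lee_fin addr_ge0.
Qed.

Lemma cvg_integral0_le_add (f g h : nat -> T -> R) :
  (forall k, measurable_fun D (f k)) -> (forall k, measurable_fun D (g k)) ->
  (forall k, measurable_fun D (h k)) ->
  (forall k x, 0 <= f k x) -> (forall k x, 0 <= g k x) ->
  (forall k x, 0 <= h k x <= 2 * (f k x + g k x)) ->
  (\int[mu]_(x in D) (f k x)%:E @[k --> \oo] --> 0)%E ->
  (\int[mu]_(x in D) (g k x)%:E @[k --> \oo] --> 0)%E ->
  (\int[mu]_(x in D) (h k x)%:E @[k --> \oo] --> 0)%E.
Proof.
move=> mf mg mh f0 g0 h01 cf cg.
apply: (@squeeze_cvge _ _ _ _ (fun=> 0%E) _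
  (fun k => 2%:E * (\int[mu]_(x in D) (f k x)%:E + \int[mu]_(x in D) (g k x)%:E))%E).
- apply: nearW => k; apply/andP; split.
    by apply: integral_ge0 => x _; rewrite lee_fin; have /andP[] := h01 k x.
  exact: ge0_integral_le_add.
- exact: cvg_cst.
- rewrite -[X in _ --> X](mule0 2%:E) -[X in (_ * X)%E](adde0 0%E).
  by apply: cvgeZl => //; apply: cvgeD.
Qed.

End integrable_real.

(** * Sobolev functions and test functions *)

Section compact_support.
Context {R : realType} {d : nat}.
Local Notation E := 'cV[R]_d.

Lemma coord_le_norm (x : E) i : `|x i 0| <= `|x|.
Proof.
rewrite [leRHS]/Num.Def.normr /= mx_normrE; apply/bigmax_geP; right.
by exists (i, 0).
Qed.

Lemma bounded_sub_cube (A : set E) : bounded_set A -> exists M, A `<=` cube d M.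
Proof.
move=> [M [Mreal AM]]; exists (M + 1) => x Ax i.
by apply: le_trans (coord_le_norm x i) _; apply: AM => //; rewrite ltrDl.
Qed.

Lemma cube_compact M : compact (cube d M : set E).
Proof.
rewrite (_ : cube d M = closed_cube 0 M); first exact: closed_cube_compact.
by apply/seteqP; split=> x xM i; have := xM i; rewrite mxE sub0r normrN.
Qed.

Lemma compact_bound (K : set E) (f : E -> R) : compact K -> continuous f ->
  exists C, 0 <= C /\ forall x, K x -> `|f x| <= C.
Proof.
move=> cK cf; have := continuous_compact (continuous_subspaceT cf) cK.
move=> /compact_bounded[M [Mreal fM]]; exists (`|M| + 1); split.
  by rewrite addr_ge0.
move=> x Kx; apply: fM; last by exists x.
by rewrite (le_lt_trans (ler_norm M))// ltrDl.
Qed.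

Lemma partial_support (K : set E) (f : E -> R) i : compact K ->
  (forall x, ~ K x -> f x = 0) -> forall x, ~ K x -> partial i f x = 0.
Proof.
move=> cK f0 x Kx; rewrite /partial.
rewrite (@near_eq_derive _ _ _ f (cst 0)) ?derive_cst//.
have oK : open (~` K) by apply: closed_openC; apply: compact_closed => //; exact: norm_hausdorff.
have : \forall y \near x, (~` K) y by exact: open_nbhs_nbhs.
by apply: filterS => y; exact: f0.
Qed.

Lemma test_fun_mul (Om : set E) (f chi : E -> R) :
  smooth f -> test_fun Om chi -> test_fun Om (fun x => f x * chi x).
Proof.
move=> sf [schi [K [cK KOm chi0]]]; split; first exact: smoothM.
by exists K; split=> // x /chi0->; rewrite mulr0.
Qed.

Lemma integral_partial_test (Om : set E) (f : E -> R) i : test_fun Om f ->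
  \int[leb]_(x in Om) partial i f x = 0 :> R.
Proof.
move=> [sf [K [cK KOm f0]]].
have p0 := partial_support i cK f0.
have cp : continuous (partial i f) by apply: smooth_continuous; exact: smooth_partial.
have [C [C0 pC]] := compact_bound cK cp.
have [M KM] := bounded_sub_cube (compact_bounded cK).
have -> : \int[leb]_(x in Om) partial i f x = \int[leb]_x partial i f x.
  rewrite Rintegral_mkcond; apply: eq_Rintegral => x _; rewrite patchE.
  by case: ifPn => // /negP; rewrite inE => xOm; rewrite p0// => /KOm.
rewrite /Rintegral (@integral_partial _ _ _ _ M C)//.
- by move=> x; exact: smooth_derivable.
- by move=> x; have [/pC//|/p0->] := pselect (K x); rewrite normr0.
- by move=> x xM; split; [apply: f0|apply: p0] => /KM.
Qed.

End compact_support.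

Section sobolev_space.
Context {R : realType} {d : nat}.
Local Notation E := 'cV[R]_d.
Variable Om : set E.
Hypotheses (oOm : open Om) (bOm : bounded_set Om).

Let mOm : measurable Om. Proof. exact: open_measurable_col. Qed.

Lemma leb_bounded_lty : (leb Om < +oo)%E.
Proof.
have [M OmM] := bounded_sub_cube bOm.
apply: le_lt_trans (lebesgue_cube d M).
by apply: le_measure; rewrite ?inE//; exact: measurable_cube.
Qed.

Lemma continuous_L2 (f : E -> R) : continuous f -> L2 leb Om f.
Proof.
move=> cf; have mf : measurable_fun Om f.
  by apply: measurable_funS (continuous_measurable_col cf).
split=> //; have [M OmM] := bounded_sub_cube bOm.
have [C [C0 fC]] := compact_bound (@cube_compact _ _ M) cf.
have : leb.-integrable Om (EFin \o (fun x => f x ^+ 2)); last by [].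
apply: measurable_bounded_integrable.
- exact: mOm.
- exact: leb_bounded_lty.
- exact: measurable_funX.
- exists (C ^+ 2); split; first exact: num_real.
  move=> B CB x Ox /=; rewrite ger0_norm ?sqr_ge0// (le_trans _ (ltW CB))//.
  rewrite -[leLHS]real_normK ?num_real// ler_sqr ?nnegrE// fC//.
  exact: OmM.
Qed.

Lemma smooth_L2 (f : E -> R) : smooth f -> L2 leb Om f.
Proof. by move=> sf; apply: continuous_L2; exact: smooth_continuous. Qed.

Lemma partial_L2 (f : E -> R) i : smooth f -> L2 leb Om (partial i f).
Proof. by move=> sf; apply: smooth_L2; exact: smooth_partial. Qed.

Lemma ip_subl (f g h : E -> R) : L2 leb Om f -> L2 leb Om g -> L2 leb Om h ->
  ip Om (fun x => f x - g x) h = ip Om f h - ip Om g h.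
Proof.
move=> Lf Lg Lh; rewrite /ip -RintegralB//; try exact: L2_prod.
by apply: eq_Rintegral => x _; rewrite mulrBl.
Qed.

Lemma measurable_surf (A : set E) : measurable A ->
  measurable (A : set (caratheodory_type (@surf_outer R d))).
Proof. by move=> mA; exact: measurable_hausdorff. Qed.

Lemma measurable_bdry : measurable (bdry Om : set (caratheodory_type (@surf_outer R d))).
Proof.
apply: measurable_surf; apply: closed_measurable_col; rewrite /bdry setDE.
by apply: closedI; [exact: closed_closure|apply: open_closedC; exact: open_interior].
Qed.

Lemma continuous_measurable_surf (D : set E) (f : E -> R) : continuous f ->
  measurable_fun (D : set (caratheodory_type (@surf_outer R d))) f.
Proof.
move=> cf; apply: measurable_funTS => _ B mB; rewrite setTI; apply: measurable_surf.
by have := continuous_measurable_col cf measurableT mB; rewrite setTI.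
Qed.

Lemma H1_facts (v : H1 Om) : [/\ L2 leb Om (val1 v), L2v Om (grad1 v),
  weak_grad Om (val1 v) (grad1 v), L2 surf (bdry Om) (trace1 v) &
  is_trace Om (val1 v) (grad1 v) (trace1 v)].
Proof. by case: v. Qed.

(** Differences of approximants approximate the difference, by (a + b)^2 <= 2 a^2 + 2 b^2 in each of
    the three integrals. The boundary integral requires smooth functions to be measurable for the
    Hausdorff measure. *)
Lemma is_trace_sub v G g w H h : L2 leb Om v -> L2v Om G -> L2 surf (bdry Om) g ->
  L2 leb Om w -> L2v Om H -> L2 surf (bdry Om) h ->
  is_trace Om v G g -> is_trace Om w H h ->
  is_trace Om (fun x => v x - w x) (fun x => G x - H x) (fun x => g x - h x).
Proof.
move=> Lv LG Lg Lw LH Lh [p [sp pv pG pg]] [q [sq qv qG qg]].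
have sqB (a b c e : R) : 0 <= (a - b - (c - e)) ^+ 2 <= 2 * ((a - c) ^+ 2 + (b - e) ^+ 2).
  rewrite sqr_ge0/= -subr_ge0.
  by rewrite (_ : _ - _ = (a - c + (b - e)) ^+ 2) ?sqr_ge0//; ring.
have mOmf (f : E -> R) : continuous f -> measurable_fun Om f.
  by move=> cf; apply: measurable_funS (continuous_measurable_col cf).
have cp k := smooth_continuous (sp k); have cq k := smooth_continuous (sq k).
have spq k : smooth (fun x => p k x - q k x) by exact: smoothB.
have cpq k := smooth_continuous (spq k).
exists (fun k x => p k x - q k x); split; first exact: spq.
- apply: (cvg_integral0_le_add mOm _ _ _ _ _ _ pv qv) => [k|k|k|k x|k x|k x].
  + by apply: measurable_funX; apply: measurable_funB; [exact: mOmf|have [] := Lv].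
  + by apply: measurable_funX; apply: measurable_funB; [exact: mOmf|have [] := Lw].
  + apply: measurable_funX; apply: measurable_funB; [exact: (mOmf _ (cpq k))|].
    by apply: measurable_funB; [have [] := Lv|have [] := Lw].
  + exact: sqr_ge0.
  + exact: sqr_ge0.
  + exact: sqB.
- have mdot (k : nat) (f : E -> R) (F : E -> E) : smooth f -> L2v Om F ->
      measurable_fun Om (fun x => dot (grad f x - F x) (grad f x - F x)).
    move=> sf LF; apply: measurable_sum => i.
    have m1 : measurable_fun Om (fun x => (grad f x - F x) i 0).
      under eq_fun do rewrite !mxE.
      apply: measurable_funB; last by have [] := LF i.
      by apply: mOmf; apply: smooth_continuous; exact: smooth_partial.
    exact: measurable_funM.
  have LGH : L2v Om (fun x => G x - H x).
    move=> i; rewrite (_ : (fun x => _) = fun x => G x i 0 - H x i 0).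
      by apply: L2_sub; [exact: mOm|exact: LG|exact: LH].
    by apply/funext => x; rewrite !mxE.
  apply: (cvg_integral0_le_add mOm _ _ _ _ _ _ pG qG) => [k|k|k|k x|k x|k x].
  + exact: mdot.
  + exact: mdot.
  + exact: mdot (spq k) LGH.
  + exact: dot_ge0.
  + exact: dot_ge0.
  + rewrite dot_ge0/= /dot -big_split/= mulr_sumr; apply: ler_sum => i _.
    rewrite !mxE partialB// -!expr2.
    by have /andP[_ ] := sqB (partial i (p k) x) (partial i (q k) x) (G x i 0) (H x i 0).
- apply: (cvg_integral0_le_add measurable_bdry _ _ _ _ _ _ pg qg) => [k|k|k|k x|k x|k x].
  + apply: measurable_funX; apply: measurable_funB; last by have [] := Lg.
    exact: continuous_measurable_surf.
  + apply: measurable_funX; apply: measurable_funB; last by have [] := Lh.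
    exact: continuous_measurable_surf.
  + apply: measurable_funX; apply: measurable_funB.
      by apply: continuous_measurable_surf; exact: cpq.
    by apply: measurable_funB; [have [] := Lg|have [] := Lh].
  + exact: sqr_ge0.
  + exact: sqr_ge0.
  + exact: sqB.
Qed.

Lemma exists_H1_sub (v w : H1 Om) : exists s : H1 Om,
  [/\ val1 s = (fun x => val1 v x - val1 w x),
      grad1 s = (fun x => grad1 v x - grad1 w x) &
      trace1 s = (fun x => trace1 v x - trace1 w x)].
Proof.
have [Lv LG wv Lg tv] := H1_facts v; have [Lw LH ww Lh tw] := H1_facts w.
have L1 : L2 leb Om (fun x => val1 v x - val1 w x) by exact: L2_sub.
have GHE i : (fun x => (grad1 v x - grad1 w x) i 0) = (fun x => grad1 v x i 0 - grad1 w x i 0).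
  by apply/funext => x; rewrite !mxE.
have L2' : L2v Om (fun x => grad1 v x - grad1 w x).
  by move=> i; rewrite GHE; apply: L2_sub; [exact: mOm|exact: LG|exact: LH].
have W : weak_grad Om (fun x => val1 v x - val1 w x) (fun x => grad1 v x - grad1 w x).
  move=> phi tphi i; rewrite GHE; have [sphi _] := tphi.
  have Lp := partial_L2 i sphi; have Lphi := smooth_L2 sphi.
  rewrite !ip_subl// (wv _ tphi i) (ww _ tphi i).
  by rewrite opprB opprK addrC.
have L3 : L2 surf (bdry Om) (fun x => trace1 v x - trace1 w x).
  by apply: L2_sub => //; exact: measurable_bdry.
have Tr := is_trace_sub Lv LG Lg Lw LH Lh tv tw.
by exists (MkH1 L1 L2' W L3 Tr).
Qed.

(** The weak gradient is the classical one, since the partial derivatives of a product of test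
    functions integrate to 0; the constant sequence realizes the zero trace. Test functions thus
    become admissible in the variational equation. *)
Lemma exists_H1_test (phi : E -> R) : test_fun Om phi -> exists s : H1 Om,
  [/\ val1 s = phi, grad1 s = grad phi & trace1 s = cst 0].
Proof.
move=> tphi; have [sphi [K [cK KOm phi0]]] := tphi.
have L1 := smooth_L2 sphi.
have GE i : (fun x => grad phi x i 0) = partial i phi by apply/funext => x; rewrite mxE.
have L2' : L2v Om (grad phi) by move=> i; rewrite GE; exact: partial_L2.
have W : weak_grad Om phi (grad phi).
  move=> psi [spsi _] i; rewrite GE.
  have := integral_partial_test i (test_fun_mul spsi tphi).
  have Lpsi := smooth_L2 spsi; have Lpp := partial_L2 i sphi; have Lps := partial_L2 i spsi.
  under eq_Rintegral do rewrite partialM//.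
  rewrite RintegralD//; try exact: L2_prod.
  move/eqP; rewrite addrC addr_eq0 /ip => /eqP ->; congr (- _).
  by apply: eq_Rintegral => x _; rewrite mulrC.
have L3 : L2 surf (bdry Om) (cst 0 : E -> R).
  split; first exact: measurable_cst.
  rewrite (_ : (fun x => _) = cst 0%E); first exact: integrable0.
  by apply/funext => x; rewrite /= expr0n.
have Tr : is_trace Om phi (grad phi) (cst 0).
  exists (fun=> phi); split=> //.
  - rewrite (_ : (fun _ => _) = cst 0%E); first exact: cvg_cst.
    by apply/funext => k; apply: integral0_eq => x _; rewrite subrr expr0n.
  - rewrite (_ : (fun _ => _) = cst 0%E); first exact: cvg_cst.
    apply/funext => k; apply: integral0_eq => x _; rewrite subrr /dot big1// => i _.
    by rewrite mxE mul0r.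
  - rewrite (_ : (fun _ => _) = cst 0%E); first exact: cvg_cst.
    apply/funext => k; apply: integral0_eq => x [_ nint].
    rewrite subr0 phi0 ?expr0n// => Kx; apply: nint.
    by move/interior_id : oOm => ->; exact: KOm.
by exists (MkH1 L1 L2' W L3 Tr).
Qed.

(** The products of [f] with the cutoffs are test functions, and they converge to [f] under the
    integral with the dominating function [|g f|]. *)
Lemma ip_smooth_eq0 (g f : E -> R) : L2 leb Om g ->
  (forall phi, test_fun Om phi -> ip Om g phi = 0) -> smooth f -> ip Om g f = 0.
Proof.
move=> Lg g0 sf; have [chi [tchi chi01 chi1]] := cutoff_functions oOm.
have Lf := smooth_L2 sf.
have cvg : (\int[leb]_(x in Om) (g x * (f x * chi n x))%:E @[n --> \oo] -->
    \int[leb]_(x in Om) (g x * f x)%:E)%E.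
  have igf := L2_prod mOm Lg Lf.
  apply: (@dominated_cvg _ _ _ leb Om mOm _ _ (fun x => `|(g x * f x)%:E|%E)) => //.
  - move=> n; apply/measurable_EFinP; apply: measurable_funM; first by have [] := Lg.
    have [stchi _] := test_fun_mul sf (tchi n).
    by have [] := smooth_L2 stchi.
  - move=> x Ox; apply: cvg_EFin; first exact: nearW.
    rewrite -[X in _ --> X]mulr1; under eq_cvg do rewrite /= mulrA.
    by apply: cvgM; [exact: cvg_cst|exact: chi1].
  - exact: integrable_norm.
  - move=> n x _; rewrite /= lee_fin mulrA [leLHS]normrM ler_piMr//.
    by have /andP[h0 h1] := chi01 n x; rewrite ger0_norm.
rewrite /ip /Rintegral -(cvg_lim _ cvg)//.
rewrite (_ : (fun n => _) = cst 0%E); first by rewrite lim_cst.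
apply/funext => n /=; rewrite -[LHS]fineK; last first.
  apply: integrable_fin_num => //; apply: L2_prod => //.
  by have [stchi _] := test_fun_mul sf (tchi n); exact: smooth_L2.
by have := g0 _ (test_fun_mul sf (tchi n)); rewrite /ip /Rintegral => ->.
Qed.

Lemma ip_H1_eq0 (g : E -> R) (s : H1 Om) : L2 leb Om g ->
  (forall phi, test_fun Om phi -> ip Om g phi = 0) -> ip Om g (val1 s) = 0.
Proof.
move=> Lg g0; have [Ls _ _ _ [p [sp pv _ _]]] := H1_facts s.
have Lp k := smooth_L2 (sp k).
(* As [g] annihilates the smooth approximant [p k], only its pairing with [p k - val1 s] is left. *)
have bound k : ip Om g (val1 s) ^+ 2 <=
    ip Om g g * \int[leb]_(x in Om) ((p k x - val1 s x) ^+ 2).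
  have -> : ip Om g (val1 s) = - \int[leb]_(x in Om) (g x * (p k x - val1 s x)).
    under eq_Rintegral do rewrite mulrBr.
    rewrite RintegralB//; try exact: L2_prod.
    by have := ip_smooth_eq0 Lg g0 (sp k); rewrite /ip => ->; rewrite sub0r opprK.
  have Ld : L2 leb Om (fun x => p k x - val1 s x) by exact: L2_sub.
  rewrite sqrrN; apply: Rintegral_CauchySchwarz => //.
  - exact: L2_prod.
  - exact: L2_prod.
  - by have [] := Ld.
  - by apply: aeW => x _; rewrite -expr2 !sqr_ge0 exprMn.
have lim0 : ip Om g g * \int[leb]_(x in Om) ((p k x - val1 s x) ^+ 2) @[k --> \oo] --> (0 : R).
  rewrite -[X in _ --> X](mulr0 (ip Om g g)); apply: cvgM; first exact: cvg_cst.
  exact: (fine_cvg pv).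
apply/eqP; rewrite -sqrf_eq0 eq_le sqr_ge0 andbT.
apply: (cvgr_to_ge lim0); exact: nearW.
Qed.

End sobolev_space.

(** * Uniformly elliptic coefficients *)

Section dot_algebra.
Context {R : realType} {d : nat}.
Implicit Types (u v : 'cV[R]_d) (M : 'M[R]_d).

Lemma dot_mulmx_sym M u v : M^T = M -> dot (M *m u) v = dot u (M *m v).
Proof. by move=> MT; rewrite !dotE trmx_mul MT mulmxA. Qed.

Lemma dot_CauchySchwarz u v : dot u v ^+ 2 <= dot u u * dot v v.
Proof.
have [v0|v0] := eqVneq (dot v v) 0.
  rewrite (dot_eq0 v0) -(scale0r (0 : 'cV[R]_d)) !dotZr !mul0r.
  by rewrite expr0n mulr0.
have vv : 0 < dot v v by rewrite lt_neqAle eq_sym v0 dot_ge0.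
have := dot_ge0 (dot v v *: u - dot u v *: v).
rewrite dotDl !dotDr !dotNl !dotNr !dotZl !dotZr (dotC v u) => h.
rewrite -(ler_pM2l vv) -subr_ge0; apply: le_trans h _.
by rewrite le_eqVlt; apply/orP; left; apply/eqP; ring.
Qed.

(** Cauchy-Schwarz in the plane; it joins the flux part and the scalar part of a residual. *)
Lemma sqr_add_le (X Y F1 F2 G1 G2 : R) : 0 <= F1 -> 0 <= F2 -> 0 <= G1 -> 0 <= G2 ->
  X ^+ 2 <= F1 * G1 -> Y ^+ 2 <= F2 * G2 -> (X + Y) ^+ 2 <= (F1 + F2) * (G1 + G2).
Proof.
move=> F10 F20 G10 G20 X2 Y2.
have XY : 2 * `|X * Y| <= F1 * G2 + F2 * G1.
  apply: le_half_sum_of_sqr_le; rewrite ?mulr_ge0//.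
  rewrite exprMn (_ : F1 * G2 * (F2 * G1) = (F1 * G1) * (F2 * G2)); last by ring.
  by apply: ler_pM; rewrite ?sqr_ge0.
have := ler_norm (X * Y).
rewrite sqrrD mulrDl !mulrDr; lra.
Qed.

End dot_algebra.

Section elliptic_matrix.
Context {R : realType} {d : nat}.
Variables (a0 a1 : R) (M : 'M[R]_d).
Hypotheses (a0_gt0 : 0 < a0) (MT : M^T = M).
Hypothesis ell : forall xi, a0 * enorm xi ^+ 2 <= dot xi (M *m xi) <= a1 * enorm xi ^+ 2.

Lemma enorm2 (xi : 'cV[R]_d) : enorm xi ^+ 2 = dot xi xi.
Proof. by rewrite sqr_sqrtr// dot_ge0. Qed.

Lemma elliptic_pos xi : xi != 0 -> 0 < dot xi (M *m xi).
Proof.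
move=> xi0; have /andP[+ _] := ell xi; apply: lt_le_trans.
rewrite enorm2 mulr_gt0// lt_neqAle dot_ge0 andbT eq_sym.
by apply: contra xi0 => /eqP/dot_eq0->.
Qed.

Lemma elliptic_unit : M \in unitmx.
Proof.
have [_ Su SS] := msqrtP MT elliptic_pos.
by rewrite -SS unitmx_mul Su.
Qed.

Lemma invmx_sym : (invmx M)^T = invmx M.
Proof. by rewrite trmx_inv MT. Qed.

Lemma dot_msqrt_inv u v :
  dot (invmx (msqrt M) *m u) (invmx (msqrt M) *m v) = dot u (invmx M *m v).
Proof.
have [ST Su SS] := msqrtP MT elliptic_pos.
rewrite dot_mulmx_sym; last by rewrite trmx_inv ST.
congr dot; rewrite -[LHS](mulKmx elliptic_unit) -{2}SS -mulmxA.
by rewrite !(mulKVmx Su).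
Qed.

Lemma msqrt_inv_mul (u : 'cV[R]_d) : invmx (msqrt M) *m (M *m u) = msqrt M *m u.
Proof.
have [ST Su SS] := msqrtP MT elliptic_pos.
by rewrite -{2}SS -mulmxA mulKmx.
Qed.

Lemma dot_invmx_ge0 u : 0 <= dot u (invmx M *m u).
Proof. by rewrite -dot_msqrt_inv dot_ge0. Qed.

Lemma dot_invmx_CS u v :
  dot u (invmx M *m v) ^+ 2 <= dot u (invmx M *m u) * dot v (invmx M *m v).
Proof. by rewrite -!dot_msqrt_inv dot_CauchySchwarz. Qed.

(** Writing [v = invmx M *m (M *m v)], Cauchy-Schwarz in the inner product of the inverse leaves
    [dot v (M *m v)]. This is where [a1] enters the final constant. *)
Lemma dot_le_invmx u v : dot u v ^+ 2 <= dot u (invmx M *m u) * (a1 * dot v v).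
Proof.
apply: (@le_trans _ _ (dot u (invmx M *m u) * dot v (M *m v))).
  have := dot_invmx_CS u (M *m v).
  by rewrite (mulKmx elliptic_unit) (dotC (M *m v)).
apply: ler_wpM2l; first exact: dot_invmx_ge0.
by rewrite -enorm2; have /andP[] := ell v.
Qed.

(** The j-th column [e] of the inverse satisfies [a0 |e|^2 <= dot e (M *m e)], which is the j-th
    entry of [e] and so at most [|e|]. *)
Lemma invmx_entry_bound i j : `|invmx M i j| <= a0^-1.
Proof.
pose e := invmx M *m unit_col j.
have -> : invmx M i j = e i 0 by rewrite /e /unit_col -colE mxE.
apply: le_trans (coord_le_enorm e i) _.
have /andP[h _] := ell e.
have Me : M *m e = unit_col j by rewrite /e mulKVmx// elliptic_unit.
have ej : dot e (M *m e) <= enorm e.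
  rewrite Me /dot (bigD1 j)//= big1 => [|k kj]; last first.
    by rewrite [unit_col j k 0]mxE (negbTE kj) mulr0.
  rewrite [unit_col j j 0]mxE !eqxx mulr1 addr0.
  exact: le_trans (ler_norm _) (coord_le_enorm e j).
have [e0|e0] := eqVneq (enorm e) 0; first by rewrite e0 invr_ge0 ltW.
have e1 : 0 < enorm e by rewrite lt_neqAle eq_sym e0 sqrtr_ge0.
rewrite -(ler_pM2l a0_gt0) divff ?gt_eqF// -(ler_pM2r e1) mul1r -mulrA -expr2.
exact: le_trans ej.
Qed.

End elliptic_matrix.

(** * Measurability of the inverse matrix *)

Section measurable_inverse.
Context disp (T : measurableType disp) (R : realType).
Variable D : set T.

Lemma measurable_inv_real (f : T -> R) : measurable_fun D f ->
  measurable_fun D (fun x => (f x)^-1).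
Proof.
(* The real power is measurable and inverts nonnegative numbers, hence the square; where [f]
   vanishes both sides are 0. *)
move=> mf; rewrite (_ : (fun x => _) = fun x => f x * ((f x ^+ 2) `^ (-1))).
  apply: measurable_funM => //.
  apply: (@measurableT_comp _ _ _ _ _ _ (fun t : R => t `^ (-1))) => //.
  exact: measurable_funX.
apply/funext => x; rewrite powR_inv1 ?sqr_ge0//.
have [->|f0] := eqVneq (f x) 0; first by rewrite invr0 mul0r.
by rewrite expr2 invfM mulrA divff// mul1r.
Qed.

Lemma measurable_det n (M : T -> 'M[R]_n) :
  (forall i j, measurable_fun D (fun x => M x i j)) ->
  measurable_fun D (fun x => \det (M x)).
Proof.
move=> mM; apply: measurable_sum => s; apply: measurable_funM => //.
by apply: measurable_prod => i _; exact: mM.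
Qed.

Lemma measurable_invmx n (M : T -> 'M[R]_n) :
  (forall i j, measurable_fun D (fun x => M x i j)) ->
  forall i j, measurable_fun D (fun x => invmx (M x) i j).
Proof.
move=> mM i j; have mdet := measurable_det mM.
(* The first term is the cofactor formula; the second accounts for the convention that [invmx]
   returns a singular matrix unchanged. *)
rewrite (_ : (fun x => _) = fun x => (\det (M x))^-1 * (\adj (M x)) i j +
    \1_[set 0] (\det (M x)) * M x i j); last first.
  apply/funext => x; rewrite indicE.
  have [Mu|Mu] := boolP (M x \in unitmx).
    rewrite /invmx Mu !mxE memNset ?mul0r ?addr0//= => det0.
    by move: Mu; rewrite unitmxE det0 unitr0.
  have det0 : \det (M x) = 0.
    by apply/eqP; move: Mu; rewrite unitmxE unitfE negbK.
  by rewrite (invmx_out Mu) det0 invr0 mul0r add0r mem_set// mul1r.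
apply: measurable_funD; apply: measurable_funM => //.
- exact: measurable_inv_real.
- under eq_fun do rewrite mxE /cofactor.
  apply: measurable_funM => //; apply: measurable_det => k l.
  by under eq_fun do rewrite !mxE; exact: mM.
- exact: (@measurableT_comp _ _ _ _ _ _ (\1_[set (0 : R)] : R -> R)).
Qed.

End measurable_inverse.

(** * Least-squares residuals and error representation *)

Section least_squares.
Context {R : realType} {d : nat} (P : problem R d) (a0 a1 : R).
Local Notation E := 'cV[R]_d.
Local Notation Om := (dom P).
Local Notation A := (coefA P).
Local Notation b := (coefb P).
Local Notation c := (coefc P).
Hypotheses (lipOm : lipschitz_domain Om) (hcoef : coefficients P a0 a1)
  (hdata : data P).
Implicit Types (f g : E -> E) (s v w z : H1 Om) (tau rho : Hdiv Om).

Let oOm : open Om. Proof. by case: lipOm. Qed.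
Let bOm : bounded_set Om. Proof. by case: lipOm. Qed.
Let mOm : measurable Om. Proof. exact: open_measurable_col. Qed.

Local Notation Int h := (leb.-integrable Om (EFin \o h)).

Lemma elliptic_ae : exists N, [/\ measurable N, leb N = 0%E &
  forall x, (Om `\` N) x -> (A x)^T = A x /\
    forall xi, a0 * enorm xi ^+ 2 <= dot xi (A x *m xi) <= a1 * enorm xi ^+ 2].
Proof.
have [_ _ _ _ /negligible_measure0[N [mN N0 NP]]] := hcoef.
by exists N; split=> // x [Ox Nx]; exact: NP.
Qed.

Lemma a0_gt0 : 0 < a0. Proof. by case: hcoef => /andP[]. Qed.

Lemma L2v_add f g : L2v Om f -> L2v Om g -> L2v Om (fun x => f x + g x).
Proof.
move=> Lf Lg i; rewrite (_ : (fun x => _) = fun x => f x i 0 + g x i 0).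
  exact: L2_add.
by apply/funext => x; rewrite mxE.
Qed.

Lemma integrable_dot f g : L2v Om f -> L2v Om g -> Int (fun x => dot (f x) (g x)).
Proof.
move=> Lf Lg; apply: integrable_finsum => // i.
exact: L2_prod.
Qed.

Lemma L2v_mulmx (M : E -> 'M[R]_d) f :
  (forall i j, Linf Om (fun x => M x i j)) -> L2v Om f ->
  L2v Om (fun x => M x *m f x).
Proof.
move=> LM Lf i; under eq_fun do rewrite mxE.
apply: L2_sum => // j; have [mM [C MC]] := LM i j.
by apply: (L2_ae_bounded_mul mOm mM MC); exact: Lf.
Qed.

Lemma L2v_Amul f : L2v Om f -> L2v Om (Amul P f).
Proof. by apply: L2v_mulmx; case: hcoef. Qed.

Lemma L2v_Ainv f : L2v Om f -> L2v Om (Ainv P f).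
Proof.
apply: L2v_mulmx => i j; split.
  by apply: measurable_invmx => k l; have [_ LA _ _ _] := hcoef; have [] := LA k l.
have [N [mN N0 NP]] := elliptic_ae.
exists a0^-1; exists N; split=> // x /= h; apply: contrapT => Nx; apply: h => Ox.
have [AT ell] := NP x (conj Ox Nx).
exact: (invmx_entry_bound a0_gt0 AT ell).
Qed.

Lemma H1_L2 v : L2 leb Om (val1 v). Proof. by have [] := H1_facts v. Qed.
Lemma H1_L2v v : L2v Om (grad1 v). Proof. by have [] := H1_facts v. Qed.
Lemma Hdiv_L2v tau : L2v Om (valdiv tau). Proof. by case: tau. Qed.
Lemma Hdiv_L2 tau : L2 leb Om (div1 tau). Proof. by case: tau. Qed.

Lemma L2v_bval v : L2v Om (bval P v).
Proof.
move=> i; rewrite (_ : (fun x => _) = fun x => b x i 0 * val1 v x).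
  have [_ _ Lb _ _] := hcoef; have [mb [C bC]] := Lb i.
  by apply: (L2_ae_bounded_mul mOm mb bC); exact: H1_L2.
by apply/funext => x; rewrite /bval mxE mulrC.
Qed.

Lemma L2_bgrad v : L2 leb Om (bgrad P v).
Proof.
apply: L2_sum => // i; have [_ _ Lb _ _] := hcoef; have [mb [C bC]] := Lb i.
by apply: (L2_ae_bounded_mul mOm mb bC); exact: H1_L2v.
Qed.

Lemma L2_cval v : L2 leb Om (cval P v).
Proof.
have [_ _ _ [mc [C cC]] _] := hcoef.
by apply: (L2_ae_bounded_mul mOm mc cC); exact: H1_L2.
Qed.

Lemma L2_f1 : L2 leb Om (srcf1 P). Proof. by case: hdata => [[]]. Qed.
Lemma L2_g1 : L2 leb Om (srcg1 P). Proof. by case: hdata => [[]]. Qed.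
Lemma L2v_f2 : L2v Om (srcf2 P). Proof. by case: hdata => [_ []]. Qed.
Lemma L2v_g2 : L2v Om (srcg2 P). Proof. by case: hdata => [_ []]. Qed.

(** This is [residual_p1] multiplied by the square root of A wherever A is symmetric and elliptic: a
    form free of square roots, and visibly in L2. *)
Definition flux_residual_p tau w : E -> E :=
  fun x => valdiv tau x + Amul P (grad1 w) x + srcf2 P x.
Definition flux_residual_d rho v : E -> E :=
  fun x => valdiv rho x + Amul P (grad1 v) x + bval P v x + srcg2 P x.

Lemma L2v_flux_residual_p tau w : L2v Om (flux_residual_p tau w).
Proof.
apply: L2v_add; last exact: L2v_f2.
by apply: L2v_add; [exact: Hdiv_L2v|exact/L2v_Amul/H1_L2v].
Qed.

Lemma L2v_flux_residual_d rho v : L2v Om (flux_residual_d rho v).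
Proof.
apply: L2v_add; last exact: L2v_g2.
apply: L2v_add; last exact: L2v_bval.
by apply: L2v_add; [exact: Hdiv_L2v|exact/L2v_Amul/H1_L2v].
Qed.

Lemma L2_residual_p2 tau w : L2 leb Om (residual_p2 P tau w).
Proof.
apply: (@L2_sub _ _ _ _ _ mOm _ (srcf1 P)); last exact: L2_f1.
apply: (@L2_add _ _ _ _ _ mOm _ (cval P w)); last exact: L2_cval.
by apply: (@L2_add _ _ _ _ _ mOm (div1 tau)); [exact: Hdiv_L2|exact: L2_bgrad].
Qed.

Lemma L2_residual_d2 rho v : L2 leb Om (residual_d2 P rho v).
Proof.
apply: (@L2_sub _ _ _ _ _ mOm _ (srcg1 P)); last exact: L2_g1.
by apply: (@L2_add _ _ _ _ _ mOm (div1 rho)); [exact: Hdiv_L2|exact: L2_cval].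
Qed.

Lemma residual_p1E tau w x : (A x)^T = A x ->
  (forall xi, a0 * enorm xi ^+ 2 <= dot xi (A x *m xi) <= a1 * enorm xi ^+ 2) ->
  dot (residual_p1 P tau w x) (residual_p1 P tau w x) =
  dot (flux_residual_p tau w x) (Ainv P (flux_residual_p tau w) x).
Proof.
move=> AT ell; rewrite /Ainv -(dot_msqrt_inv a0_gt0 AT ell).
suff -> : residual_p1 P tau w x = invmx (msqrt (A x)) *m flux_residual_p tau w x by [].
by rewrite /residual_p1 /flux_residual_p /Amul !mulmxDr (msqrt_inv_mul a0_gt0 AT ell).
Qed.

Lemma residual_d1E rho v x : (A x)^T = A x ->
  (forall xi, a0 * enorm xi ^+ 2 <= dot xi (A x *m xi) <= a1 * enorm xi ^+ 2) ->
  dot (residual_d1 P rho v x) (residual_d1 P rho v x) =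
  dot (flux_residual_d rho v x) (Ainv P (flux_residual_d rho v) x).
Proof.
move=> AT ell; rewrite /Ainv -(dot_msqrt_inv a0_gt0 AT ell).
suff -> : residual_d1 P rho v x = invmx (msqrt (A x)) *m flux_residual_d rho v x by [].
by rewrite /residual_d1 /flux_residual_d /Amul !mulmxDr (msqrt_inv_mul a0_gt0 AT ell).
Qed.

(* The residuals involve A^{1/2}, whose measurability in x is not needed: almost
   everywhere their squares agree with A^{-1}-weighted squares of L2 fields. *)
Section weighted_square.
Variables (r F : E -> E).
Hypothesis LF : L2v Om F.
Hypothesis rF : forall x, (A x)^T = A x ->
  (forall xi, a0 * enorm xi ^+ 2 <= dot xi (A x *m xi) <= a1 * enorm xi ^+ 2) ->
  dot (r x) (r x) = dot (F x) (Ainv P F x).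

Lemma integral_square_eq :
  (\int[leb]_(x in Om) (dot (r x) (r x))%:E =
   \int[leb]_(x in Om) `|(dot (F x) (Ainv P F x))%:E|)%E.
Proof.
have [N [mN N0 NP]] := elliptic_ae.
rewrite (@ge0_integral_setD_null _ _ _ leb Om N) => [|//|//|x _]; last first.
  by rewrite lee_fin dot_ge0.
rewrite [RHS](@ge0_integral_setD_null _ _ _ leb Om N) => [|//|//|//].
apply: eq_integral => x; rewrite inE => xON; have [AT ell] := NP x xON.
by rewrite -rF//= ger0_norm// dot_ge0.
Qed.

Lemma integral_square_lty : (\int[leb]_(x in Om) (dot (r x) (r x))%:E < +oo)%E.
Proof.
rewrite integral_square_eq.
by have /integrableP[] := integrable_dot LF (L2v_Ainv LF).
Qed.

Lemma Rintegral_square_eq :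
  \int[leb]_(x in Om) dot (r x) (r x) = \int[leb]_(x in Om) dot (F x) (Ainv P F x).
Proof.
rewrite {1}/Rintegral integral_square_eq.
have iF := integrable_dot LF (L2v_Ainv LF).
apply: (@ae_eq_Rintegral _ _ _ leb Om mOm (fun x => `|dot (F x) (Ainv P F x)|)).
- by apply: measurableT_comp => //; exact: integrable_measurable iF.
- exact: integrable_measurable iF.
have [N [mN N0 NP]] := elliptic_ae.
exists N; split=> // x /= h; apply: contrapT => Nx; apply: h => Ox.
have [AT ell] := NP x (conj Ox Nx).
by rewrite -rF// ger0_norm// dot_ge0.
Qed.

Lemma measurable_square N : measurable N ->
  (forall x, (Om `\` N) x -> (A x)^T = A x /\
    forall xi, a0 * enorm xi ^+ 2 <= dot xi (A x *m xi) <= a1 * enorm xi ^+ 2) ->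
  measurable_fun (Om `\` N) (fun x => (dot (r x) (r x))%:E).
Proof.
move=> mN NP.
have iF := integrable_measurable (integrable_dot LF (L2v_Ainv LF)).
have mF : measurable_fun (Om `\` N) (fun x => (dot (F x) (Ainv P F x))%:E).
  by apply/measurable_EFinP; apply: measurable_funS iF.
apply: eq_measurable_fun mF => x; rewrite inE => xON; have [AT ell] := NP x xON.
by rewrite rF.
Qed.

End weighted_square.

Lemma sum_fine_integral_simplex (T : seq 'M[R]_(d, d.+1)) (f : E -> \bar R) :
  (forall x, (0 <= f x)%E) ->
  (\sum_(K <- T) \int[leb]_(x in simplex K) f x = \int[leb]_(x in Om) f x)%E ->
  (\int[leb]_(x in Om) f x < +oo)%E ->
  \sum_(K <- T) fine (\int[leb]_(x in simplex K) f x) = fine (\int[leb]_(x in Om) f x).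
Proof.
move=> f0 sumE fin.
have int0 D : (0 <= \int[leb]_(x in D) f x)%E by apply: integral_ge0 => x _; exact: f0.
apply: EFin_inj; rewrite fineK ?ge0_fin_numE// -sumE -sumEFin.
apply: eq_big_seq => K KT; rewrite fineK// ge0_fin_numE//.
by apply: le_lt_trans fin; rewrite -sumE (big_rem K)//= leeDl// sume_ge0.
Qed.

Section mesh_sums.
Variable T : seq 'M[R]_(d, d.+1).
Hypotheses (d0 : (0 < d)%N) (triT : triangulation Om T).

Lemma sum_ipv_simplex (r F : E -> E) : L2v Om F ->
  (forall x, (A x)^T = A x ->
    (forall xi, a0 * enorm xi ^+ 2 <= dot xi (A x *m xi) <= a1 * enorm xi ^+ 2) ->
    dot (r x) (r x) = dot (F x) (Ainv P F x)) ->
  \sum_(K <- T) ipv (simplex K) r r = ipv Om r r.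
Proof.
move=> LF rF; have [N [mN N0 NP]] := elliptic_ae.
have r0 x : (0 <= (dot (r x) (r x))%:E)%E by rewrite lee_fin dot_ge0.
apply: (sum_fine_integral_simplex r0); last exact: integral_square_lty LF rF.
apply: (sum_integral_simplex d0 lipOm triT mN N0 r0).
exact: measurable_square LF rF N mN NP.
Qed.

Lemma sum_ip_simplex (r : E -> R) : L2 leb Om r ->
  \sum_(K <- T) ip (simplex K) r r = ip Om r r.
Proof.
move=> Lr; have r0 x : (0 <= (r x * r x)%:E)%E by rewrite lee_fin -expr2 sqr_ge0.
have irr := L2_prod mOm Lr Lr.
apply: (sum_fine_integral_simplex r0).
  apply: (sum_integral_simplex d0 lipOm triT measurable0 (measure0 _) r0).
  by rewrite setD0; apply/measurable_EFinP; exact: integrable_measurable irr.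
by apply: integrable_lty.
Qed.

Lemma sum_LSp tau w : \sum_(K <- T) LSp P (simplex K) tau w = LSp P Om tau w.
Proof.
rewrite /LSp big_split /=; congr (_ + _).
  apply: sum_ipv_simplex (L2v_flux_residual_p tau w) _ => x; exact: residual_p1E.
exact/sum_ip_simplex/L2_residual_p2.
Qed.

Lemma sum_LSd rho v : \sum_(K <- T) LSd P (simplex K) rho v = LSd P Om rho v.
Proof.
rewrite /LSd big_split /=; congr (_ + _).
  apply: sum_ipv_simplex (L2v_flux_residual_d rho v) _ => x; exact: residual_d1E.
exact/sum_ip_simplex/L2_residual_d2.
Qed.

End mesh_sums.

Lemma LSpE tau w : LSp P Om tau w =
  ipv Om (flux_residual_p tau w) (Ainv P (flux_residual_p tau w)) +
  ip Om (residual_p2 P tau w) (residual_p2 P tau w).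
Proof.
rewrite /LSp; congr (_ + _).
apply: Rintegral_square_eq (L2v_flux_residual_p tau w) _ => x; exact: residual_p1E.
Qed.

Lemma LSdE rho v : LSd P Om rho v =
  ipv Om (flux_residual_d rho v) (Ainv P (flux_residual_d rho v)) +
  ip Om (residual_d2 P rho v) (residual_d2 P rho v).
Proof.
rewrite /LSd; congr (_ + _).
apply: Rintegral_square_eq (L2v_flux_residual_d rho v) _ => x; exact: residual_d1E.
Qed.

Lemma ip_ge0 (f : E -> R) : 0 <= ip Om f f.
Proof. by apply: Rintegral_ge0 => x _; rewrite -expr2 sqr_ge0. Qed.

Lemma ipv_ge0 f : 0 <= ipv Om f f.
Proof. by apply: Rintegral_ge0 => x _; exact: dot_ge0. Qed.

Lemma LSp_ge0 tau w : 0 <= LSp P Om tau w.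
Proof. by rewrite addr_ge0 ?ipv_ge0 ?ip_ge0. Qed.

Lemma LSd_ge0 rho v : 0 <= LSd P Om rho v.
Proof. by rewrite addr_ge0 ?ipv_ge0 ?ip_ge0. Qed.

Lemma elliptic_aeP (Q : E -> Prop) :
  (forall x, Om x -> (A x)^T = A x ->
    (forall xi, a0 * enorm xi ^+ 2 <= dot xi (A x *m xi) <= a1 * enorm xi ^+ 2) -> Q x) ->
  {ae leb, forall x, Om x -> Q x}.
Proof.
move=> h; have [N [mN N0 NP]] := elliptic_ae; exists N; split=> // x /= nQ.
apply: contrapT => Nx; apply: nQ => Ox.
by have [AT ell] := NP x (conj Ox Nx); exact: h.
Qed.

Lemma ipv_Ainv_ge0 f : L2v Om f -> 0 <= ipv Om f (Ainv P f).
Proof.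
move=> Lf; apply: (ae_Rintegral_ge0 mOm); first exact: integrable_dot Lf (L2v_Ainv Lf).
by apply: elliptic_aeP => x _ AT ell; exact: (dot_invmx_ge0 a0_gt0 AT ell).
Qed.

(** The flux part pairs with the gradient at the price [a1], the scalar part with the value at the
    price 1; the maximum serves the whole H1 norm. *)
Lemma residual_bound (F : E -> E) (r : E -> R) s : L2v Om F -> L2 leb Om r ->
  (ipv Om F (grad1 s) + ip Om r (val1 s)) ^+ 2 <=
  (ipv Om F (Ainv P F) + ip Om r r) * (Num.max a1 1 * H1norm s ^+ 2).
Proof.
move=> LF Lr; set c2 := Num.max a1 1.
have c1 : 1 <= c2 by rewrite le_max lexx orbT.
have a1c : a1 <= c2 by rewrite le_max lexx.
have G0 : 0 <= ipv Om (grad1 s) (grad1 s) by exact: ipv_ge0.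
have V0 : 0 <= ip Om (val1 s) (val1 s) by exact: ip_ge0.
rewrite /H1norm sqr_sqrtr ?addr_ge0// [X in _ * (_ * X)]addrC mulrDr.
apply: sqr_add_le; rewrite ?mulr_ge0 ?(le_trans _ c1)// ?ip_ge0 ?ipv_Ainv_ge0//.
- have iF := integrable_dot LF (L2v_Ainv LF).
  have iG := integrable_dot (H1_L2v s) (H1_L2v s).
  have iFG := integrable_dot LF (H1_L2v s).
  rewrite /ipv -RintegralZl//; apply: Rintegral_CauchySchwarz => //.
    exact: integrable_scale.
  apply: elliptic_aeP => x _ AT ell; split.
  + exact: (dot_invmx_ge0 a0_gt0 AT ell).
  + by rewrite mulr_ge0 ?dot_ge0 ?(le_trans _ c1).
  + apply: le_trans (dot_le_invmx a0_gt0 AT ell _ _) _.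
    apply: ler_wpM2l; first exact: (dot_invmx_ge0 a0_gt0 AT ell).
    by rewrite ler_wpM2r ?dot_ge0.
- have ir := L2_prod mOm Lr Lr; have is_ := L2_prod mOm (H1_L2 s) (H1_L2 s).
  have irs := L2_prod mOm Lr (H1_L2 s).
  apply: (@le_trans _ _ (ip Om r r * ip Om (val1 s) (val1 s))).
    apply: Rintegral_CauchySchwarz => //; apply: aeW => x _.
    by rewrite -!expr2 !sqr_ge0 exprMn.
  apply: ler_wpM2l; first exact: ip_ge0.
  by rewrite ler_peMl.
Qed.

Local Notation GN := (bdryN P).
Local Notation GD := (bdryD P).

(* Formal linear combinations of L2 pairings: identities between the bilinear
   forms follow from pointwise identities between their integrands. *)
Definition pairing (t : (E -> R) * (E -> R) + (E -> E) * (E -> E)) : R :=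
  match t with inl p => ip Om p.1 p.2 | inr p => ipv Om p.1 p.2 end.
Definition pairing_at (t : (E -> R) * (E -> R) + (E -> E) * (E -> E)) (x : E) : R :=
  match t with inl p => p.1 x * p.2 x | inr p => dot (p.1 x) (p.2 x) end.
Definition pairing_L2 (t : (E -> R) * (E -> R) + (E -> E) * (E -> E)) : Prop :=
  match t with
  | inl p => L2 leb Om p.1 /\ L2 leb Om p.2
  | inr p => L2v Om p.1 /\ L2v Om p.2
  end.

Lemma pairing_lincomb (l : seq (R * ((E -> R) * (E -> R) + (E -> E) * (E -> E)))) :
  foldr (fun p Q => pairing_L2 p.2 /\ Q) True l ->
  (forall x, Om x -> (A x)^T = A x ->
    (forall xi, a0 * enorm xi ^+ 2 <= dot xi (A x *m xi) <= a1 * enorm xi ^+ 2) ->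
    \sum_(p <- l) p.1 * pairing_at p.2 x = 0) ->
  \sum_(p <- l) p.1 * pairing p.2 = 0.
Proof.
move=> Ll l0; have := @Rintegral_lincomb _ _ _ leb Om mOm
  [seq (p.1, pairing_at p.2) | p <- l].
rewrite big_map => h; apply: etrans (h _ _).
- by apply: eq_bigr => -[a [[f g]|[f g]]] _.
- elim: l Ll {l0 h} => // -[a [[f g]|[f g]]] l IH /= [[Lf Lg] /IH Ll]; split=> //.
    exact: L2_prod.
  exact: integrable_dot.
- apply: elliptic_aeP => x Ox AT ell; rewrite big_map; exact: l0.
Qed.

Lemma L2v_addf f g : L2v Om f -> L2v Om g -> L2v Om (f \+ g).
Proof. exact: L2v_add. Qed.

Lemma L2_addf (f g : E -> R) : L2 leb Om f -> L2 leb Om g -> L2 leb Om (f \+ g).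
Proof. exact: L2_add. Qed.

Local Hint Resolve H1_L2 H1_L2v Hdiv_L2 Hdiv_L2v L2_f1 L2_g1 L2v_f2 L2v_g2 L2v_addf
  L2_addf L2v_bval L2_bgrad L2_cval L2v_Amul L2v_Ainv L2v_flux_residual_p
  L2v_flux_residual_d L2_residual_p2 L2_residual_d2 : sobolev.

Local Ltac solve_L2 := simpl; repeat (split; [by split; eauto 8 with sobolev|]); exact I.

(** The two Neumann pairings cancel, so the identity holds for every [tau] and every [s]. It is used
    for the discrete pair, whose [flux_pair] vanishes when [s] vanishes on the Dirichlet part, and
    for the exact pair. *)
Lemma primal_residual tau w s :
  a_form P w s - ell P s + flux_pair P tau s =
  ipv Om (flux_residual_p tau w) (grad1 s) + ip Om (residual_p2 P tau w) (val1 s).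
Proof.
rewrite /a_form /ell /flux_pair.
have : \sum_(p <- [::
  (1, inr (Amul P (grad1 w), grad1 s));
  (1, inl (bgrad P w \+ cval P w, val1 s));
  (-1, inl (srcf1 P, val1 s));
  (1, inr (srcf2 P, grad1 s));
  (1, inr (valdiv tau, grad1 s));
  (1, inl (div1 tau, val1 s));
  (-1, inr (flux_residual_p tau w, grad1 s));
  (-1, inl (residual_p2 P tau w, val1 s))]) p.1 * pairing p.2 = 0.
  apply: pairing_lincomb => [|x _ _ _]; first solve_L2.
  by rewrite !big_cons big_nil /flux_residual_p /residual_p2 /= !dotDl; ring.
by rewrite !big_cons big_nil /=; lra.
Qed.

(** Here the first argument of the form varies: symmetry moves A onto the gradient of [v], and the
    convection term becomes the pairing of b v with the gradient of [s], hence part of the flux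
    residual. *)
Lemma dual_residual rho v s :
  ipv Om (valdiv rho) (grad1 s) + ip Om (div1 rho) (val1 s) = bpair GN (fluxd P) s ->
  a_form P s v - m_form P s =
  ipv Om (flux_residual_d rho v) (grad1 s) + ip Om (residual_d2 P rho v) (val1 s).
Proof.
move=> nt; rewrite /a_form /m_form -nt.
have : \sum_(p <- [::
  (1, inr (Amul P (grad1 s), grad1 v));
  (1, inl (bgrad P s \+ cval P s, val1 v));
  (-1, inl (srcg1 P, val1 s));
  (1, inr (srcg2 P, grad1 s));
  (1, inr (valdiv rho, grad1 s));
  (1, inl (div1 rho, val1 s));
  (-1, inr (flux_residual_d rho v, grad1 s));
  (-1, inl (residual_d2 P rho v, val1 s))]) p.1 * pairing p.2 = 0.
  apply: pairing_lincomb => [|x _ AT _]; first solve_L2.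
  rewrite !big_cons big_nil /flux_residual_d /residual_d2 /= /Amul /bgrad /cval /bval.
  by rewrite !dotDl (dot_mulmx_sym _ _ AT) (dotC (grad1 s x)) dotZl; ring.
by rewrite !big_cons big_nil /=; lra.
Qed.

Lemma gamma1_sub_gamma0 tau w rho v :
  gamma1 P w tau v rho - gamma0 P w v =
  ipv Om (flux_residual_p tau w) (Ainv P (flux_residual_d rho v)).
Proof.
rewrite /gamma1 /gamma0 /ell_tilde /m_tilde /a_tilde /m_form /ell /a_form.
have : \sum_(p <- [::
  (1, inl (srcg1 P, val1 w));
  (1, inr (Ainv P (valdiv tau \+ srcf2 P), srcg2 P));
  (1, inl (srcf1 P, val1 v));
  (1, inr (srcf2 P, Ainv P (valdiv rho \+ bval P v \+ srcg2 P)));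
  (-1, inr (Ainv P (valdiv tau \+ srcf2 P), valdiv rho \+ srcg2 P));
  (-1, inl (cval P w, val1 v));
  (1, inr (valdiv tau \+ Amul P (grad1 w) \+ srcf2 P, Ainv P (valdiv rho)));
  (1, inr (Ainv P (valdiv tau), valdiv rho \+ srcg2 P \+ Amul P (grad1 v) \+ bval P v));
  (-1, inl (srcg1 P, val1 w));
  (1, inr (srcg2 P, grad1 w));
  (-1, inl (srcf1 P, val1 v));
  (1, inr (srcf2 P, grad1 v));
  (1, inr (Amul P (grad1 w), grad1 v));
  (1, inl (bgrad P w \+ cval P w, val1 v));
  (-1, inr (flux_residual_p tau w, Ainv P (flux_residual_d rho v)))]) p.1 * pairing p.2 = 0.
  apply: pairing_lincomb => [|x _ AT ell]; first solve_L2.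
  rewrite !big_cons big_nil /flux_residual_d /flux_residual_p /= /Amul /Ainv /bgrad /cval.
  have Mu := elliptic_unit a0_gt0 AT ell; have Msym := invmx_sym AT.
  rewrite /= !mulmxDr !(mulKmx Mu) !dotDl !dotDr !(dot_mulmx_sym _ _ Msym).
  rewrite !(dot_mulmx_sym _ _ AT) !(mulKmx Mu) !(mulKVmx Mu) /bval dotZr.
  rewrite (dotC (grad1 w x) (b x)) (dotC (grad1 w x) (srcg2 P x)); ring.
by rewrite !big_cons big_nil /=; lra.
Qed.

Lemma a_form_subl (u w s e : H1 Om) : val1 e = (fun x => val1 u x - val1 w x) ->
  grad1 e = (fun x => grad1 u x - grad1 w x) ->
  a_form P e s = a_form P u s - a_form P w s.
Proof.
move=> ve ge; rewrite /a_form.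
have : \sum_(p <- [::
  (1, inr (Amul P (grad1 e), grad1 s));
  (1, inl (bgrad P e \+ cval P e, val1 s));
  (-1, inr (Amul P (grad1 u), grad1 s));
  (-1, inl (bgrad P u \+ cval P u, val1 s));
  (1, inr (Amul P (grad1 w), grad1 s));
  (1, inl (bgrad P w \+ cval P w, val1 s))]) p.1 * pairing p.2 = 0.
  apply: pairing_lincomb => [|x _ _ _]; first solve_L2.
  rewrite !big_cons big_nil /= /Amul /bgrad /cval ve ge.
  by rewrite mulmxBr dotDl dotDr !dotNl !dotNr; ring.
by rewrite !big_cons big_nil /=; lra.
Qed.

Lemma a_form_subr (u w s e : H1 Om) : val1 e = (fun x => val1 u x - val1 w x) ->
  grad1 e = (fun x => grad1 u x - grad1 w x) ->
  a_form P s e = a_form P s u - a_form P s w.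
Proof.
move=> ve ge; rewrite /a_form.
have : \sum_(p <- [::
  (1, inr (Amul P (grad1 s), grad1 e));
  (1, inl (bgrad P s \+ cval P s, val1 e));
  (-1, inr (Amul P (grad1 s), grad1 u));
  (-1, inl (bgrad P s \+ cval P s, val1 u));
  (1, inr (Amul P (grad1 s), grad1 w));
  (1, inl (bgrad P s \+ cval P s, val1 w))]) p.1 * pairing p.2 = 0.
  apply: pairing_lincomb => [|x _ _ _]; first solve_L2.
  by rewrite !big_cons big_nil /= ve ge !dotDr !dotNr; ring.
by rewrite !big_cons big_nil /=; lra.
Qed.

(** * Boundary terms, the exact flux and the inf-sup bound *)

Hypothesis hG : boundary_split Om GD GN.

Lemma L2_flux : L2 surf GN (fluxp P) /\ L2 surf GN (fluxd P).
Proof. by case: hdata. Qed.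

Lemma bdryN_facts : measurable (GN : set (caratheodory_type (@surf_outer R d))) /\
  GN `<=` bdry Om.
Proof.
have [_ [U oU ->] _ _ _] := hG; split; last by move=> x [].
apply: measurableI; first exact: (measurable_bdry Om).
apply: measurable_surf; exact: open_measurable_col.
Qed.

Lemma L2_trace_GN v : L2 surf GN (trace1 v).
Proof.
have [mG GB] := bdryN_facts; have [_ _ _ [mt it] _] := H1_facts v.
have mB := measurable_bdry Om.
split; first exact: measurable_funS mt.
exact: integrableS it.
Qed.

Lemma bpair_sub (psi : E -> R) (u w e : H1 Om) : L2 surf GN psi ->
  trace1 e = (fun x => trace1 u x - trace1 w x) ->
  bpair GN psi e = bpair GN psi u - bpair GN psi w.
Proof.
move=> Lpsi te; have [mG _] := bdryN_facts.
rewrite /bpair te -RintegralB//; try by apply: L2_prod => //; exact: L2_trace_GN.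
by apply: eq_Rintegral => x _; rewrite mulrBr.
Qed.

Lemma ell_sub (u w e : H1 Om) : val1 e = (fun x => val1 u x - val1 w x) ->
  grad1 e = (fun x => grad1 u x - grad1 w x) ->
  trace1 e = (fun x => trace1 u x - trace1 w x) ->
  ell P e = ell P u - ell P w.
Proof.
move=> ve ge te; rewrite /ell (bpair_sub L2_flux.1 te).
have : \sum_(p <- [::
  (1, inl (srcf1 P, val1 e)); (-1, inr (srcf2 P, grad1 e));
  (-1, inl (srcf1 P, val1 u)); (1, inr (srcf2 P, grad1 u));
  (1, inl (srcf1 P, val1 w)); (-1, inr (srcf2 P, grad1 w))]) p.1 * pairing p.2 = 0.
  apply: pairing_lincomb => [|x _ _ _]; first solve_L2.
  by rewrite !big_cons big_nil /= ve ge !dotDr !dotNr; ring.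
by rewrite !big_cons big_nil /=; lra.
Qed.

Lemma m_form_sub (u w e : H1 Om) : val1 e = (fun x => val1 u x - val1 w x) ->
  grad1 e = (fun x => grad1 u x - grad1 w x) ->
  trace1 e = (fun x => trace1 u x - trace1 w x) ->
  m_form P e = m_form P u - m_form P w.
Proof.
move=> ve ge te; rewrite /m_form (bpair_sub L2_flux.2 te).
have : \sum_(p <- [::
  (1, inl (srcg1 P, val1 e)); (-1, inr (srcg2 P, grad1 e));
  (-1, inl (srcg1 P, val1 u)); (1, inr (srcg2 P, grad1 u));
  (1, inl (srcg1 P, val1 w)); (-1, inr (srcg2 P, grad1 w))]) p.1 * pairing p.2 = 0.
  apply: pairing_lincomb => [|x _ _ _]; first solve_L2.
  by rewrite !big_cons big_nil /= ve ge !dotDr !dotNr; ring.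
by rewrite !big_cons big_nil /=; lra.
Qed.

Lemma eq_on_sub (phi : E -> R) (u w e : H1 Om) : eq_on GD u phi -> eq_on GD w phi ->
  trace1 e = (fun x => trace1 u x - trace1 w x) -> HD GD e.
Proof.
move=> hu hw te.
have aeF : Filter (almost_everywhere (@surf R d)) by exact: ae_filter_ringOfSetsType.
apply: (@filterS2 _ _ aeF _ _ _ _ hu hw) => x hux hwx Gx.
by rewrite te hux// hwx// subrr.
Qed.

Lemma primal_flux_pair (u z : H1 Om) (sigma : Hdiv Om) :
  primal_solution P u -> primal_flux P u sigma ->
  flux_pair P sigma z = ell P z - a_form P u z.
Proof.
move=> [_ hu] hsigma.
have F0 (s : H1 Om) : ipv Om (flux_residual_p sigma u) (grad1 s) = 0.
  rewrite -[RHS](_ : \int[leb]_(x in Om) (cst 0 x : R) = 0); last first.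
    by rewrite Rintegral_cst// mul0r.
  apply: (ae_eq_Rintegral mOm) => //.
  - exact: integrable_measurable (integrable_dot (L2v_flux_residual_p _ _) (H1_L2v s)).
  - apply: filterS hsigma => x hx Ox.
    by rewrite /flux_residual_p hx// /Amul addrAC subrK addNr dotE trmx0 mul0mx mxE.
have r0 : ip Om (residual_p2 P sigma u) (val1 z) = 0.
  apply: (ip_H1_eq0 oOm bOm); first exact: L2_residual_p2.
  move=> phi tphi; have [s [vs gs ts]] := exists_H1_test oOm bOm tphi.
  have sHD : HD GD s by apply: aeW => x _; rewrite ts.
  (* For a test function the weak divergence cancels the flux term and the zero trace cancels the
     Neumann term. *)
  have fp0 : flux_pair P sigma s = 0.
    rewrite /flux_pair vs gs; case: (sigma) => f q _ _ /= /(_ _ tphi) ->.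
    rewrite addNr sub0r /bpair ts.
    under eq_Rintegral do rewrite mulr0.
    by rewrite Rintegral_cst ?mul0r ?oppr0//; exact: bdryN_facts.1.
  have := primal_residual sigma u s.
  by rewrite hu// subrr fp0 F0 !add0r vs.
have := primal_residual sigma u z; rewrite F0 r0; lra.
Qed.

(** [e] competes in the infimum, and each quotient in its supremum is at most [B / H1norm e]. A
    vanishing norm is treated apart, since [HD0] consists of elements of nonzero norm. *)
Lemma infsup_bound (beta B : R) (e : H1 Om) : infsup P beta -> HD GD e -> 0 <= B ->
  (forall s, HD GD s -> `|a_form P e s| <= B * H1norm s) -> beta * H1norm e <= B.
Proof.
move=> [b0 bE _] eD B0 hB.
have n0 (s : H1 Om) : 0 <= H1norm s by exact: sqrtr_ge0.
have [->|e0] := eqVneq (H1norm e) 0; first by rewrite mulr0.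
have ep : 0 < H1norm e by rewrite lt0r e0 n0.
rewrite -ler_pdivlMr// -lee_fin bE.
apply: (@le_trans _ _ (ereal_sup
  [set (a_form P e v / (H1norm e * H1norm v))%:E | v in HD0 P])).
  by apply: ereal_inf_lbound; exists e.
apply: ge_ereal_sup => _ [v [vD v0] <-]; rewrite lee_fin.
have vp : 0 < H1norm v by rewrite lt0r v0 n0.
rewrite ler_pdivrMr ?mulr_gt0// mulrA divfK//.
exact: le_trans (ler_norm _) (hB v vD).
Qed.

End least_squares.

Theorem lemma7p1 (R : realType) (d : nat) (hd : (2 <= d)%N)
    (P : problem R d) (a0 a1 beta kappa : R) (T0 : seq 'M[R]_(d, d.+1))
    (hOm : lipschitz_domain (dom P))
    (hG : boundary_split (dom P) (bdryD P) (bdryN P))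
    (hcoef : coefficients P a0 a1) (hdata : data P)
    (hbeta : infsup P beta)
    (u : H1 (dom P)) (sigma : Hdiv (dom P)) (zd : H1 (dom P))
    (hu : primal_solution P u) (hsigma : primal_flux P u sigma)
    (hzd : eq_on (bdryD P) zd (dird P))
    (hT0 : triangulation (dom P) T0)
    (hbd : discrete_boundary_data P T0) :
  exists C : R, 0 < C /\
    forall (T : seq 'M[R]_(d, d.+1)),
      triangulation (dom P) T -> shape_regular kappa T -> refines T T0 ->
    forall (sigmah : Hdiv (dom P)) (uh : H1 (dom P))
           (rh : Hdiv (dom P)) (zh : H1 (dom P)),
      minimizer_p P T sigmah uh -> minimizer_d P T rh zh ->
      0 < etap P sigmah uh -> 0 < etad P rh zh ->
      let gamma := Jp P u sigma zd in
      let S := \sum_(K <- T) eta2 P sigmah uh rh zh K in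
      [/\ S = etap P sigmah uh * etad P rh zh,
          `|gamma - gamma0 P uh zh| <= C * S &
          `|gamma - gamma1 P uh sigmah zh rh| <= C * S].
Proof.
have b0 : 0 < beta by case: hbeta.
set c2 := Num.max a1 1.
have c1 : 1 <= c2 by rewrite le_max lexx orbT.
have c0 : 0 < c2 by exact: lt_le_trans c1.
exists (c2 / beta + 1); split; first by rewrite addr_gt0 ?divr_gt0.
move=> T triT _ _ sigmah uh rh zh [[_ ntp] [_ uhD] _] [[_ ntd] [_ zhD] _] ep0 ed0 gamma S.
have oOm : open (dom P) by case: hOm.
have bOm : bounded_set (dom P) by case: hOm.
have epE : etap P sigmah uh ^+ 2 = LSp P (dom P) sigmah uh.
  by rewrite sqr_sqrtr ?LSp_ge0.
have edE : etad P rh zh ^+ 2 = LSd P (dom P) rh zh.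
  by rewrite sqr_sqrtr ?LSd_ge0.
have d0 : (0 < d)%N by exact: ltnW.
have SE : S = etap P sigmah uh * etad P rh zh.
  rewrite /S /eta2 -mulr_sumr big_split /= -!mulr_sumr.
  rewrite (sum_LSp hOm hcoef hdata d0 triT) (sum_LSd hOm hcoef hdata d0 triT).
  rewrite -epE -edE; field.
  by rewrite !gt_eqF.
have [e [ve ge te]] := exists_H1_sub oOm bOm u uh.
have [y [vy gy ty]] := exists_H1_sub oOm bOm zd zh.
have eD : HD (bdryD P) e by exact: eq_on_sub hu.1 uhD te.
have yD : HD (bdryD P) y by exact: eq_on_sub hzd zhD ty.
have n0 (s : H1 (dom P)) : 0 <= H1norm s by exact: sqrtr_ge0.
have sc0 : 0 <= Num.sqrt c2 by exact: sqrtr_ge0.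
have sc : Num.sqrt c2 ^+ 2 = c2 by rewrite sqr_sqrtr// ltW.
have error_bound : beta * H1norm e <= Num.sqrt c2 * etap P sigmah uh.
  apply: (infsup_bound hbeta eD); first by rewrite mulr_ge0// ltW.
  move=> s sD; rewrite -(ger0_norm (mulr_ge0 (mulr_ge0 sc0 (ltW ep0)) (n0 s))).
  rewrite -ler_sqr ?nnegrE// !real_normK ?num_real//.
  have aE : a_form P e s = - (a_form P uh s - ell P s + flux_pair P sigmah s).
    rewrite (a_form_subl hOm hcoef s ve ge) hu.2// /flux_pair ntp// subrr addr0.
    by rewrite opprB.
  rewrite aE sqrrN (primal_residual hOm hcoef hdata).
  apply: le_trans (residual_bound hOm hcoef _ _ _) _.
  - exact: (L2v_flux_residual_p hOm hcoef hdata _ _).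
  - exact: (L2_residual_p2 hOm hcoef hdata).
  - by rewrite -(LSpE hOm hcoef hdata) -epE !exprMn sc -/c2; lra.
have g0E : gamma - gamma0 P uh zh = - (a_form P e zh - m_form P e).
  rewrite /gamma /Jp (primal_flux_pair hOm hcoef hdata hG zd hu hsigma) /gamma0.
  rewrite (a_form_subl hOm hcoef zh ve ge) (m_form_sub hOm hcoef hdata hG ve ge te).
  have := ell_sub hOm hcoef hdata hG vy gy ty.
  have := a_form_subr hOm hcoef u vy gy.
  have := hu.2 y yD; lra.
have g0_bound : `|gamma - gamma0 P uh zh| <= c2 / beta * S.
  apply: (@le_trans _ _ (Num.sqrt c2 * etad P rh zh * H1norm e)).
    rewrite -(ger0_norm (mulr_ge0 (mulr_ge0 sc0 (ltW ed0)) (n0 e))).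
    rewrite -ler_sqr ?nnegrE// !real_normK ?num_real// g0E sqrrN.
    rewrite (dual_residual hOm hcoef hdata zh (ntd e eD)).
    apply: le_trans (residual_bound hOm hcoef _ _ _) _.
    - exact: (L2v_flux_residual_d hOm hcoef hdata _ _).
    - exact: (L2_residual_d2 hOm hcoef hdata).
    - by rewrite -(LSdE hOm hcoef hdata) -edE !exprMn sc -/c2; lra.
  (* One factor [Num.sqrt c2] comes from the dual residual, the other from [error_bound]; together
     they give [c2 / beta]. *)
  rewrite SE [leRHS]mulrAC ler_pdivlMr// -[leLHS]mulrA (mulrC _ beta).
  apply: le_trans (ler_wpM2l (mulr_ge0 sc0 (ltW ed0)) error_bound) _.
  by rewrite -[X in _ <= X * _]sc; lra.
have S0 : 0 <= S by rewrite SE mulr_ge0// ltW.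
have g10_bound : `|gamma1 P uh sigmah zh rh - gamma0 P uh zh| <= S.
  rewrite (gamma1_sub_gamma0 hOm hcoef hdata) -(ger0_norm S0).
  rewrite -ler_sqr ?nnegrE// !real_normK ?num_real// SE exprMn epE edE.
  have LF := L2v_flux_residual_p hOm hcoef hdata sigmah uh.
  have LG := L2v_flux_residual_d hOm hcoef hdata rh zh.
  apply: (@le_trans _ _ (
    ipv (dom P) (flux_residual_p sigmah uh) (Ainv P (flux_residual_p sigmah uh)) *
    ipv (dom P) (flux_residual_d rh zh) (Ainv P (flux_residual_d rh zh)))).
    apply: Rintegral_CauchySchwarz.
    - exact: open_measurable_col.
    - exact: integrable_dot LF (L2v_Ainv hOm hcoef LG).
    - exact: integrable_dot LF (L2v_Ainv hOm hcoef LF).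
    - exact: integrable_dot LG (L2v_Ainv hOm hcoef LG).
    - apply: (elliptic_aeP hcoef) => x _ AT ell; split.
      + exact: dot_invmx_ge0 (a0_gt0 hcoef) AT ell _.
      + exact: dot_invmx_ge0 (a0_gt0 hcoef) AT ell _.
      + exact: dot_invmx_CS (a0_gt0 hcoef) AT ell _ _.
  rewrite (LSpE hOm hcoef hdata) (LSdE hOm hcoef hdata).
  by apply: ler_pM; rewrite ?(ipv_Ainv_ge0 hOm hcoef) ?lerDl ?ip_ge0.
split => //; first by apply: le_trans g0_bound _; rewrite mulrDl mul1r lerDl.
rewrite -(subrK (gamma0 P uh zh) gamma) -addrA (mulrDl _ 1) mul1r.
by rewrite (le_trans (ler_normD _ _))// lerD// distrC.
Qed.
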